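(* Let $\Gamma=(V,E,s,r)$ be a finite directed graph. Then the center $Z(CK(\Gamma))$ of the Cuntz-Krieger $C^*$-algebra $CK(\Gamma)$ is isomorphic to a finite direct sum $\mathbb{C}\oplus\cdots\oplus\mathbb{C}\oplus T\oplus\cdots\oplus T$, where $T$ is the $C^*$-algebra of continuous complex-valued functions on the unit circle; that is, there are integers $k,l\ge0$ with $Z(CK(\Gamma))\cong\mathbb{C}^k\oplus T^l$.
   Context: A directed graph $\Gamma=(V,E,s,r)$ consists of a set $V$ of vertices, a set $E$ of edges, and maps $s,r:E\to V$ (source and range). It is finite if $V$ and $E$ are finite. $CK(\Gamma)$ is the universal $C^*$-algebra generated by $V\cup E$, where the elements of $V$ are mutually orthogonal projections, subject to: (1) $s(e)e=er(e)=e$ for all $e\in E$; (2) $e^*f=\delta_{e,f}r(f)$ for all $e,f\in E$; (3) $v=\sum_{e\in s^{-1}(v)}ee^*$ whenever $s^{-1}(v)\neq\emptyset$. *)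

(* Defs.v *)
From HB Require Import structures.
From mathcomp Require Import all_boot all_order all_algebra.
From mathcomp Require Import complex.
From mathcomp Require Import all_classical reals topology normedtype.
Set Implicit Arguments.
Unset Strict Implicit.
Unset Printing Implicit Defensive.
Import Order.TTheory GRing.Theory Num.Theory.
Import numFieldNormedType.Exports.
Local Open Scope classical_set_scope.
Local Open Scope ring_scope.
Local Open Scope complex_scope.

Local Notation Re := complex.Re.
Local Notation Im := complex.Im.

(** C*-algebras are not assumed unital, so the ring structures of the library do
    not apply and the product is a separate operation [cmul]; the zero algebra
    is allowed. Norms are [R[i]]-valued, as in [normedModType R[i]]. *)
HB.mixin Record isCStarAlgebra (R : realType) A & CompleteNormedModule R[i] A := {
  cmul : A -> A -> A;
  cstar : A -> A;
  cmulA : forall x y z, cmul x (cmul y z) = cmul (cmul x y) z;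
  cmulDl : forall x y z, cmul (x + y) z = cmul x z + cmul y z;
  cmulDr : forall x y z, cmul x (y + z) = cmul x y + cmul x z;
  cmulZl : forall (a : R[i]) x y, cmul (a *: x) y = a *: cmul x y;
  cmulZr : forall (a : R[i]) x y, cmul x (a *: y) = a *: cmul x y;
  cstarK : forall x, cstar (cstar x) = x;
  cstarD : forall x y, cstar (x + y) = cstar x + cstar y;
  cstarZ : forall (a : R[i]) x, cstar (a *: x) = a^* *: cstar x;
  cstarM : forall x y, cstar (cmul x y) = cmul (cstar y) (cstar x);
  normcmul : forall x y, `|cmul x y| <= `|x| * `|y|;
  normcstar : forall x, `|cmul (cstar x) x| = `|x| ^+ 2
}.

#[short(type="cstarType")]
HB.structure Definition CStarAlgebra (R : realType) :=
  {A of CompleteNormedModule R[i] A & isCStarAlgebra R A}.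

Lemma normC_ReE (R : realType) (V : normedModType R[i]) (x : V) :
  `|x| = (Re `|x|)%:C.
Proof. by rewrite RRe_real// ger0_real. Qed.

Lemma ReC_ge0 (R : realType) (V : normedModType R[i]) (x : V) : 0 <= Re `|x|.
Proof. by rewrite -ler0c -normC_ReE. Qed.

Lemma ge0C_ReE (R : realType) (x : R[i]) : 0 <= x -> x = (Re x)%:C.
Proof. by move=> x0; rewrite RRe_real// ger0_real. Qed.

Lemma normcstar_id (R : realType) (A : cstarType R) (x : A) : `|cstar x| = `|x|.
Proof.
have H (y : A) : `|y| <= `|cstar y|.
  have [->//|y0] := eqVneq y 0; first by rewrite normr0.
  have y1 : 0 < `|y| by rewrite normr_gt0.
  by rewrite -(ler_pM2r y1) -expr2 -normcstar normcmul.
by apply/eqP; rewrite eq_le H -{2}(cstarK x) H.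
Qed.

(** Builds a C*-algebra structure on [A] from an embedding [ev] as a uniformly
    closed *-algebra of bounded functions from [I] to [B]; [fnormP] says that
    [fnorm] is the sup-norm. *)
HB.factory Record isCStarFunctions (R : realType) (I : Type) (B : cstarType R) A
    & GRing.Lmodule R[i] A := {
  fmul : A -> A -> A;
  fstar : A -> A;
  fnorm : A -> R[i];
  ev : I -> A -> B;
  ev_linear : forall i (a : R[i]) x y, ev i (a *: x + y) = a *: ev i x + ev i y;
  ev_mul : forall i x y, ev i (fmul x y) = cmul (ev i x) (ev i y);
  ev_star : forall i x, ev i (fstar x) = cstar (ev i x);
  ev_inj : forall x y, (forall i, ev i x = ev i y) -> x = y;
  fnorm_ge0 : forall x, 0 <= fnorm x;
  fnormP : forall x (c : R), 0 <= c ->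
    (fnorm x <= c%:C) <-> (forall i, `|ev i x| <= c%:C);
  ev_closed : forall h : I -> B,
    (forall e : R, 0 < e -> exists x, forall i, `|ev i x - h i| <= e%:C) ->
    exists x, forall i, ev i x = h i
}.

HB.builders Context R I B A & isCStarFunctions R I B A.

Let evD i x y : ev i (x + y) = ev i x + ev i y.
Proof. by have := ev_linear i 1 x y; rewrite !scale1r. Qed.

Let ev0 i : ev i 0 = 0.
Proof. by apply: (addrI (ev i 0)); rewrite -evD !addr0. Qed.

Let evZ i a x : ev i (a *: x) = a *: ev i x.
Proof. by have := ev_linear i a x 0; rewrite !addr0 ev0 addr0. Qed.

Let evB i x y : ev i (x - y) = ev i x - ev i y.
Proof. by rewrite evD -scaleN1r evZ scaleN1r. Qed.

Let fnormE x : fnorm x = (Re (fnorm x))%:C.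
Proof. exact/ge0C_ReE/fnorm_ge0. Qed.

Let Refnorm_ge0 x : 0 <= Re (fnorm x).
Proof. by rewrite -ler0c -fnormE fnorm_ge0. Qed.

Let ev_le x i : `|ev i x| <= fnorm x.
Proof.
by rewrite fnormE; apply/(fnormP x (Refnorm_ge0 x)).1; rewrite -fnormE.
Qed.

Let fnorm_le x (c : R[i]) : 0 <= c -> (forall i, `|ev i x| <= c) -> fnorm x <= c.
Proof.
move=> c0; rewrite (ge0C_ReE c0) => H; apply/fnormP => //.
by rewrite -lecR -(ge0C_ReE c0).
Qed.

Let fnormD x y : fnorm (x + y) <= fnorm x + fnorm y.
Proof.
apply: fnorm_le => [|i]; first by rewrite addr_ge0// fnorm_ge0.
by rewrite evD (le_trans (ler_normD _ _))// lerD// ev_le.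
Qed.

Let fnormZ (l : R[i]) x : fnorm (l *: x) = `|l| * fnorm x.
Proof.
have H (a : R[i]) y : fnorm (a *: y) <= `|a| * fnorm y.
  apply: fnorm_le => [|i]; first by rewrite mulr_ge0// fnorm_ge0.
  by rewrite evZ normrZ ler_wpM2l// ev_le.
apply/eqP; rewrite eq_le H /=; have [->|l0] := eqVneq l 0.
  by rewrite normr0 mul0r fnorm_ge0.
have := H l^-1 (l *: x); rewrite scalerA mulVf// scale1r normrV ?unitfE//.
by rewrite -ler_pdivrMl ?invr_gt0 ?normr_gt0// invrK.
Qed.

Let fnorm0_eq0 x : fnorm x = 0 -> x = 0.
Proof.
move=> x0; apply: ev_inj => i; rewrite ev0; apply/eqP.
by rewrite -normr_le0 -x0 ev_le.
Qed.

HB.instance Definition _ :=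
  Lmodule_isNormed.Build R[i] A fnormD fnormZ fnorm0_eq0.

Let evnE (x : A) : `|x| = fnorm x. Proof. by []. Qed.

Let completeA (F : set_system A) : ProperFilter F -> cauchy F -> cvg F.
Proof.
move=> FF /cauchyP Fc.
have Fcv i : cvg (ev i @ F).
  apply: cauchy_cvg; apply/cauchyP => e e0.
  have [x Fx] := Fc _ e0; exists (ev i x).
  apply: (@filterS _ F _ (ball x e)) => // y; rewrite -!ball_normE /= => xy.
  change (is_true (`|ev i x - ev i y| < e)).
  by rewrite -evB (le_lt_trans _ xy)// evnE ev_le.
pose h i := lim (ev i @ F).
have hP x e : F (ball x e) -> forall i, `|ev i x - h i| <= e.
  move=> Fx i.
  have e0 : 0 < e.
    have [y] := filter_ex Fx.
    by rewrite -ball_normE /=; exact: le_lt_trans.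
  apply/ler_addgt0Pr => d d0.
  have /cvgrPdist_lt/(_ d d0) Fh := Fcv i.
  have [y [/= yx yh]] := filter_ex (filterI Fx Fh).
  rewrite -(subrKA (ev i y)) (le_trans (ler_normD _ _))// lerD//; last first.
    by rewrite distrC ltW.
  rewrite -evB (le_trans (ev_le _ _))// ltW//.
have [a ah] : exists a, forall i, ev i a = h i.
  apply: ev_closed => e e0; have e0' : 0 < e%:C by rewrite ltcR.
  by have [x Fx] := Fc _ e0'; exists x; exact: hP.
apply: (cvgP a); apply/cvgrPdist_lt => e e0.
have e20 : 0 < e / 2 by rewrite divr_gt0.
have [x Fx] := Fc _ e20.
have ax : `|a - x| <= e / 2.
  rewrite distrC evnE; apply: fnorm_le; first exact: ltW.
  by move=> i; rewrite evB ah; exact: hP.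
apply: filterS Fx => y; rewrite -ball_normE /= => xy.
rewrite -(subrKA x) (le_lt_trans (ler_normD _ _))// (splitr e).
exact: ler_ltD.
Qed.

HB.instance Definition _ := Uniform_isComplete.Build A completeA.

Let fmulA x y z : fmul x (fmul y z) = fmul (fmul x y) z.
Proof. by apply: ev_inj => i; rewrite !ev_mul cmulA. Qed.
Let fmulDl x y z : fmul (x + y) z = fmul x z + fmul y z.
Proof. by apply: ev_inj => i; rewrite evD !ev_mul evD cmulDl. Qed.
Let fmulDr x y z : fmul x (y + z) = fmul x y + fmul x z.
Proof. by apply: ev_inj => i; rewrite evD !ev_mul evD cmulDr. Qed.
Let fmulZl (a : R[i]) x y : fmul (a *: x) y = a *: fmul x y.
Proof. by apply: ev_inj => i; rewrite evZ !ev_mul evZ cmulZl. Qed.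
Let fmulZr (a : R[i]) x y : fmul x (a *: y) = a *: fmul x y.
Proof. by apply: ev_inj => i; rewrite evZ !ev_mul evZ cmulZr. Qed.
Let fstarK x : fstar (fstar x) = x.
Proof. by apply: ev_inj => i; rewrite !ev_star cstarK. Qed.
Let fstarD x y : fstar (x + y) = fstar x + fstar y.
Proof. by apply: ev_inj => i; rewrite evD !ev_star evD cstarD. Qed.
Let fstarZ (a : R[i]) x : fstar (a *: x) = a^* *: fstar x.
Proof. by apply: ev_inj => i; rewrite evZ !ev_star evZ cstarZ. Qed.
Let fstarM x y : fstar (fmul x y) = fmul (fstar y) (fstar x).
Proof. by apply: ev_inj => i; rewrite ev_mul !ev_star ev_mul cstarM. Qed.

Let normfmul (x y : A) : `|fmul x y| <= `|x| * `|y|.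
Proof.
rewrite !evnE; apply: fnorm_le => [|i]; first by rewrite mulr_ge0// fnorm_ge0.
by rewrite ev_mul (le_trans (normcmul _ _))// ler_pM// ev_le.
Qed.

Let normfstar (x : A) : `|fmul (fstar x) x| = `|x| ^+ 2.
Proof.
apply/eqP; rewrite eq_le; apply/andP; split.
  rewrite (le_trans (normfmul _ _))// expr2 ler_wpM2r//.
  rewrite !evnE; apply: fnorm_le => [|i]; first exact: fnorm_ge0.
  by rewrite ev_star normcstar_id ev_le.
rewrite -[leRHS]sqrtCK lerXn2r ?nnegrE ?sqrtC_ge0//.
rewrite !evnE; apply: fnorm_le => [|i]; first by rewrite sqrtC_ge0 fnorm_ge0.
rewrite -[leLHS](@sqrCK _ `|ev i x|)// ler_sqrtC ?qualifE/= ?exprn_ge0 ?fnorm_ge0//.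
by rewrite -normcstar -ev_star -ev_mul ev_le.
Qed.

HB.instance Definition _ := isCStarAlgebra.Build R A fmulA fmulDl fmulDr
  fmulZl fmulZr fstarK fstarD fstarZ fstarM normfmul normfstar.

HB.end.

(** An alias of [R[i]^o]: the completeness instance attached to [_^o] itself is
    the one for real numbers. *)
Definition cplx (R : realType) : Type := (R[i])^o.
HB.instance Definition _ (R : realType) := NormedModule.copy (cplx R) (R[i])^o.

Section cplx.
Variable R : realType.

Let Re_le (z : R[i]) : `|Re z| <= Re `|z|.
Proof. by rewrite -lecR -(ge0C_ReE (normr_ge0 z)) normc_ge_Re. Qed.

Let normi : `|'i%C : R[i]| = 1.
Proof. by rewrite normc_def /= expr0n expr1n add0r sqrtr1. Qed.

Let normR (x : R) : `|x%:C| = `|x|%:C.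
Proof. by rewrite normc_def /= expr0n addr0 sqrtr_sqr. Qed.

Let Im_le (z : R[i]) : `|Im z| <= Re `|z|.
Proof.
have -> : Im z = Re (- (z * 'i%C)) by case: z => a b /=; rewrite mulr0 mulr1 sub0r opprK.
by rewrite (le_trans (Re_le _))// normrN normrM normi mulr1.
Qed.

Let norm_le_ReIm (z : R[i]) : `|z| <= (`|Re z| + `|Im z|)%:C.
Proof.
rewrite [in leLHS](complexE z) (le_trans (ler_normD _ _))// rmorphD /= normR.
by rewrite normrM normi mul1r normR.
Qed.

Let cplx_complete (F : set_system (cplx R)) : ProperFilter F -> cauchy F -> cvg F.
Proof.
move=> FF /cauchyP Fc.
have part (g : R[i] -> R) : {morph g : x y / x - y} ->
    (forall z, `|g z| <= Re `|z|) -> cvg ((g : cplx R -> R) @ F).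
  move=> gB gle; apply: cauchy_cvg; apply/cauchyP => e e0.
  have e0' : 0 < e%:C by rewrite ltcR.
  have [x Fx] := Fc _ e0'; exists (g x).
  apply: (@filterS _ F _ (ball x e%:C)) => // y; rewrite -!ball_normE /= => xy.
  change (is_true (`|g x - g y| < e)).
  rewrite -gB (le_lt_trans (gle _))// -ltcR; move: xy.
  by rewrite [X in X < _ -> _]normC_ReE.
have /cvgrPdist_lt ReF : cvg ((@complex.Re R : cplx R -> R) @ F).
  by apply: part => // -[a b] [c d].
have /cvgrPdist_lt ImF : cvg ((@complex.Im R : cplx R -> R) @ F).
  by apply: part => // -[a b] [c d].
apply: (cvgP (lim ((@complex.Re R : cplx R -> R) @ F)
  +i* lim ((@complex.Im R : cplx R -> R) @ F) : cplx R)).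
apply/cvgrPdist_lt => e e0.
have eE : e = (Re e)%:C by rewrite -ge0C_ReE// ltW.
have e20 : 0 < Re e / 2 by rewrite divr_gt0// -ltcR -eE.
near=> z; rewrite eE (le_lt_trans (norm_le_ReIm _))// ltcR (splitr (Re e)).
have -> : Re ((lim ((@complex.Re R : cplx R -> R) @ F)
  +i* lim ((@complex.Im R : cplx R -> R) @ F) : cplx R) - z) =
  lim ((@complex.Re R : cplx R -> R) @ F) - Re z by case: (z).
have -> : Im ((lim ((@complex.Re R : cplx R -> R) @ F)
  +i* lim ((@complex.Im R : cplx R -> R) @ F) : cplx R) - z) =
  lim ((@complex.Im R : cplx R -> R) @ F) - Im z by case: (z).
by rewrite ltrD//; near: z; [exact: ReF|exact: ImF].
Unshelve. all: by end_near. Qed.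

HB.instance Definition _ := Uniform_isComplete.Build (cplx R) cplx_complete.

Let cplx_mul (x y : cplx R) : cplx R := (x : R[i]) * (y : R[i]).
Let cplx_star (x : cplx R) : cplx R := (x : R[i])^*.

Let cplx_mulA x y z : cplx_mul x (cplx_mul y z) = cplx_mul (cplx_mul x y) z.
Proof. exact: mulrA. Qed.
Let cplx_mulDl (x y z : cplx R) :
  cplx_mul (x + y) z = cplx_mul x z + cplx_mul y z.
Proof. exact: (@mulrDl R[i]). Qed.
Let cplx_mulDr (x y z : cplx R) :
  cplx_mul x (y + z) = cplx_mul x y + cplx_mul x z.
Proof. exact: (@mulrDr R[i]). Qed.
Let cplx_mulZl (a : R[i]) (x y : cplx R) :
  cplx_mul (a *: x) y = a *: cplx_mul x y.
Proof. by rewrite /cplx_mul -[RHS]/(a * _) mulrA. Qed.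
Let cplx_mulZr (a : R[i]) (x y : cplx R) :
  cplx_mul x (a *: y) = a *: cplx_mul x y.
Proof. by rewrite /cplx_mul -[RHS]/(a * _) mulrCA. Qed.
Let cplx_starK x : cplx_star (cplx_star x) = x.
Proof. exact: conjcK. Qed.
Let cplx_starD (x y : cplx R) : cplx_star (x + y) = cplx_star x + cplx_star y.
Proof. exact: (rmorphD (@conjc R)). Qed.
Let cplx_starZ (a : R[i]) (x : cplx R) :
  cplx_star (a *: x) = a^* *: cplx_star x.
Proof. exact: (rmorphM (@conjc R)). Qed.
Let cplx_starM x y : cplx_star (cplx_mul x y) = cplx_mul (cplx_star y) (cplx_star x).
Proof. by rewrite /cplx_mul mulrC; exact: (rmorphM (@conjc R)). Qed.
Let cplx_normM (x y : cplx R) : `|cplx_mul x y| <= `|x| * `|y|.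
Proof. by rewrite -(@normrM R[i]). Qed.
Let cplx_normstar (x : cplx R) : `|cplx_mul (cplx_star x) x| = `|x| ^+ 2.
Proof.
by rewrite /cplx_mul (@normrM R[i]) expr2 /cplx_star; congr (_ * _); exact: normcJ.
Qed.

HB.instance Definition _ := isCStarAlgebra.Build R (cplx R) cplx_mulA cplx_mulDl
  cplx_mulDr cplx_mulZl cplx_mulZr cplx_starK cplx_starD cplx_starZ cplx_starM
  cplx_normM cplx_normstar.

Lemma cplx_cmulE (x y : cplx R) : cmul x y = (x : R[i]) * (y : R[i]).
Proof. by []. Qed.

Lemma cplx_cstarE (x : cplx R) : cstar x = (x : R[i])^*.
Proof. by []. Qed.

End cplx.

Definition cstar_central (R : realType) (A : cstarType R) : {pred A} :=
  fun x => `[< forall y, cmul x y = cmul y x >].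
Arguments cstar_central {R} A _.

Section cstar_center.
Variables (R : realType) (A : cstarType R).

Lemma centralP (x : A) : reflect (forall y, cmul x y = cmul y x) (x \in cstar_central A).
Proof. exact: asboolP. Qed.

Lemma cmul0x (x : A) : cmul 0 x = 0.
Proof. by rewrite -(scale0r 0) cmulZl !scale0r. Qed.

Lemma cmulx0 (x : A) : cmul x 0 = 0.
Proof. by rewrite -(scale0r 0) cmulZr !scale0r. Qed.

Lemma cmulN (x y : A) : cmul (- x) y = - cmul x y.
Proof. by rewrite -scaleN1r cmulZl scaleN1r. Qed.

Lemma cmulxN (x y : A) : cmul x (- y) = - cmul x y.
Proof. by rewrite -scaleN1r cmulZr scaleN1r. Qed.

Fact central_submod_closed : submod_closed (cstar_central A).
Proof.
split=> [|a x y /centralP xC /centralP yC]; apply/centralP => z.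
  by rewrite cmul0x cmulx0.
by rewrite cmulDl cmulDr cmulZl cmulZr xC yC.
Qed.

HB.instance Definition _ :=
  GRing.isSubmodClosed.Build R[i] A (cstar_central A) central_submod_closed.

Record cstar_center : Type :=
  CStarCenter { center_val :> A; _ : center_val \in cstar_central A }.
HB.instance Definition _ := [isSub for center_val].
HB.instance Definition _ := [Choice of cstar_center by <:].
HB.instance Definition _ := [SubChoice_isSubLmodule of cstar_center by <:].

Lemma center_valP (x : cstar_center) : (x : A) \in cstar_central A.
Proof. by case: x. Qed.

Fact center_mul_subproof (x y : cstar_center) : cmul (x : A) y \in cstar_central A.
Proof.
apply/centralP => z; have /centralP xC := center_valP x.
have /centralP yC := center_valP y.
by rewrite -cmulA yC cmulA xC cmulA.
Qed.

Fact center_star_subproof (x : cstar_center) : cstar (x : A) \in cstar_central A.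
Proof.
apply/centralP => z; have /centralP xC := center_valP x.
by rewrite -[z]cstarK -!cstarM xC.
Qed.

Let center_mul (x y : cstar_center) : cstar_center :=
  CStarCenter (center_mul_subproof x y).
Let center_star (x : cstar_center) : cstar_center :=
  CStarCenter (center_star_subproof x).

Let center_closed (h : unit -> A) :
  (forall e : R, 0 < e -> exists x : cstar_center, forall i : unit,
     `|(x : A) - h i| <= e%:C) ->
  exists x : cstar_center, forall i : unit, x = h i :> A.
Proof.
move=> H; suff hC : h tt \in cstar_central A by exists (CStarCenter hC) => -[].
apply/centralP => z; apply/eqP; rewrite -subr_eq0 -normr_le0.
apply/ler_addgt0Pr => e e0; rewrite add0r.
have eE : e = (Re e)%:C by rewrite -ge0C_ReE// ltW.
have z1 : 0 < `|z| + `|z| + 1 by rewrite ltr_wpDl// addr_ge0.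
have d0 : 0 < e / (`|z| + `|z| + 1) by rewrite divr_gt0.
have dE := ge0C_ReE (ltW d0).
have d0' : 0 < Re (e / (`|z| + `|z| + 1)) by rewrite -ltcR -dE.
have [x /(_ tt)] := H _ d0'; rewrite -dE => xh.
have /centralP/(_ z) xC := center_valP x.
have -> : cmul (h tt) z - cmul z (h tt) =
    cmul z ((x : A) - h tt) - cmul ((x : A) - h tt) z.
  by rewrite cmulDl cmulDr cmulN cmulxN xC opprD opprK addrC addrACA subrr add0r addrC.
rewrite (le_trans (ler_normB _ _))//.
apply: (@le_trans _ _ (`|z| * `|(x : A) - h tt| + `|(x : A) - h tt| * `|z|)).
  by rewrite lerD// normcmul.
rewrite [leLHS](_ : _ = `|(x : A) - h tt| * (`|z| + `|z|)); last first.
  by rewrite mulrDr mulrC.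
apply: (@le_trans _ _ (e / (`|z| + `|z| + 1) * (`|z| + `|z| + 1))).
  by rewrite ler_pM// ?addr_ge0// lerDl.
by rewrite divfK// gt_eqF.
Qed.

Let center_norm (x : cstar_center) : R[i] := `|x : A|.

Let center_normP (x : cstar_center) (c : R) : 0 <= c ->
  (center_norm x <= c%:C) <-> (forall i : unit, `|x : A| <= c%:C).
Proof. by move=> _; split=> // /(_ tt). Qed.

HB.instance Definition _ := @isCStarFunctions.Build R unit A cstar_center
  center_mul center_star center_norm (fun=> center_val)
  (fun _ a x y => erefl) (fun _ x y => erefl) (fun _ x => erefl)
  (fun x y xy => val_inj (xy tt)) (fun x => normr_ge0 _)
  center_normP center_closed.

End cstar_center.
Arguments cstar_center {R} A.

Section center_theory.
Variables (R : realType) (A : cstarType R).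

Lemma center_cmulE (x y : cstar_center A) : cmul x y = cmul (x : A) (y : A) :> A.
Proof. by []. Qed.

Lemma center_cstarE (x : cstar_center A) : cstar x = cstar (x : A) :> A.
Proof. by []. Qed.

Lemma center_normE (x : cstar_center A) : `|x| = `|x : A|. Proof. by []. Qed.

End center_theory.

Section supnorm.
Variables (R : realType) (I : Type) (B : cstarType R).

Definition supnorm (f : I -> B) : R[i] := (sup [set Re `|f i| | i in setT])%:C.

Lemma supnorm_ge0 (f : I -> B) : 0 <= supnorm f.
Proof.
rewrite /supnorm ler0c; set S := [set _ | _ in _].
have [supS|supS] := pselect (has_sup S); last by rewrite sup_out.
case: supS => [[_ [i _ _]] ubS].
by rewrite (le_trans (ReC_ge0 (f i)))//; apply: ub_le_sup => //; exists i.
Qed.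

Lemma supnormP (f : I -> B) (c : R) :
  (exists M : R, forall i, `|f i| <= M%:C) -> 0 <= c ->
  (supnorm f <= c%:C) <-> (forall i, `|f i| <= c%:C).
Proof.
move=> [M fM] c0; rewrite /supnorm lecR; split=> [fc i|fc].
  rewrite normC_ReE lecR (le_trans _ fc)//; apply: ub_le_sup; last by exists i.
  by exists M => _ [j _ <-]; rewrite -lecR -normC_ReE.
have [ [x0]|I0] := pselect (inhabited I).
  apply: ge_sup; first by exists (Re `|f x0|), x0.
  by move=> _ [j _ <-]; rewrite -lecR -normC_ReE.
rewrite (_ : [set _ | _ in _] = set0) ?sup0//.
by rewrite -subset0 => y [i _ _]; apply: I0; constructor.
Qed.

End supnorm.

Section finite_power.
Variables (R : realType) (I : finType) (B : cstarType R).
Local Notation BI := {ffun I -> B}.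

Let ffun_cmul (f g : BI) : BI := [ffun i => cmul (f i) (g i)].
Let ffun_cstar (f : BI) : BI := [ffun i => cstar (f i)].

Let ffun_ev_linear (i : I) (a : R[i]) (f g : BI) : (a *: f + g) i = a *: f i + g i.
Proof. by rewrite !ffunE. Qed.

Let ffun_normP (f : BI) (c : R) : 0 <= c ->
  (supnorm f <= c%:C) <-> (forall i : I, `|f i| <= c%:C).
Proof.
apply: supnormP; exists (\sum_i Re `|f i|) => i.
rewrite normC_ReE lecR (bigD1 i)//= lerDl sumr_ge0// => j _; exact: ReC_ge0.
Qed.

Let ffun_closed (h : I -> B) :
  (forall e : R, 0 < e -> exists f : BI, forall i : I, `|f i - h i| <= e%:C) ->
  exists f : BI, forall i, f i = h i.
Proof. by move=> _; exists [ffun i => h i] => i; rewrite ffunE. Qed.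

HB.instance Definition _ := @isCStarFunctions.Build R I B {ffun I -> B}
  ffun_cmul ffun_cstar (fun f => supnorm f) (fun i f => f i) ffun_ev_linear
  (fun i f g => ffunE _ _) (fun i f => ffunE _ _) (fun f g => (ffunP f g).1)
  (fun f => supnorm_ge0 f) ffun_normP ffun_closed.

Lemma ffun_cmulE (f g : BI) i : cmul f g i = cmul (f i) (g i).
Proof. exact: ffunE. Qed.

Lemma ffun_cstarE (f : BI) i : cstar f i = cstar (f i).
Proof. exact: ffunE. Qed.

Lemma ffun_normE (f : BI) : `|f| = supnorm f. Proof. by []. Qed.

End finite_power.

Section direct_sum.
Variables (R : realType) (A B : cstarType R).
Local Notation AB := (A * B)%type.

HB.instance Definition _ := NormedModule.copy (A * B)%type (AB : normedModType R[i]).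

Let prod_complete (F : set_system AB) : ProperFilter F -> cauchy F -> cvg F.
Proof.
move=> FF /cauchyP Fc.
have c1 : cvg (fst @ F).
  apply: cauchy_cvg; apply/cauchyP => e e0; have [x Fx] := Fc _ e0.
  by exists x.1; apply: (@filterS _ F _ (ball x e)) => // y [].
have c2 : cvg (snd @ F).
  apply: cauchy_cvg; apply/cauchyP => e e0; have [x Fx] := Fc _ e0.
  by exists x.2; apply: (@filterS _ F _ (ball x e)) => // y [].
apply: (cvgP (lim (fst @ F), lim (snd @ F))).
have -> : F = (fun z : AB => (z.1, z.2)) @ F.
  by apply/seteqP; split => X /=; rewrite /nbhs /=; apply: filterS => -[].
exact: cvg_pair.
Qed.

HB.instance Definition _ := Uniform_isComplete.Build (A * B)%type prod_complete.

Let prod_cmul (x y : AB) : AB := (cmul x.1 y.1, cmul x.2 y.2).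
Let prod_cstar (x : AB) : AB := (cstar x.1, cstar x.2).

Let prod_cmulA x y z : prod_cmul x (prod_cmul y z) = prod_cmul (prod_cmul x y) z.
Proof. by rewrite /prod_cmul/= !cmulA. Qed.
Let prod_cmulDl (x y z : AB) :
  prod_cmul (x + y) z = prod_cmul x z + prod_cmul y z.
Proof. by rewrite /prod_cmul/= !cmulDl. Qed.
Let prod_cmulDr (x y z : AB) :
  prod_cmul x (y + z) = prod_cmul x y + prod_cmul x z.
Proof. by rewrite /prod_cmul/= !cmulDr. Qed.
Let prod_cmulZl (a : R[i]) (x y : AB) :
  prod_cmul (a *: x) y = a *: prod_cmul x y.
Proof. by rewrite /prod_cmul/= !cmulZl. Qed.
Let prod_cmulZr (a : R[i]) (x y : AB) :
  prod_cmul x (a *: y) = a *: prod_cmul x y.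
Proof. by rewrite /prod_cmul/= !cmulZr. Qed.
Let prod_cstarK x : prod_cstar (prod_cstar x) = x.
Proof. by rewrite /prod_cstar/= !cstarK; case: x. Qed.
Let prod_cstarD (x y : AB) : prod_cstar (x + y) = prod_cstar x + prod_cstar y.
Proof. by rewrite /prod_cstar/= !cstarD. Qed.
Let prod_cstarZ (a : R[i]) (x : AB) :
  prod_cstar (a *: x) = a^* *: prod_cstar x.
Proof. by rewrite /prod_cstar/= !cstarZ. Qed.
Let prod_cstarM x y :
  prod_cstar (prod_cmul x y) = prod_cmul (prod_cstar y) (prod_cstar x).
Proof. by rewrite /prod_cstar/prod_cmul/= !cstarM. Qed.

Let prod_normC (x : AB) : `|x| = (Num.max (Re `|x.1|) (Re `|x.2|))%:C.
Proof.
rewrite (_ : `|x| = Num.max `|x.1| `|x.2|)// /Order.max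
  (normC_ReE x.1) (normC_ReE x.2) ltcR /=.
by case: ifP.
Qed.

Let prod_normcmul (x y : AB) : `|prod_cmul x y| <= `|x| * `|y|.
Proof.
have H (u v w u' v' w' : R) : 0 <= v -> 0 <= w -> u <= v * w -> 
  v <= v' -> w <= w' -> u <= v' * w'.
  by move=> v0 w0 /le_trans uvw vv' ww'; apply: uvw; rewrite ler_pM.
rewrite !prod_normC -rmorphM /= lecR ge_max; apply/andP; split.
- apply: (H _ (Re `|x.1|) (Re `|y.1|) 0); rewrite ?ReC_ge0 ?le_max ?lexx//.
  by rewrite -lecR rmorphM /= -!normC_ReE normcmul.
- apply: (H _ (Re `|x.2|) (Re `|y.2|) 0); rewrite ?ReC_ge0 ?le_max ?lexx ?orbT//.
  by rewrite -lecR rmorphM /= -!normC_ReE normcmul.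
Qed.

Let prod_normcstar (x : AB) : `|prod_cmul (prod_cstar x) x| = `|x| ^+ 2.
Proof.
rewrite !prod_normC /= !normcstar (normC_ReE x.1) (normC_ReE x.2) -!rmorphXn /=.
congr (_%:C); have x1 := ReC_ge0 x.1; have x2 := ReC_ge0 x.2.
have [le12|/ltW le21] := leP (Re `|x.1|) (Re `|x.2|).
  by rewrite max_r// lerXn2r ?nnegrE.
by rewrite max_l// lerXn2r ?nnegrE.
Qed.

HB.instance Definition _ := isCStarAlgebra.Build R (A * B)%type prod_cmulA
  prod_cmulDl prod_cmulDr prod_cmulZl prod_cmulZr prod_cstarK prod_cstarD
  prod_cstarZ prod_cstarM prod_normcmul prod_normcstar.

Lemma prod_cmulE (x y : AB) : cmul x y = (cmul x.1 y.1, cmul x.2 y.2).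
Proof. by []. Qed.

Lemma prod_cstarE (x : AB) : cstar x = (cstar x.1, cstar x.2).
Proof. by []. Qed.

Lemma prod_cnormE (x : AB) : `|x| = Num.max `|x.1| `|x.2|. Proof. by []. Qed.

End direct_sum.

Lemma Renorm_continuous (R : realType) (V : normedModType R[i]) :
  continuous (fun z : V => Re `|z|).
Proof.
move=> z; apply/cvgrPdist_lt => e e0; have e0' : 0 < e%:C by rewrite ltcR.
have /cvgrPdist_lt/(_ _ e0') : (id : V -> V) @ z --> z by [].
apply: filterS => y /= zy.
have {zy} : Re `|z - y| < e by rewrite -ltcR -normC_ReE.
apply: le_lt_trans.
have H (u v : V) : Re `|u| - Re `|v| <= Re `|u - v|.
  by rewrite lerBlDr -lecR rmorphD /= -!normC_ReE -{1}(subrK v u) ler_normD.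
by rewrite ler_norml H lerNl opprB distrC H.
Qed.

Lemma cstar_continuous (R : realType) (A : cstarType R) : continuous (@cstar R A).
Proof.
move=> z; apply/cvgrPdist_lt => e e0.
have /cvgrPdist_lt/(_ _ e0) : (id : A -> A) @ z --> z by [].
apply: filterS => y; rewrite -[`|z - y|]normcstar_id cstarD.
by rewrite -scaleN1r cstarZ rmorphN rmorph1 scaleN1r.
Qed.

Section circle.
Variable R : realType.

Definition circle : set (cplx R) := [set z | `|z| = 1].

Definition cts_circle : {pred circle -> cplx R} := fun f => `[< continuous f >].

Lemma cts_circleP (f : circle -> cplx R) : reflect (continuous f) (f \in cts_circle).
Proof. exact: asboolP. Qed.

Fact cts_circle_submod_closed : submod_closed cts_circle.
Proof.
split=> [|a f g /cts_circleP fc /cts_circleP gc]; apply/cts_circleP => z.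
  exact: (@cst_continuous _ _ (0 : cplx R)).
apply: (@cvgD _ (cplx R) _ (nbhs z) _ (a \*: f) g (a *: f z) (g z)); last exact: gc.
by apply: cvgZr; exact: fc.
Qed.

HB.instance Definition _ := GRing.isSubmodClosed.Build R[i] (circle -> cplx R)
  cts_circle cts_circle_submod_closed.

Record circle_cfun : Type :=
  CircleCfun { circle_fun :> circle -> cplx R; _ : circle_fun \in cts_circle }.
HB.instance Definition _ := [isSub for circle_fun].
HB.instance Definition _ := [Choice of circle_cfun by <:].
HB.instance Definition _ := [SubChoice_isSubLmodule of circle_cfun by <:].

Lemma circle_cfun_continuous (f : circle_cfun) : continuous (f : circle -> cplx R).
Proof. by apply/cts_circleP; case: f. Qed.

Let compact_circle : compact circle.
Proof.
pose g (x : R * R) : cplx R := x.1 +i* x.2.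
have normg (z : R[i]) : `|z| <= (`|Re z| + `|Im z|)%:C.
  rewrite normc_def lecR -[leRHS]ger0_norm ?addr_ge0// -sqrtr_sqr.
  rewrite ler_sqrt ?sqr_ge0// sqrrD !real_normK ?num_real//.
  by rewrite lerD2r lerDl mulrn_wge0// mulr_ge0.
have gc : continuous g.
  move=> x; apply/cvgrPdist_lt => e e0.
  have eE : e = (Re e)%:C by rewrite -ge0C_ReE// ltW.
  have e20 : 0 < Re e / 2 by rewrite divr_gt0// -ltcR -eE.
  have /cvgrPdist_lt/(_ _ e20) x1 : fst @ x --> x.1 by exact: cvg_fst.
  have /cvgrPdist_lt/(_ _ e20) x2 : snd @ x --> x.2 by exact: cvg_snd.
  apply: filterS2 x1 x2 => y x1 x2.
  by rewrite eE (le_lt_trans (normg _))// ltcR (splitr (Re e)) ltrD.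
apply: (@subclosed_compact _ _ (g @` (`[-1, 1] `*` `[-1, 1]))).
- rewrite (_ : circle = (Num.norm : cplx R -> R[i]^o) @^-1` [set 1])//.
  apply: closed_comp; first by move=> *; exact: norm_continuous.
  by apply/accessible_closed_set1/hausdorff_accessible; exact: norm_hausdorff.
- apply: continuous_compact; first exact: continuous_subspaceT.
  by apply: compact_setX; exact: segment_compact.
- move=> z /= z1; exists (Re z, Im z); last by case: z {z1}.
  have : (Re z) ^+ 2 + (Im z) ^+ 2 = 1.
    by apply: complexI; rewrite add_Re2_Im2 z1 expr1n.
    move=> ab; split; rewrite /= in_itv /= -ler_norml -sqrtr_sqr -[leRHS]sqrtr1 ler_sqrt//.
    by rewrite -ab lerDl sqr_ge0.
  by rewrite -ab lerDr sqr_ge0.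
Qed.

Let bounded_cfun (f : circle_cfun) : exists M : R, forall z, `|f z| <= M%:C.
Proof.
pose g (z : circle) : R := Re `|f z|.
have gc : continuous g.
  move=> z; apply: (@continuous_comp _ _ _ (f : circle -> cplx R)).
    exact: circle_cfun_continuous.
  exact: Renorm_continuous.
have /continuous_compact/(_ compact_circle)/compact_bounded[M [_ gM]] :=
  (@subspace_valL_continuousP' _ circle _ 0 g).2 gc.
exists (M + 1) => z; rewrite normC_ReE lecR.
have gz : valL_ 0 g (val z) = g z by rewrite -[RHS](congr1 (@^~ z) (valLK 0 g)).
have M1 : M < M + 1 by rewrite ltrDl.
have /= := gM _ M1 (g z) (ex_intro2 _ _ (val z) (set_mem (valP z)) gz).
by rewrite /g ger0_norm// ReC_ge0.
Qed.

Let cfun_mul_subproof (f g : circle_cfun) :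
  (fun z => cmul (f z) (g z)) \in cts_circle.
Proof.
apply/cts_circleP => z.
exact: (@cvgM R[i] circle (nbhs z) _ (f : circle -> R[i]) (g : circle -> R[i])
  (f z) (g z) (circle_cfun_continuous (x:=z)) (circle_cfun_continuous (x:=z))).
Qed.

Let cfun_star_subproof (f : circle_cfun) : (fun z => cstar (f z)) \in cts_circle.
Proof.
apply/cts_circleP => z.
apply: (@continuous_comp _ _ _ (f : circle -> cplx R)).
  exact: circle_cfun_continuous.
exact: cstar_continuous.
Qed.

Let cfun_mul (f g : circle_cfun) : circle_cfun :=
  CircleCfun (cfun_mul_subproof f g).
Let cfun_star (f : circle_cfun) : circle_cfun :=
  CircleCfun (cfun_star_subproof f).

Let cfun_inj (f g : circle_cfun) :
  (forall z : circle, f z = g z) -> f = g.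
Proof. by move=> fg; apply/val_inj/funext. Qed.

Let cfun_closed (h : circle -> cplx R) :
  (forall e : R, 0 < e ->
    exists f : circle_cfun, forall z : circle, `|f z - h z| <= e%:C) ->
  exists f : circle_cfun, forall z, f z = h z.
Proof.
move=> H; suff hc : h \in cts_circle by exists (CircleCfun hc).
apply/cts_circleP => z.
apply/(@cvgrPdist_lt _ _ _ (nbhs z) _ h (h z)) => e e0.
have e20 : 0 < e / 2 by rewrite divr_gt0.
have eE : e / 2 / 2 = (Re (e / 2 / 2))%:C by rewrite -ge0C_ReE// divr_ge0// ltW.
have e40 : 0 < Re (e / 2 / 2) by rewrite -ltcR -eE divr_gt0.
have [f] := H _ e40; rewrite -eE => fh.
have /(@cvgrPdist_lt _ _ _ (nbhs z) _ f (f z))/(_ _ e20) :=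
  circle_cfun_continuous (f := f) (x := z).
apply: filterS => y fzy.
have -> : h z - h y = (h z - f z) + (f y - h y) + (f z - f y).
  by rewrite addrAC -addrA [f z - f y + _]addrA subrK addrA subrK.
rewrite (le_lt_trans (ler_normD _ _))// (splitr e) ler_ltD//.
rewrite (le_trans (ler_normD _ _))// [leRHS]splitr lerD//.
by rewrite distrC.
Qed.

HB.instance Definition _ := @isCStarFunctions.Build R circle (cplx R) circle_cfun
  cfun_mul cfun_star (fun f => supnorm f) (fun z f => f z)
  (fun _ a f g => erefl) (fun _ f g => erefl) (fun _ f => erefl)
  cfun_inj (fun f => supnorm_ge0 f)
  (fun f c => supnormP (bounded_cfun f)) cfun_closed.

Lemma circle_cfun_cmulE (f g : circle_cfun) z : cmul f g z = cmul (f z) (g z).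
Proof. by []. Qed.

Lemma circle_cfun_cstarE (f : circle_cfun) z : cstar f z = cstar (f z).
Proof. by []. Qed.

Lemma circle_cfun_normE (f : circle_cfun) : `|f| = supnorm f.
Proof. by []. Qed.

End circle.

Section morphisms.
Variables (R : realType) (A B : cstarType R).

(** *-homomorphisms of C*-algebras are automatically contractive, and bijective
    ones isometric, so no condition on the norm is required. *)
Record star_hom (phi : A -> B) : Prop := StarHom {
  star_hom_linear : forall (a : R[i]) x y, phi (a *: x + y) = a *: phi x + phi y;
  star_hom_mul : forall x y, phi (cmul x y) = cmul (phi x) (phi y);
  star_hom_star : forall x, phi (cstar x) = cstar (phi x)
}.

Definition cstar_isomorphic : Prop :=
  exists phi : A -> B, star_hom phi /\ bijective phi.

End morphisms.
Arguments cstar_isomorphic {R} A B.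

Section generation.
Variables (R : realType) (A : cstarType R).

Record star_subalgebra (D : set A) : Prop := StarSubalgebra {
  star_subalgebra0 : D 0;
  star_subalgebraD : forall (a : R[i]) x y, D x -> D y -> D (a *: x + y);
  star_subalgebraM : forall x y, D x -> D y -> D (cmul x y);
  star_subalgebra_star : forall x, D x -> D (cstar x)
}.

Definition generates (S : set A) : Prop :=
  forall D : set A, star_subalgebra D -> closed D -> S `<=` D -> D = setT.

End generation.

Record finDigraph : Type := FinDigraph {
  vertex : finType;
  edge : finType;
  esource : edge -> vertex;
  erange : edge -> vertex
}.

Section cuntz_krieger.
Variables (R : realType) (G : finDigraph).

Record CK_family (B : cstarType R) (p : vertex G -> B) (s : edge G -> B) : Prop :=
  CKFamily {
    CK_idem : forall v, cmul (p v) (p v) = p v;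
    CK_selfadj : forall v, cstar (p v) = p v;
    CK_orth : forall v w, v != w -> cmul (p v) (p w) = 0;
    CK_source : forall e, cmul (p (esource e)) (s e) = s e;
    CK_range : forall e, cmul (s e) (p (erange e)) = s e;
    CK_cuntz : forall e f,
      cmul (cstar (s e)) (s f) = if e == f then p (erange f) else 0;
    CK_krieger : forall v, (exists e, esource e = v) ->
      p v = \sum_(e | esource e == v) cmul (s e) (cstar (s e))
  }.

(** [A], with [p] and [s] the images of the vertices and edges, is the
    universal C*-algebra of Cuntz-Krieger families; uniqueness of [phi] is a
    consequence of generation. *)
Record is_CK (A : cstarType R) (p : vertex G -> A) (s : edge G -> A) : Prop :=
  IsCK {
    is_CK_family : CK_family p s;
    is_CK_generates : generates (range p `|` range s);
    is_CK_universal : forall (B : cstarType R) (q : vertex G -> B) (t : edge G -> B),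
      CK_family q t -> exists phi : A -> B,
        [/\ star_hom phi, forall v, phi (p v) = q v & forall e, phi (s e) = t e]
  }.

End cuntz_krieger.

(* Main.v *)
Require Import Defs.
From mathcomp Require Import all_boot all_order all_algebra.
From mathcomp Require Import complex ring lra zify cyclic separable cyclotomic.
From mathcomp Require Import all_classical reals topology normedtype.
Set Implicit Arguments.
Unset Strict Implicit.
Unset Printing Implicit Defensive.
Import Order.TTheory GRing.Theory Num.Theory.
Import numFieldNormedType.Exports.
Local Open Scope classical_set_scope.
Local Open Scope ring_scope.
Local Notation "x ** y" := (cmul x y) (at level 40, left associativity).

(** The proof uses the gauge action, which gives the center a grading by degree,
    and deduces the structure of the center from its part of degree zero.

    For every [t] on the unit circle, multiplying all edges by [t] is again a
    Cuntz-Krieger family, so universality gives an endomorphism [gauge t]. These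
    endomorphisms are contractive ([star_hom_contractive]) and form an action of
    the circle. Averaging over roots of unity gives Fourier coefficients
    ([fcoef]), and every element is a limit of its Fejer means ([fejer_dense]).
    The Fourier coefficients of a central element are central, so the
    homogeneous central elements span a dense subspace of the center.

    The central elements of degree zero form a finite-dimensional algebra. For a
    central [z] and a path [mu] with end [w], [s_mu^* z s_mu = z p_w]. If [w] is
    the end of arbitrarily long paths, a long [mu] compresses any approximation
    of degree zero of [z] by monomials to a scalar multiple of [p_w], so [z p_w]
    itself is such a multiple; the same is true at sinks ([core_scalar]). By the
    Krieger relation these scalars determine [z] ([core_faithful]). Hence the
    central elements of degree zero are functions on a finite set, and the unit
    is a finite sum of minimal projections [e i] among them
    ([minimal_projections]).

    Let [e] be one of these. If [x] is central of degree [n], then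
    [(x e)^* (x e)] has degree zero, hence is a scalar multiple of [e], and [x e]
    is a multiple of a unitary of the corner of [e] ([homog_unitary]). So either
    only degree zero occurs, and the center cut down by [e] is scalar, or it is
    generated by a unitary [u] of minimal positive degree
    ([corner_dichotomy]). In the second case the gauge action bounds the
    coefficients of a polynomial in [u] by its norm. This property characterizes
    the norm of all polynomials in [u]: by the C*-identity the [2^k]-th power of
    the norm of a polynomial is the norm of a polynomial [2^k] times as long,
    which is comparable to its largest coefficient up to a factor linear in
    [2^k] ([nm_peval_le]). The identity function of the
    circle has the same property, so the Laurent polynomials in both have the
    same completion ([circular_iso]), which is the algebra of continuous
    functions on the circle by Fejer interpolation ([circle_dense]). Summing over
    the minimal projections gives the theorem ([center_direct_sum]). *)

(** * Real-valued norms, limits and density *)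

Section real_lemmas.
Variable R : realType.

Lemma bernoulli (d : R) n : 0 <= d -> 1 + n%:R * d <= (1 + d) ^+ n.
Proof.
move=> d0; elim: n => [|n IH]; first by rewrite mul0r addr0 expr0.
rewrite exprS (le_trans _ (ler_wpM2l _ IH)) ?addr_ge0//.
have : 0 <= n%:R * (d * d) by rewrite !mulr_ge0.
by rewrite -natr1; lra.
Qed.

(** A factor growing linearly with the exponent disappears after extracting
    roots. *)
Lemma le_of_powers (x y : R) (n : nat) : 0 <= x -> 0 <= y ->
  (forall k, x ^+ (2 ^ k) <= (2 ^ k * n)%:R * y ^+ (2 ^ k)) -> x <= y.
Proof.
move=> x0 y0 H; rewrite leNgt; apply/negP => yx.
have {}y0 : 0 < y.
  rewrite lt_neqAle y0 andbT eq_sym; apply/eqP => yE.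
  by have := H 0; rewrite expn0 yE mulr0 expr1 leNgt -{1}yE yx.
pose d := x / y - 1.
have d0 : 0 < d by rewrite subr_gt0 ltr_pdivlMr// mul1r.
have xE : x = (1 + d) * y by rewrite /d addrCA subrr addr0 divfK ?gt_eqF.
have K k : (2 ^ k)%:R * d ^+ 2 <= (2 * n)%:R.
  have := H k.+1; rewrite xE exprMn ler_pM2r ?exprn_gt0// expnS mulnC exprM.
  have j0 : (0 : R) < (2 ^ k)%:R by rewrite ltr0n expn_gt0.
  have : ((2 ^ k)%:R * d) ^+ 2 <= ((1 + d) ^+ (2 ^ k)) ^+ 2.
    have d1 : 0 <= 1 + d by rewrite addr_ge0// ltW.
    have d2 : 0 <= (2 ^ k)%:R * d by rewrite mulr_ge0// ltW.
    rewrite lerXn2r ?nnegrE ?exprn_ge0//.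
    by apply: le_trans (bernoulli _ (ltW d0)); rewrite lerDr.
  move=> /le_trans/[apply].
  by rewrite exprMn (expr2 _%:R) -mulrA -mulnA natrM ler_pM2l.
have d2 : 0 < d ^+ 2 by rewrite exprn_gt0.
pose m := (Num.trunc ((2 * n)%:R / d ^+ 2)).+1.
have := K m; apply/negP; rewrite -ltNge -ltr_pdivrMr//.
rewrite (lt_trans (truncnS_gt _))// ltr_nat; exact: ltn_expl.
Qed.

Lemma half_pow_small (e : R) : 0 < e -> exists N, forall n, (N <= n)%N -> 2^-1 ^+ n <= e.
Proof.
move=> e0; exists (Num.trunc e^-1) => n Nn.
rewrite -[leRHS]invrK exprVn lef_pV2 ?posrE ?invr_gt0 ?exprn_gt0//.
apply/ltW/(lt_le_trans (truncnS_gt _)); rewrite -natrX ler_nat.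
exact: leq_ltn_trans Nn (ltn_expl _ _).
Qed.

Lemma invn_small (e : R) : 0 < e -> exists N, forall n, (N <= n)%N -> n.+1%:R^-1 <= e.
Proof.
move=> e0; exists (Num.trunc e^-1) => n Nn.
rewrite -[leRHS]invrK lef_pV2 ?posrE ?invr_gt0//.
by apply/ltW/(lt_le_trans (truncnS_gt _)); rewrite ler_nat.
Qed.

End real_lemmas.

Section real_norm.
Variable R : realType.
Local Notation C := R[i].

(** Norms take values in [R[i]]; their real parts allow estimates in the ordered
    field [R]. *)
Definition cabs (a : C) : R := complex.Re `|a|.
Definition nm (V : normedModType C) (x : V) : R := complex.Re `|x|.

Lemma cabsE (a : C) : `|a| = (cabs a)%:C%C.
Proof. exact/ge0C_ReE/normr_ge0. Qed.

Lemma nmE (V : normedModType C) (x : V) : `|x| = (nm x)%:C%C.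
Proof. exact: normC_ReE. Qed.

Lemma cabs_ge0 a : 0 <= cabs a.
Proof. by rewrite -ler0c -cabsE. Qed.

Lemma cabsM a b : cabs (a * b) = cabs a * cabs b.
Proof. by apply: complexI; rewrite rmorphM -!cabsE normrM. Qed.

Lemma cabsX a n : cabs (a ^+ n) = cabs a ^+ n.
Proof. by apply: complexI; rewrite rmorphXn -!cabsE normrX. Qed.

Lemma cabs1 : cabs 1 = 1.
Proof. by apply: complexI; rewrite -cabsE normr1. Qed.

Lemma cabs0 : cabs 0 = 0.
Proof. by apply: complexI; rewrite -cabsE normr0. Qed.

Lemma cabsN a : cabs (- a) = cabs a.
Proof. by rewrite /cabs normrN. Qed.

Lemma cabsD a b : cabs (a + b) <= cabs a + cabs b.
Proof. by rewrite -lecR rmorphD /= -!cabsE ler_normD. Qed.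

Lemma cabs_conj (a : C) : cabs a^* = cabs a.
Proof. by apply: complexI; rewrite -!cabsE norm_conjC. Qed.

Lemma cabs_eq0 a : (cabs a == 0) = (a == 0).
Proof. by rewrite -(inj_eq (@complexI R)) -cabsE normr_eq0. Qed.

Lemma cabsR (x : R) : cabs x%:C%C = `|x|.
Proof. by apply: complexI; rewrite -cabsE normc_def /= expr0n addr0 sqrtr_sqr. Qed.

Lemma cabsV a : cabs a^-1 = (cabs a)^-1.
Proof.
have [->|a0] := eqVneq a 0; first by rewrite invr0 cabs0 invr0.
apply: (mulfI (_ : cabs a != 0)); first by rewrite cabs_eq0.
by rewrite -cabsM !divff ?cabs1 ?cabs_eq0.
Qed.

Lemma cabs_nat n : cabs n%:R = n%:R.
Proof. by rewrite -[n%:R in LHS](rmorph_nat (real_complex R)) cabsR ger0_norm. Qed.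

Lemma conjR (x : R) : (x%:C%C)^* = x%:C%C.
Proof. exact: conjc_real. Qed.

Lemma mulJ (a : C) : a^* * a = ((cabs a) ^+ 2)%:C%C.
Proof. by rewrite mulrC -normCK rmorphXn /= -cabsE. Qed.

Lemma cabs_sum I (r : seq I) (P : pred I) (F : I -> C) :
  cabs (\sum_(i <- r | P i) F i) <= \sum_(i <- r | P i) cabs (F i).
Proof.
elim/big_ind2: _ => [|a b c d ab cd|//]; first by rewrite cabs0.
by rewrite (le_trans (cabsD _ _))// lerD.
Qed.

Section normed.
Variable V : normedModType C.
Implicit Types x y : V.

Lemma nm_ge0 x : 0 <= nm x. Proof. exact: ReC_ge0. Qed.

Lemma nm0 : nm (0 : V) = 0.
Proof. by apply: complexI; rewrite -nmE normr0. Qed.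

Lemma nm_eq0 x : (nm x == 0) = (x == 0).
Proof. by rewrite -(inj_eq (@complexI R)) -nmE normr_eq0. Qed.

Lemma nm_gt0 x : (0 < nm x) = (x != 0).
Proof. by rewrite lt_neqAle nm_ge0 andbT eq_sym nm_eq0. Qed.

Lemma nmN x : nm (- x) = nm x. Proof. by rewrite /nm normrN. Qed.

Lemma nmB x y : nm (x - y) = nm (y - x). Proof. by rewrite /nm distrC. Qed.

Lemma nmD x y : nm (x + y) <= nm x + nm y.
Proof. by rewrite -lecR rmorphD /= -!nmE ler_normD. Qed.

Lemma nmBD x y : nm (x - y) <= nm x + nm y.
Proof. by rewrite -(nmN y) nmD. Qed.

Lemma nmZ a x : nm (a *: x) = cabs a * nm x.
Proof. by apply: complexI; rewrite rmorphM /= -!nmE -cabsE normrZ. Qed.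

Lemma nm_via y x z : nm (x - z) <= nm (x - y) + nm (y - z).
Proof. by rewrite -(subrKA y) nmD. Qed.

Lemma nm_sum I (r : seq I) (P : pred I) (F : I -> V) :
  nm (\sum_(i <- r | P i) F i) <= \sum_(i <- r | P i) nm (F i).
Proof.
elim/big_ind2: _ => [|a b c d ab cd|//]; first by rewrite nm0.
by rewrite (le_trans (nmD _ _))// lerD.
Qed.

Lemma nm_small x : (forall e : R, 0 < e -> nm x <= e) -> x = 0.
Proof.
move=> H; apply/eqP; rewrite -nm_eq0 eq_le nm_ge0 andbT.
by apply/ler_addgt0Pr => e /H; rewrite add0r.
Qed.

Lemma nm_smallB x y : (forall e : R, 0 < e -> nm (x - y) <= e) -> x = y.
Proof. by move=> /nm_small/eqP; rewrite subr_eq0 => /eqP. Qed.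

(** Membership in the closure of [D], phrased without filters so that it can be
    combined directly with norm estimates. *)
Definition approx (D : V -> Prop) x := forall e : R, 0 < e ->
  exists2 y, D y & nm (x - y) <= e.

Lemma approx_refl (D : V -> Prop) x : D x -> approx D x.
Proof. by move=> Dx e e0; exists x => //; rewrite subrr nm0 ltW. Qed.

Lemma approx_closed (D : V -> Prop) : closed (approx D : set V).
Proof.
move=> x /= cx e e0.
have e2 : 0 < e / 2 by rewrite divr_gt0.
have [|y [Dy]] := cx (ball x (e / 2)%:C%C).
  by apply: nbhsx_ballx; rewrite ltcR.
rewrite -ball_normE /= nmE ltcR => xy; have [z Dz yz] := Dy _ e2.
by exists z => //; rewrite (le_trans (nm_via y _ _))// (splitr e) lerD// ltW.
Qed.

Lemma approx_trans (D E : V -> Prop) x :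
  (forall y, D y -> approx E y) -> approx D x -> approx E x.
Proof.
move=> DE Dx e e0; have e2 : 0 < e / 2 by rewrite divr_gt0.
have [y Dy xy] := Dx _ e2; have [z Ez yz] := DE _ Dy _ e2.
by exists z => //; rewrite (le_trans (nm_via y _ _))// (splitr e) lerD.
Qed.

Definition tends (f : nat -> V) (l : V) := forall e : R, 0 < e ->
  exists N, forall n, (N <= n)%N -> nm (f n - l) <= e.

End normed.

Lemma complete_tends (V : completeNormedModType C) (f : nat -> V) :
  (forall e : R, 0 < e -> exists N, forall m n, (N <= m)%N -> (N <= n)%N ->
     nm (f m - f n) <= e) -> exists l, tends f l.
Proof.
move=> H; have /cvgrPdist_le fl : cvg (f @ \oo).
  apply: cauchy_cvg; apply/cauchyP => e e0.
  have eE := ge0C_ReE (ltW e0).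
  have e20 : 0 < complex.Re e / 2 by rewrite divr_gt0// -ltcR -eE.
  have [N HN] := H _ e20; exists (f N); exists N => // n /= Nn.
  rewrite -ball_normE /= nmE eE ltcR (le_lt_trans (HN _ _ _ _))//.
  by rewrite ltr_pdivrMr// ltr_pMr ?ltr1n// -ltcR -eE.
exists (lim (f @ \oo)) => e e0; have e0' : 0 < e%:C%C by rewrite ltcR.
have [N _ HN] := fl _ e0'.
by exists N => n Nn; rewrite nmB -lecR -nmE; exact: HN.
Qed.

Lemma geometric_tends (V : completeNormedModType C) (f : nat -> V) :
  (forall n, nm (f n.+1 - f n) <= 2^-1 ^+ n) -> exists l, tends f l.
Proof.
move=> H; apply: complete_tends => e e0.
have K n k : nm (f (n + k)%N - f n) <= 2 * 2^-1 ^+ n - 2 * 2^-1 ^+ (n + k).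
  elim: k => [|k IH]; first by rewrite addn0 !subrr nm0.
  rewrite (le_trans (nm_via (f (n + k)%N) _ _))// addnS.
  apply: le_trans (lerD (H _) IH) _; rewrite (exprS _ (n + k)); lra.
have [|N HN] := @half_pow_small _ (e / 4); first lra.
exists N => m n Nm Nn; rewrite (le_trans (nm_via (f N) _ _))//.
have {}K m' : (N <= m')%N -> nm (f m' - f N) <= e / 2.
  move=> /subnKC <-; apply: le_trans (K _ _) _.
  have := HN _ (leqnn N); have : (0 : R) <= 2^-1 ^+ (N + (m' - N)) by rewrite exprn_ge0// invr_ge0.
  lra.
by rewrite [X in _ + X]nmB (splitr e) lerD// K.
Qed.

(** The coefficients of a sequence converging to [x] on the line of [e] form a
    Cauchy sequence of scalars. *)
Lemma approx_line (V : normedModType C) (x e : V) :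
  approx (fun y => exists a : C, y = a *: e) x -> exists a : C, x = a *: e.
Proof.
move=> H; have [e0|e0] := eqVneq e 0.
  exists 0; rewrite scale0r; apply: nm_small => d /H[_ [a ->]].
  by rewrite e0 scaler0 subr0.
have ne : 0 < nm e by rewrite nm_gt0.
have /choice[c cP] : forall n : nat, exists a : C, nm (x - a *: e) <= n.+1%:R^-1.
  move=> n; have [|_ [a ->] ?] := H n.+1%:R^-1; first by rewrite invr_gt0.
  by exists a.
have small d : 0 < d -> exists N, forall n, (N <= n)%N -> nm (x - c n *: e) <= d.
  by move=> /invn_small[N HN]; exists N => n Nn; exact: le_trans (cP n) (HN n Nn).
have [a ta] : exists a, tends (c : nat -> cplx R) a.
  apply: complete_tends => d d0; have [|N HN] := small (d * nm e / 2).
    by rewrite divr_gt0// mulr_gt0.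
  exists N => m n Nm Nn; rewrite -(ler_pM2r ne).
  rewrite -[leLHS](nmZ (c m - c n) e) scalerBl.
  rewrite (le_trans (nm_via x _ _))// (splitr (d * _)) lerD ?HN//.
  by rewrite nmB HN.
exists a; apply: nm_smallB => d d0.
have [|N HN] := small (d / 2); first by rewrite divr_gt0.
have [|M HM] := ta (d / 2 / nm e); first by rewrite !divr_gt0.
rewrite (le_trans (nm_via (c (maxn N M) *: e) _ _))// (splitr d) lerD//.
  by rewrite HN ?leq_maxl.
have := HM _ (leq_maxr N M).
by rewrite ler_pdivlMr// -(nmZ (c (maxn N M) - a)) scalerBl.
Qed.

End real_norm.

Section cstar_norm.
Variables (R : realType) (A : cstarType R).
Local Notation C := R[i].
Implicit Types x y z e s : A.

Lemma nmM x y : nm (x ** y) <= nm x * nm y.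
Proof. by rewrite -lecR rmorphM /= -!nmE normcmul. Qed.

Lemma nm_star x : nm (cstar x) = nm x.
Proof. by apply: complexI; rewrite -!nmE normcstar_id. Qed.

Lemma nm_starM x : nm (cstar x ** x) = nm x ^+ 2.
Proof. by apply: complexI; rewrite rmorphXn /= -!nmE normcstar. Qed.

Lemma star0 : cstar 0 = 0 :> A.
Proof. by rewrite -(scale0r 0) cstarZ rmorph0 !scale0r. Qed.

Lemma starN x : cstar (- x) = - cstar x.
Proof. by rewrite -scaleN1r cstarZ rmorphN rmorph1 scaleN1r. Qed.

Lemma starB x y : cstar (x - y) = cstar x - cstar y.
Proof. by rewrite cstarD starN. Qed.

Lemma cmulBl x y z : (x - y) ** z = x ** z - y ** z.
Proof. by rewrite cmulDl cmulN. Qed.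

Lemma cmulBr x y z : z ** (x - y) = z ** x - z ** y.
Proof. by rewrite cmulDr cmulxN. Qed.

Lemma star_sum I (r : seq I) (P : pred I) (F : I -> A) :
  cstar (\sum_(i <- r | P i) F i) = \sum_(i <- r | P i) cstar (F i).
Proof. exact: (big_morph _ (@cstarD _ A) star0). Qed.

Lemma cmul_suml I (r : seq I) (P : pred I) (F : I -> A) z :
  (\sum_(i <- r | P i) F i) ** z = \sum_(i <- r | P i) F i ** z.
Proof. exact: (big_morph (fun x => x ** z) (fun x y => cmulDl x y z) (cmul0x z)). Qed.

Lemma cmul_sumr I (r : seq I) (P : pred I) (F : I -> A) z :
  z ** (\sum_(i <- r | P i) F i) = \sum_(i <- r | P i) z ** F i.
Proof. exact: (big_morph (fun x => z ** x) (cmulDr z) (cmulx0 z)). Qed.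

Lemma star_inj : injective (@cstar R A).
Proof. exact: can_inj (@cstarK R A). Qed.

Lemma nm_proj_le1 e : cstar e = e -> e ** e = e -> nm e <= 1.
Proof.
move=> es ee; have := nm_starM e; rewrite es ee => n2.
have [->|e0] := eqVneq e 0; first by rewrite nm0.
by have /eqP := n2; rewrite expr2 -{1}[nm e]mulr1 (inj_eq (mulfI _)) ?nm_eq0// => /eqP <-.
Qed.

Lemma nm_proj e : cstar e = e -> e ** e = e -> e != 0 -> nm e = 1.
Proof.
move=> es ee e0; have := nm_starM e; rewrite es ee => /eqP.
by rewrite expr2 -{1}[nm e]mulr1 (inj_eq (mulfI _)) ?nm_eq0// => /eqP <-.
Qed.

Lemma nm_isom s e : cstar e = e -> e ** e = e -> cstar s ** s = e -> nm s <= 1.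
Proof.
move=> es ee se; rewrite -(@ler_pXn2r _ 2) ?nnegrE ?nm_ge0// -nm_starM se expr1n.
exact: nm_proj_le1.
Qed.

End cstar_norm.

Section star_hom_theory.
Variables (R : realType) (A B : cstarType R) (phi : A -> B).
Hypothesis phiH : star_hom phi.

Lemma star_homD x y : phi (x + y) = phi x + phi y.
Proof. by have := star_hom_linear phiH 1 x y; rewrite !scale1r. Qed.

Lemma star_hom0 : phi 0 = 0.
Proof. by apply: (addrI (phi 0)); rewrite -star_homD !addr0. Qed.

Lemma star_homZ a x : phi (a *: x) = a *: phi x.
Proof. by have := star_hom_linear phiH a x 0; rewrite star_hom0 !addr0. Qed.

Lemma star_homB x y : phi (x - y) = phi x - phi y.
Proof. by rewrite star_homD -scaleN1r star_homZ scaleN1r. Qed.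

End star_hom_theory.

(** * Unital C*-algebras: contractivity and positivity without spectral theory *)

Section unital.
Variables (R : realType) (A : cstarType R) (one : A).
Hypotheses (mul1x : forall x, one ** x = x) (mulx1 : forall x, x ** one = x).
Implicit Types x y z e h k m : A.

Lemma one_star : cstar one = one.
Proof. by rewrite -[LHS]mulx1 -{2}[one]cstarK -cstarM mulx1 cstarK. Qed.

Lemma nm_one : nm one <= 1.
Proof. by apply: nm_proj_le1; rewrite ?one_star ?mul1x. Qed.

(** Writing [k = 1 - m], the equation [k^2 + h^2 = 1] becomes the fixed point
    equation [m = (h^2 + m^2) / 2], a contraction of the ball of radius 1/2. *)
Lemma cos_of_sin h : cstar h = h -> nm h <= 2^-1 ->
  exists k, cstar k = k /\ k ** h = h ** k /\ k ** k + h ** h = one.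
Proof.
move=> hs hn; pose f m : A := (2^-1 : R[i]) *: (h ** h + m ** m).
have c2 : cabs (2^-1 : R[i]) = 2^-1 by rewrite cabsV cabs_nat.
have fB m m' : nm m <= 2^-1 -> nm m' <= 2^-1 -> nm (f m - f m') <= 2^-1 * nm (m - m').
  move=> mn m'n; rewrite -scalerBr nmZ c2 ler_pM2l ?invr_gt0// opprD addrACA subrr add0r.
  have -> : m ** m - m' ** m' = m ** (m - m') + (m - m') ** m'.
    by rewrite cmulBr cmulBl addrA subrK.
  apply: le_trans (nmD _ _) _; apply: le_trans (lerD (nmM _ _) (nmM _ _)) _.
  by rewrite (mulrC (nm (m - m'))) -mulrDl ler_piMl ?nm_ge0//; lra.
pose x n := iter n f 0.
have xP n : nm (x n) <= 2^-1 /\ cstar (x n) = x n /\ x n ** h = h ** x n.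
  elim: n => [|n [IHn [IHs IHc]]]; first by rewrite nm0 star0 cmul0x cmulx0 invr_ge0.
  split; [|split].
  - have H y : nm y <= 2^-1 -> nm (y ** y) <= 2^-1 * 2^-1.
      by move=> yn; rewrite (le_trans (nmM _ _))// ler_pM ?nm_ge0.
    have := nmD (h ** h) (x n ** x n); rewrite /= nmZ c2 -/(x n).
    have := H _ hn; have := H _ IHn; lra.
  - by rewrite /= cstarZ cstarD !cstarM hs IHs fmorphV rmorph_nat.
  - rewrite /= cmulZl cmulZr cmulDl cmulDr cmulA; congr (_ *: (_ + _)).
    by rewrite -cmulA -/(x n) IHc !cmulA IHc.
have [m xm] : exists m, tends x m.
  apply: geometric_tends; elim=> [|n IH].
    by rewrite expr0 subr0; have [] := xP 1%N; lra.
  rewrite -[x n.+2]/(f (x n.+1)) -[x n.+1 in X in _ - X]/(f (x n)).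
  rewrite (le_trans (fB _ _ _ _)) ?(xP _).1// exprS.
  by rewrite ler_pM2l ?invr_gt0.
have mn : nm m <= 2^-1.
  apply/ler_addgt0Pr => d /xm[N /(_ _ (leqnn N)) Nm].
  rewrite -(subrK (x N) m) (le_trans (nmD _ _))// addrC lerD ?(xP _).1//.
  by rewrite nmB.
have ms : cstar m = m.
  apply: nm_smallB => d d0; have [|N /(_ _ (leqnn N)) Nm] := xm (d / 2); first lra.
  rewrite (le_trans (nm_via (x N) _ _))// (splitr d) lerD//.
  by rewrite -{1}(xP N).2.1 -starB nm_star nmB.
have mc : m ** h = h ** m.
  apply: nm_smallB => d d0; have [|N /(_ _ (leqnn N)) Nm] := xm (d / 2); first lra.
  rewrite (le_trans (nm_via (x N ** h) _ _))// (splitr d) {2}(xP N).2.2.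
  rewrite -cmulBl -cmulBr (le_trans (lerD (nmM _ _) (nmM _ _)))//.
  rewrite (nmB m); have := nm_ge0 (x N - m); have := nm_ge0 h.
  move: (nm (x N - m)) Nm => t; nra.
have mf : f m = m.
  apply: nm_smallB => d d0; have [|N HN] := xm (d / 2); first lra.
  rewrite (le_trans (nm_via (x N.+1) _ _))// (splitr d) lerD ?HN//.
  rewrite (le_trans (fB _ _ mn (xP _).1))//.
  have := HN N (leqnn N); rewrite nmB; have := nm_ge0 (x N - m); lra.
exists (one - m); split; [|split].
- by rewrite starB one_star ms.
- by rewrite cmulBl cmulBr mul1x mulx1 mc.
- have hm : h ** h + m ** m = m + m.
    have : (2 : R[i]) *: f m = (2 : R[i]) *: m by rewrite mf.
    by rewrite scalerA divff ?pnatr_eq0// scale1r scaler_nat mulr2n.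
  rewrite cmulBl mul1x cmulBr mulx1 opprB (addrC (m ** m)) addrA.
  by rewrite -(addrA _ (m ** m)) (addrC (m ** m)) hm addrA !subrK.
Qed.

(** By the C*-identity [h + i k] and [h - i k] have norm at most one, and [h] is
    their mean. *)
Lemma nm_sin h k e : cstar h = h -> cstar k = k -> k ** h = h ** k ->
  k ** k + h ** h = e -> nm e <= 1 -> nm h <= 1.
Proof.
move=> hs ks kh hk e1.
have un (s : R[i]) : s^* = - s -> s ^+ 2 = -1 -> nm (h + s *: k) <= 1.
  move=> sJ s2; rewrite -(@ler_pXn2r _ 2) ?nnegrE ?nm_ge0// -nm_starM expr1n.
  rewrite cstarD cstarZ hs ks sJ cmulDl !cmulDr !cmulZl !cmulZr kh.
  rewrite -addrA (addrA (s *: _)) -scalerDl subrr scale0r add0r scalerA.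
  by rewrite mulNr -expr2 s2 opprK scale1r addrC hk.
have i2 : 'i ^+ 2 = -1 :> R[i] by exact: sqrCi.
have iJ : 'i^* = - 'i :> R[i] by exact: conjCi.
have iJ2 : (- 'i)^* = - - 'i :> R[i] by rewrite raddfN /= iJ.
have i22 : (- 'i) ^+ 2 = -1 :> R[i] by rewrite sqrrN i2.
have n1 := un _ iJ i2; have n2 := un _ iJ2 i22.
have : nm (h + h) <= 2.
  rewrite (_ : h + h = (h + 'i *: k) + (h + - 'i *: k)); last first.
    by rewrite addrACA -scalerDl subrr scale0r addr0.
  by rewrite (le_trans (nmD _ _))//; lra.
rewrite -mulr2n -scaler_nat nmZ cabs_nat; lra.
Qed.

Lemma nm_one_sub_sqr h : cstar h = h -> nm h <= 2^-1 -> nm (one - h ** h) <= 1.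
Proof.
move=> hs /(cos_of_sin hs)[k [ks [kh hk]]].
have -> : one - h ** h = k ** k by rewrite -hk addrK.
rewrite -{1}ks nm_starM expr_le1 ?nm_ge0//.
by apply: (nm_sin ks hs _ _ nm_one); rewrite // addrC.
Qed.

(** The squares of the real and imaginary parts of [y] would add up to [-e]. For
    their halves [a] and [b], the contractions [e (1 - a^2)] and [e (1 - b^2)]
    would then add up to [(2 + 1/4) e], which has norm greater than [2]. *)
Lemma no_negative_unitary y e : cstar e = e -> e ** e = e ->
  cstar y ** y = - e -> y ** cstar y = - e -> e = 0.
Proof.
move=> es ee yy yy'; apply/eqP; rewrite -[_ == _]negbK; apply/negP => e0.
have e1 := nm_proj es ee e0.
have y1 : nm y = 1.
  apply/eqP; rewrite -(@pexpr_eq1 _ _ 2) ?nm_ge0//.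
  by rewrite -nm_starM yy nmN e1.
pose a := (4^-1 : R[i]) *: (y + cstar y).
pose b := ('i / 4 : R[i]) *: (cstar y - y).
have iJ : ('i : R[i])^* = - 'i by exact: conjCi.
have i1 : cabs ('i : R[i]) = 1 by apply: complexI; rewrite -cabsE normCi.
have as_ : cstar a = a by rewrite /a cstarZ cstarD cstarK addrC fmorphV rmorph_nat.
have bs : cstar b = b.
  rewrite /b cstarZ starB cstarK rmorphM /= iJ fmorphV rmorph_nat mulNr scaleNr.
  by rewrite -scalerN opprB.
have an : nm a <= 2^-1.
  rewrite nmZ cabsV cabs_nat; have := nmD y (cstar y); rewrite nm_star y1; lra.
have bn : nm b <= 2^-1.
  rewrite nmZ cabsM cabsV cabs_nat i1.
  by have := nmBD (cstar y) y; rewrite nm_star y1; lra.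
have ab : a ** a + b ** b = (- (4^-1) : R[i]) *: e.
  rewrite /a /b !cmulZl !cmulZr !scalerA !(cmulDl, cmulDr, cmulN, cmulxN) yy yy' !opprK.
  have -> : 'i / 4 * ('i / 4) = - (4^-1 * 4^-1) :> R[i].
    by rewrite mulrACA -expr2 sqrCi mulN1r.
  have collect (X Y E : A) : X - E + (- E + Y) - (Y + E - (- E - X)) = - (E *+ 4).
    rewrite (opprB (- E)) opprK [- E + Y]addrC addrACA [Y + E + _]addrACA [Y + X]addrC.
    by rewrite (opprD (X + Y)) [LHS]addrACA subrr add0r -!opprD !mulrS mulr0n addr0 !addrA.
  rewrite !scaleNr -scalerBr collect -(scaler_nat 4 e) scalerN scalerA; congr (- (_ *: _)).
  by field.
have sum_e : e ** (one - a ** a) + e ** (one - b ** b) = (2 + 4^-1 : R[i]) *: e.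
  rewrite -cmulDr addrACA -opprD ab scaleNr opprK !cmulDr cmulZr mulx1 ee.
  by rewrite scalerDl scaler_nat mulr2n.
have := nmD (e ** (one - a ** a)) (e ** (one - b ** b)); rewrite sum_e nmZ e1 mulr1.
have -> : 2 + 4^-1 = (2 + 4^-1)%:C%C :> R[i] by rewrite rmorphD rmorph_nat fmorphV rmorph_nat.
rewrite cabsR ger0_norm ?addr_ge0 ?invr_ge0//.
have := nmM e (one - a ** a); have := nmM e (one - b ** b); rewrite e1 !mul1r.
have := nm_one_sub_sqr as_ an; have := nm_one_sub_sqr bs bn; lra.
Qed.

(** A self-adjoint [h] of norm at most 1/2 is the sine of an angle whose cosine
    [k] lies in the algebra; [phi] preserves [k^2 + h^2 = 1], which bounds
    [phi h] by [1]. This gives boundedness with constant 2, and the C*-identity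
    bounds the powers [nm (phi x) ^ (2 ^ n)] with the same constant, which
    therefore disappears in the limit. *)
Lemma star_hom_contractive (phi : A -> A) : star_hom phi -> phi one = one ->
  forall x, nm (phi x) <= nm x.
Proof.
move=> phiH phi1; have phiD := star_homD phiH; have phi0 := star_hom0 phiH.
have phiZ := star_homZ phiH; have [_ phiM phiS] := phiH.
have sa h : cstar h = h -> nm (phi h) <= 2 * nm h.
  move=> hs; have [->|h0] := eqVneq h 0; first by rewrite phi0 nm0 mulr0.
  have n0 : 0 < nm h by rewrite nm_gt0.
  pose c : R := (2 * nm h)^-1; have c0 : 0 < c by rewrite invr_gt0 mulr_gt0.
  have cabsc : cabs c%:C%C = c by rewrite cabsR gtr0_norm.
  have chs : cstar (c%:C%C *: h) = c%:C%C *: h by rewrite cstarZ conjR hs.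
  have chn : nm (c%:C%C *: h) <= 2^-1.
    by rewrite nmZ cabsc /c invfM mulfVK// gt_eqF.
  have [k [ks [kh hk]]] := cos_of_sin chs chn.
  have : nm (phi (c%:C%C *: h)) <= 1.
    apply: (@nm_sin _ (phi k) one); rewrite -?phiS ?chs ?ks -?phiM ?kh -?phiD ?hk ?phi1 ?nm_one//.
  by rewrite phiZ nmZ cabsc /c mulrC ler_pdivrMr ?mulr_gt0// mul1r.
have nz x : nm (phi x) <= 2 * nm x.
  rewrite -(@ler_pXn2r _ 2) ?nnegrE ?mulr_ge0 ?nm_ge0// exprMn -!nm_starM -phiS -phiM.
  have := sa (cstar x ** x); rewrite cstarM cstarK => /(_ erefl).
  have := nm_ge0 (cstar x ** x); lra.
have pw (n : nat) : forall x, nm (phi x) ^+ (2 ^ n)%N <= 2 * nm x ^+ (2 ^ n)%N.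
  elim: n => [|n IH] x; first exact: nz.
  by have := IH (cstar x ** x); rewrite phiM phiS !nm_starM -!exprM -expnS.
move=> x; apply: (@le_of_powers _ _ _ 2); rewrite ?nm_ge0// => n.
rewrite (le_trans (pw n x))// ler_wpM2r ?exprn_ge0 ?nm_ge0// ler_nat.
by rewrite leq_pmull// expn_gt0.
Qed.

End unital.

(** * The dense span of the monomials of a Cuntz-Krieger family *)

Section dense.
Variables (R : realType) (A : cstarType R).
Implicit Types (D : set A) (x y z : A).

Lemma approx_star_subalgebra D : star_subalgebra D -> star_subalgebra (approx D).
Proof.
move=> [D0 DD DM DS]; split.
- exact: approx_refl.
- move=> a x y Dx Dy e e0.
  have c0 : 0 < cabs a + 1 by rewrite ltr_wpDl ?cabs_ge0.
  have [|x' Dx' xx'] := Dx (e / 2 / (cabs a + 1)); first by rewrite !divr_gt0.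
  have [|y' Dy' yy'] := Dy (e / 2); first by rewrite divr_gt0.
  exists (a *: x' + y'); first exact: DD.
  rewrite opprD addrACA -scalerBr (le_trans (nmD _ _))// (splitr e) lerD// nmZ.
  have := ler_wpM2l (cabs_ge0 a) xx' => /le_trans; apply.
  rewrite mulrA ler_pdivrMr// mulrC ler_pM2l ?divr_gt0//; lra.
- move=> x y Dx Dy e e0; pose M := nm x + nm y + 1.
  have M0 : 0 < M by rewrite ltr_wpDl ?addr_ge0 ?nm_ge0.
  pose d := Num.min 1 (e / 2 / M).
  have d0 : 0 < d by rewrite lt_min ltr01 !divr_gt0.
  have dM : d * M <= e / 2 by rewrite -ler_pdivlMr// ge_min lexx orbT.
  have d1 : d <= 1 by rewrite ge_min lexx.
  have [x' Dx' xx'] := Dx _ d0; have [y' Dy' yy'] := Dy _ d0.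
  exists (x' ** y'); first exact: DM.
  have -> : x ** y - x' ** y' = (x - x') ** y + x' ** (y - y').
    by rewrite cmulBr cmulBl addrA subrK.
  have x'n : nm x' <= nm x + 1.
    have -> : x' = x - (x - x') by rewrite opprB addrCA subrr addr0.
    by rewrite (le_trans (nmBD _ _))// lerD2l (le_trans xx').
  apply: le_trans (nmD _ _) _; apply: le_trans (lerD (nmM _ _) (nmM _ _)) _.
  rewrite (splitr e); apply: lerD; apply: le_trans dM; rewrite /M.
    by rewrite ler_pM ?nm_ge0//; have := nm_ge0 x; lra.
  rewrite mulrC ler_pM ?nm_ge0//; have := nm_ge0 y; lra.
- move=> x Dx e /Dx[y Dy xy]; exists (cstar y); first exact: DS.
  by rewrite -starB nm_star.
Qed.

Lemma approx_eq (V W : normedModType R[i]) (D : V -> Prop) (f g : V -> W) (x : V) (c : R) : 0 <= c ->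
  (forall y z : V, nm (f y - f z) <= c * nm (y - z)) ->
  (forall y z : V, nm (g y - g z) <= c * nm (y - z)) ->
  (forall y : V, D y -> f y = g y) -> approx D x -> f x = g x.
Proof.
move=> c0 fc gc fg Dx; apply: nm_smallB => e e0.
have c1 : 0 < c + 1 by rewrite ltr_wpDl.
have [|y Dy xy] := Dx (e / 2 / (c + 1)); first by rewrite !divr_gt0.
have K : c * nm (x - y) <= e / 2.
  move: xy; rewrite ler_pdivlMr//; have := nm_ge0 (x - y); lra.
rewrite (le_trans (nm_via (f y) _ _))// (splitr e) lerD//.
  by rewrite (le_trans (fc _ _)).
by rewrite fg// (le_trans (gc _ _))// nmB.
Qed.

End dense.

Section monomials.
Variables (R : realType) (G : finDigraph) (A : cstarType R).
Variables (p : vertex G -> A) (s : edge G -> A).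
Hypothesis ck : CK_family p s.
Implicit Types (v w : vertex G) (e f : edge G) (al be : seq (edge G)) (x y z : A).

Lemma ck_pp v w : p v ** p w = if v == w then p v else 0.
Proof. by case: eqVneq => [->|/(CK_orth ck)//]; rewrite (CK_idem ck). Qed.

Lemma ck_ps v e : p v ** s e = if v == esource e then s e else 0.
Proof. by rewrite -(CK_source ck e) cmulA ck_pp; case: eqP => [->//|_]; rewrite cmul0x. Qed.

Lemma ck_sp v e : s e ** p v = if v == erange e then s e else 0.
Proof.
rewrite -{1}(CK_range ck e) -cmulA ck_pp eq_sym; case: eqP => _.
  exact: CK_range.
exact: cmulx0.
Qed.

Lemma ck_ps_star v e : cstar (s e) ** p v = if v == esource e then cstar (s e) else 0.
Proof.
apply: star_inj; rewrite cstarM cstarK (CK_selfadj ck) ck_ps.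
by case: eqP; rewrite ?cstarK ?star0.
Qed.

Lemma ck_sp_star v e : p v ** cstar (s e) = if v == erange e then cstar (s e) else 0.
Proof.
apply: star_inj; rewrite cstarM cstarK (CK_selfadj ck) ck_sp.
by case: eqP; rewrite ?cstarK ?star0.
Qed.

(** The product of the edges of a word, ending at the vertex [v]; it vanishes
    when the word is not a path to [v]. *)
Fixpoint word (al : seq (edge G)) v : A :=
  if al is e :: al' then s e ** word al' v else p v.

Definition mono al v be : A := word al v ** cstar (word be v).

Lemma word_rcons al e v : word al v ** s e = if v == esource e then word (rcons al e) (erange e) else 0.
Proof.
elim: al => [|f al IH] /=; first by rewrite ck_ps (CK_range ck).
by rewrite -cmulA IH; case: ifP => _; rewrite ?cmulx0.
Qed.

Lemma p_word v e al w : p v ** word (e :: al) w = if v == esource e then word (e :: al) w else 0.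
Proof. by rewrite /= cmulA ck_ps; case: eqP => // _; rewrite cmul0x. Qed.

Lemma p_word_cases v al w : p v ** word al w = word al w \/ p v ** word al w = 0.
Proof.
case: al => [|e al]; last by rewrite p_word; case: eqP; [left|right].
by rewrite /= ck_pp; case: eqP => [->|_]; [left|right].
Qed.

Lemma mono_star al v be : cstar (mono al v be) = mono be v al.
Proof. by rewrite cstarM cstarK. Qed.

(** The span of the monomials, as an inductive predicate so that properties
    stable under linear combinations follow by induction. Since [s_e^* s_f] is
    zero or a vertex, it is closed under products ([mspanM]), hence it is the
    *-algebra generated by the family. *)
Inductive mspan : set A :=
| mspan0 : mspan 0
| mspan_cons (a : R[i]) al v be x : mspan x -> mspan (a *: mono al v be + x).

Lemma mspanD x y : mspan x -> mspan y -> mspan (x + y).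
Proof.
move=> mx my; elim: mx => [|a al v be z mz IH]; first by rewrite add0r.
by rewrite -addrA; apply: mspan_cons.
Qed.

Lemma mspanZ a x : mspan x -> mspan (a *: x).
Proof.
elim=> [|b al v be z mz IH]; first by rewrite scaler0; apply: mspan0.
by rewrite scalerDr scalerA; apply: mspan_cons.
Qed.

Lemma mspan_mono al v be : mspan (mono al v be).
Proof. by rewrite -[mono _ _ _]addr0 -[mono _ _ _]scale1r; apply/mspan_cons/mspan0. Qed.

Lemma mspan_p v : mspan (p v).
Proof. by have := mspan_mono [::] v [::]; rewrite /mono /= (CK_selfadj ck) (CK_idem ck). Qed.

Lemma mspan_s e : mspan (s e).
Proof.
have := mspan_mono [:: e] (erange e) [::].
by rewrite /mono /= (CK_selfadj ck) -cmulA (CK_idem ck) (CK_range ck).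
Qed.

Lemma mspan_star x : mspan x -> mspan (cstar x).
Proof.
elim=> [|a al v be z mz IH]; first by rewrite star0; apply: mspan0.
by rewrite cstarD cstarZ mono_star; apply: mspan_cons.
Qed.

Lemma mspan_stable (g : A) : (forall al v be, mspan (g ** mono al v be)) ->
  forall x, mspan x -> mspan (g ** x).
Proof.
move=> H x; elim=> [|a al v be z mz IH]; first by rewrite cmulx0; apply: mspan0.
by rewrite cmulDr cmulZr; apply: mspanD => //; apply: mspanZ.
Qed.

Lemma mspan_pM v x : mspan x -> mspan (p v ** x).
Proof.
apply: mspan_stable => al w be; rewrite /mono cmulA.
have [->|->] := p_word_cases v al w; first exact: mspan_mono.
by rewrite cmul0x; apply: mspan0.
Qed.

Lemma mspan_sM e x : mspan x -> mspan (s e ** x).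
Proof. by apply: mspan_stable => al v be; have := mspan_mono (e :: al) v be; rewrite /mono /= -!cmulA. Qed.

Lemma mspan_s_starM e x : mspan x -> mspan (cstar (s e) ** x).
Proof.
apply: mspan_stable => -[|f al] v be.
  rewrite /mono /= cmulA ck_ps_star; case: eqP => [ve|_]; last first.
    by rewrite cmul0x; apply: mspan0.
  rewrite -cstarM word_rcons ve eqxx.
  have := mspan_mono [::] (erange e) (rcons be e); rewrite /mono /=.
  suff -> : p (erange e) ** cstar (word (rcons be e) (erange e)) = 
    cstar (word (rcons be e) (erange e)) by [].
  have := word_rcons be e v; rewrite ve eqxx => <-.
  by rewrite -(CK_selfadj ck) -cstarM -cmulA (CK_range ck).
rewrite /mono /= !cmulA (CK_cuntz ck); case: eqP => _.
  by rewrite -cmulA; apply/mspan_pM/mspan_mono.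
by rewrite !cmul0x; apply: mspan0.
Qed.

(** Multiplying on the left by a monomial is multiplying successively by the
    generators and their adjoints. *)
Lemma mspanM x y : mspan x -> mspan y -> mspan (x ** y).
Proof.
move=> mx my; elim: mx => [|a al v be z mz IH]; first by rewrite cmul0x; apply: mspan0.
rewrite cmulDl cmulZl; apply: mspanD => //; apply: mspanZ; rewrite /mono -cmulA.
have : mspan (cstar (word be v) ** y).
  clear IH; elim: be y my => [|e be IHbe] y my /=; first by rewrite (CK_selfadj ck); apply: mspan_pM.
  by rewrite cstarM -cmulA; apply/IHbe/mspan_s_starM.
elim: al => [|e al IHal] /= H; first exact: mspan_pM.
by rewrite -cmulA; apply/mspan_sM/IHal.
Qed.

Lemma mspan_subalgebra : star_subalgebra mspan.
Proof.
split; [exact: mspan0| |exact: mspanM|exact: mspan_star].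
by move=> a x y mx my; apply: mspanD => //; apply: mspanZ.
Qed.

Hypothesis gen : generates (range p `|` range s).

Lemma mspan_dense x : approx mspan x.
Proof.
suff -> : approx mspan = setT by [].
apply: gen.
- exact/approx_star_subalgebra/mspan_subalgebra.
- exact: approx_closed.
- by move=> _ [[v _ <-]|[e _ <-]]; apply: approx_refl; [apply: mspan_p|apply: mspan_s].
Qed.

Definition ck_one : A := \sum_v p v.

Lemma ck_one_p v : ck_one ** p v = p v.
Proof.
rewrite /ck_one cmul_suml (bigD1 v)//= (CK_idem ck) big1 ?addr0// => w wv.
by rewrite (CK_orth ck).
Qed.

Lemma ck_one_star : cstar ck_one = ck_one.
Proof. by rewrite /ck_one star_sum; apply: eq_bigr => v _; rewrite (CK_selfadj ck). Qed.

Lemma ck_one_word al v : ck_one ** word al v = word al v.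
Proof.
case: al => [|e al] /=; first exact: ck_one_p.
by rewrite -(CK_source ck e) !cmulA ck_one_p.
Qed.

Lemma ck_mul1x x : ck_one ** x = x.
Proof.
apply: (@approx_eq _ _ _ mspan (fun y => ck_one ** y) id _ (nm ck_one + 1)).
- by rewrite addr_ge0 ?nm_ge0.
- by move=> y z; rewrite -cmulBr (le_trans (nmM _ _))// ler_wpM2r ?nm_ge0//; lra.
- by move=> y z; rewrite ler_peMl ?nm_ge0//; have := nm_ge0 ck_one; lra.
- move=> y; elim=> [|a al v be z mz IH]; first by rewrite cmulx0.
  by rewrite cmulDr IH cmulZr /mono cmulA ck_one_word.
- exact: mspan_dense.
Qed.

Lemma ck_mulx1 x : x ** ck_one = x.
Proof. by apply: star_inj; rewrite cstarM ck_one_star ck_mul1x. Qed.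

End monomials.

(** * Averages over roots of unity and Fejer means for circle actions *)

Section roots_of_unity.
Variable R : realType.
Local Notation C := R[i].

Lemma prim_root_exists n : (0 < n)%N -> exists z : C, n.-primitive_root z.
Proof.
move=> n0; pose q : {poly C} := 'X^n - 1.
have [r Dq] := closed_field_poly_normal q.
rewrite (monicP _) ?monicXnsubC// scale1r in Dq.
have rn1 : all n.-unity_root r by apply/allP => z; rewrite -root_prod_XsubC -Dq.
have sz_r : (n < (size r).+1)%N by rewrite -(size_prod_XsubC r id) -Dq size_XnsubC.
have [|z] := hasP (has_prim_root n0 rn1 _ sz_r); last by exists z.
by rewrite -separable_prod_XsubC -Dq separable_Xn_sub_1// pnatr_eq0 -lt0n.
Qed.

(** A primitive root of unity of order [M.+1], so that the averages below are
    never over an empty group. *)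
Definition omega (M : nat) : C := projT1 (cid (prim_root_exists (ltn0Sn M))).

Lemma omega_prim M : (M.+1).-primitive_root (omega M).
Proof. by rewrite /omega; case: cid. Qed.

Lemma cabs_root (z : C) n : z ^+ n.+1 = 1 -> cabs z = 1.
Proof.
move=> zn; apply/eqP; rewrite -(@pexpr_eq1 _ _ n.+1) ?cabs_ge0//.
by rewrite -cabsX zn cabs1.
Qed.

Lemma cabs_omega M j : cabs (omega M ^+ j) = 1.
Proof. by rewrite cabsX (cabs_root (prim_expr_order (omega_prim M))) expr1n. Qed.

Lemma cabs1_neq0 (z : C) : cabs z = 1 -> z != 0.
Proof. by rewrite -cabs_eq0 => ->; rewrite oner_eq0. Qed.

Lemma cabs1_conj (z : C) : cabs z = 1 -> z^* = z^-1.
Proof.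
move=> z1; have z0 := cabs1_neq0 z1; apply: (mulIf z0).
by rewrite mulJ z1 expr1n mulVf.
Qed.

Lemma cabs1_exprz (z : C) (n : int) : cabs z = 1 -> cabs (z ^ n) = 1.
Proof.
move=> z1; case: n => n; first by rewrite cabsX z1 expr1n.
by rewrite NegzE -exprnN cabsV cabsX z1 expr1n invr1.
Qed.

Lemma sum_geom_root (q : C) n : q ^+ n = 1 -> q != 1 -> \sum_(j < n) q ^+ j = 0.
Proof.
move=> qn q1; apply/eqP; have := subrX1 q n; rewrite qn subrr => /esym/eqP.
by rewrite mulf_eq0 subr_eq0 (negPf q1).
Qed.

Lemma omega_exprz_eq1 M (d : int) : (`|d| <= M)%N -> (omega M ^ d == 1) = (d == 0).
Proof.
have pos n : (n <= M)%N -> (omega M ^+ n == 1) = (n == 0)%N.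
  move=> nM; rewrite -(prim_order_dvd (omega_prim M)).
  case: n nM => [|n] nM; first by rewrite dvdn0.
  by rewrite gtnNdvd.
case: d => n /= nM; first exact: pos.
by rewrite NegzE -exprnN invr_eq1 pos// oppr_eq0.
Qed.

(** Orthogonality of the characters of the cyclic group. *)
Lemma sum_omega M (d : int) : (`|d| <= M)%N ->
  \sum_(j < M.+1) (omega M ^+ j) ^ d = if d == 0 then M.+1%:R else 0.
Proof.
move=> dM; case: eqP => [->|/eqP d0].
  rewrite (eq_bigr (fun=> 1)) => [|j _]; last by rewrite expr0z.
  by rewrite sumr_const card_ord.
rewrite (eq_bigr (fun j : 'I__ => (omega M ^ d) ^+ j)) => [|j _]; last first.
  by rewrite !exprnP exprzAC.
apply: sum_geom_root; last by rewrite omega_exprz_eq1.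
by rewrite exprnP exprzAC -exprnP prim_expr_order ?exp1rz// omega_prim.
Qed.

End roots_of_unity.

Section circle_action.
Variables (R : realType) (A : cstarType R).
Local Notation C := R[i].
Implicit Types (x y z : A) (t : C) (n d : int).

Definition homog (gam : C -> A -> A) n x := forall t, cabs t = 1 -> gam t x = t ^ n *: x.

Inductive hsum (gam : C -> A -> A) : A -> Prop :=
| hsum0 : hsum gam 0
| hsum_cons n x y : homog gam n x -> hsum gam y -> hsum gam (x + y).

(** Density of the finite sums of homogeneous elements takes the place of the
    strong continuity of the action. *)
Record circle_action (gam : C -> A -> A) : Prop := CircleAction {
  ca_hom : forall t, cabs t = 1 -> star_hom (gam t);
  ca_le : forall t, cabs t = 1 -> forall x, nm (gam t x) <= nm x;
  ca_one : forall x, gam 1 x = x;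
  ca_comp : forall t u, cabs t = 1 -> cabs u = 1 ->
    forall x, gam t (gam u x) = gam (t * u) x;
  ca_dense : forall x, approx (hsum gam) x
}.

Variable gam : C -> A -> A.
Hypothesis ca : circle_action gam.
Notation H := (homog gam).

Lemma homogD n x y : H n x -> H n y -> H n (x + y).
Proof. by move=> hx hy t t1; rewrite (star_homD (ca_hom ca t1)) hx// hy// scalerDr. Qed.

Lemma homogZ n a x : H n x -> H n (a *: x).
Proof. by move=> hx t t1; rewrite (star_homZ (ca_hom ca t1)) hx// !scalerA mulrC. Qed.

Lemma homog0 n : H n 0.
Proof. by move=> t t1; rewrite (star_hom0 (ca_hom ca t1)) scaler0. Qed.

Lemma homogM n d x y : H n x -> H d y -> H (n + d) (x ** y).
Proof.
move=> hx hy t t1; rewrite (star_hom_mul (ca_hom ca t1)) hx// hy// cmulZl cmulZr.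
by rewrite scalerA expfzDr// cabs1_neq0.
Qed.

Lemma homog_star n x : H n x -> H (- n) (cstar x).
Proof.
move=> hx t t1; rewrite (star_hom_star (ca_hom ca t1)) hx// cstarZ.
by rewrite cabs1_conj ?cabs1_exprz// invr_expz.
Qed.

(** The discrete Fourier coefficient of the orbit of [x], which replaces the
    integral of [t ^ (- n) * gam t x] over the circle. *)
Definition avg n M x : A :=
  M.+1%:R^-1 *: \sum_(j < M.+1) (omega R M ^+ j) ^ (- n) *: gam (omega R M ^+ j) x.

Lemma avgL n M a x y : avg n M (a *: x + y) = a *: avg n M x + avg n M y.
Proof.
rewrite /avg scalerA mulrC -scalerA -scalerDr; congr (_ *: _).
rewrite scaler_sumr -big_split; apply: eq_bigr => j _ /=.
by rewrite (star_hom_linear (ca_hom ca (cabs_omega R M j))) scalerDr !scalerA mulrC.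
Qed.

Lemma avgD n M x y : avg n M (x + y) = avg n M x + avg n M y.
Proof. by have := avgL n M 1 x y; rewrite !scale1r. Qed.

Lemma avg0 n M : avg n M 0 = 0.
Proof. by apply: (addrI (avg n M 0)); rewrite -avgD !addr0. Qed.

Lemma avgZ n M a x : avg n M (a *: x) = a *: avg n M x.
Proof. by have := avgL n M a x 0; rewrite avg0 !addr0. Qed.

Lemma avgB n M x y : avg n M (x - y) = avg n M x - avg n M y.
Proof. by rewrite avgD -scaleN1r avgZ scaleN1r. Qed.

Lemma nm_avg n M x : nm (avg n M x) <= nm x.
Proof.
rewrite nmZ cabsV cabs_nat ler_pdivrMl// (le_trans (nm_sum _ _ _))//.
rewrite -[X in X%:R * _]card_ord -sumr_const mulr_suml.
apply: ler_sum => j _; rewrite nmZ cabs1_exprz ?cabs_omega// !mul1r.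
by rewrite (ca_le ca) ?cabs_omega.
Qed.

Lemma avg_homog n d M x : H d x -> (`|d - n| <= M)%N ->
  avg n M x = if d == n then x else 0.
Proof.
move=> hx dM; rewrite /avg.
rewrite (eq_bigr (fun j : 'I__ => (omega R M ^+ j) ^ (d - n) *: x)) => [|j _]; last first.
  rewrite hx ?cabs_omega// scalerA expfzDr; first by rewrite mulrC.
  by rewrite cabs1_neq0// cabs_omega.
rewrite -scaler_suml sum_omega// scalerA subr_eq0; case: eqP => _.
  by rewrite mulVf ?pnatr_eq0// scale1r.
by rewrite mulr0 scale0r.
Qed.

(** Once [M] exceeds all the differences of degrees, [avg n M] extracts exactly
    the component of degree [n]. *)
Lemma avg_hsum n x : hsum gam x ->
  exists2 y, H n y & exists M0, forall M, (M0 <= M)%N -> avg n M x = y.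
Proof.
elim=> [|d u v hu _ [y hy [M0 yE]]].
  by exists 0; [exact: homog0|exists 0 => M _; exact: avg0].
exists ((if d == n then u else 0) + y).
  by apply: homogD => //; case: eqP => [<-//|_]; exact: homog0.
exists (maxn M0 `|d - n|) => M; rewrite geq_max => /andP[M1 M2].
by rewrite avgD yE// (avg_homog hu).
Qed.

(** The averages are contractive and eventually constant on a dense subset, hence
    Cauchy. *)
Lemma avg_cvg n x : exists y, tends (fun M => avg n M x) y.
Proof.
apply: complete_tends => e e0; have e2 : 0 < e / 2 by rewrite divr_gt0.
have [y hy xy] := ca_dense ca x e2.
have [z _ [M0 zE]] := avg_hsum n hy.
have K M : (M0 <= M)%N -> nm (avg n M x - z) <= e / 2.
  by move=> M0M; rewrite -(zE _ M0M) -avgB (le_trans (nm_avg _ _ _)).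
exists M0 => m k Mm Mk; rewrite (le_trans (nm_via z _ _))// (splitr e) lerD// ?K//.
by rewrite nmB K.
Qed.

(** The [n]-th Fourier coefficient of [x]. *)
Definition fcoef n x : A := projT1 (cid (avg_cvg n x)).

Lemma fcoefP n x : tends (fun M => avg n M x) (fcoef n x).
Proof. by rewrite /fcoef; case: cid. Qed.

Lemma homog_fcoef n x : H n (fcoef n x).
Proof.
move=> t t1; apply: nm_smallB => e e0; have e4 : 0 < e / 4 by rewrite divr_gt0.
have [y hy xy] := ca_dense ca x e4.
have [z hz [M0 zE]] := avg_hsum n hy; have [M1 HM1] := fcoefP n x e4.
have K : nm (fcoef n x - z) <= e / 2.
  have e44 : e / 2 = e / 4 + e / 4 by lra.
  rewrite (le_trans (nm_via (avg n (maxn M0 M1) x) _ _))// e44 lerD//.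
    by rewrite nmB HM1// leq_maxr.
  by rewrite -(zE (maxn M0 M1)) ?leq_maxl// -avgB (le_trans (nm_avg _ _ _)).
rewrite (le_trans (nm_via (gam t z) _ _))// (splitr e) lerD//.
  by rewrite -(star_homB (ca_hom ca t1)) (le_trans (ca_le ca _ _)).
by rewrite hz// -scalerBr nmZ cabs1_exprz// mul1r nmB.
Qed.

(** The Fejer means: the average, against the Fejer kernel, of the orbit of
    [x]. *)
Definition fejer N M x : A :=
  N.+1%:R^-1 *: \sum_(k < N.+1) \sum_(l < N.+1) avg (k%:Z - l%:Z) M x.

Lemma fejerB N M x y : fejer N M (x - y) = fejer N M x - fejer N M y.
Proof.
rewrite -scalerBr -sumrB; congr (_ *: _); apply: eq_bigr => k _.
by rewrite -sumrB; apply: eq_bigr => l _; exact: avgB.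
Qed.

Lemma fejerD N M x y : fejer N M (x + y) = fejer N M x + fejer N M y.
Proof.
rewrite -scalerDr -big_split; congr (_ *: _); apply: eq_bigr => k _.
by rewrite -big_split; apply: eq_bigr => l _; exact: avgD.
Qed.

Lemma dist_lt (N : nat) (k l : 'I_N.+1) : (`|k%:Z - l%:Z| <= N)%N.
Proof.
rewrite -lez_nat abszE ler_norml.
have := ltn_ord k; have := ltn_ord l; rewrite !ltnS -!lez_nat.
have : 0%:Z <= k by []. have : 0%:Z <= l by [].
lra.
Qed.

(** The Fejer kernel is nonnegative, being the square of a modulus, and has
    mean one. *)
Lemma nm_fejer N M x : (N <= M)%N -> nm (fejer N M x) <= nm x.
Proof.
move=> NM; pose c (j : 'I_M.+1) : C := 
  N.+1%:R^-1 * \sum_(k < N.+1) \sum_(l < N.+1) (omega R M ^+ j) ^ - (k%:Z - l%:Z).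
have fE : fejer N M x = M.+1%:R^-1 *: \sum_(j < M.+1) c j *: gam (omega R M ^+ j) x.
  rewrite /fejer /avg.
  under eq_bigr do rewrite -scaler_sumr exchange_big /=.
  rewrite -scaler_sumr scalerA mulrC -scalerA; congr (_ *: _).
  rewrite exchange_big scaler_sumr /=; apply: eq_bigr => j _.
  under eq_bigr do rewrite -scaler_suml.
  by rewrite -scaler_suml scalerA.
have cE j : c j = N.+1%:R^-1 * `|\sum_(l < N.+1) (omega R M ^+ j) ^+ l| ^+ 2.
  congr (_ * _); rewrite normCK rmorph_sum mulrC big_distrl /=.
  apply: eq_bigr => k _; rewrite mulr_sumr; apply: eq_bigr => l _.
  have z1 := cabs_omega R M j.
  rewrite opprB expfzDr ?cabs1_neq0// mulrC rmorphXn /= cabs1_conj//.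
  by rewrite exprVn exprnN -exprnP.
have c0 j : 0 <= c j by rewrite cE mulr_ge0// ?invr_ge0// exprn_ge0.
have sc : \sum_j c j = M.+1%:R.
  rewrite -mulr_sumr exchange_big /=.
  under eq_bigr => k _.
    rewrite exchange_big /=.
    under eq_bigr => l _.
      rewrite sum_omega ?abszN; last by rewrite (leq_trans _ NM)// dist_lt.
      rewrite oppr_eq0 subr_eq0.
    over.
    rewrite (bigD1 k)//= eqxx big1 ?addr0; last first.
      by move=> l lk; case: eqP => // -[] /val_inj kl; rewrite kl eqxx in lk.
    over.
  by rewrite /= sumr_const card_ord -(mulr_natr M.+1%:R) mulrC mulfK// pnatr_eq0.
rewrite fE nmZ cabsV cabs_nat ler_pdivrMl// (le_trans (nm_sum _ _ _))//.
have <- : \sum_j cabs (c j) = M.+1%:R.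
  apply: complexI; rewrite rmorph_sum rmorph_nat -sc; apply: eq_bigr => j _.
  by rewrite -[LHS]/((cabs (c j))%:C%C) -cabsE ger0_norm.
rewrite mulr_suml; apply: ler_sum => j _; rewrite nmZ ler_wpM2l ?cabs_ge0//.
by rewrite (ca_le ca) ?cabs_omega.
Qed.

Lemma sum_lt_le N m : (\sum_(k < N) (k < m)%N <= m)%N.
Proof.
suff -> : (\sum_(k < N) (k < m)%N = minn N m)%N by rewrite geq_minr.
elim: N => [|N IH]; first by rewrite big_ord0 min0n.
rewrite big_ord_recr /= IH; lia.
Qed.

(** The mean multiplies [x] by the number of pairs [(k, l)] with [k - l = d],
    divided by [N.+1]; for at most [|d|] values of [k] there is no such [l]. *)
Lemma fejer_homog N M d x : H d x -> (N + `|d| <= M)%N ->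
  nm (fejer N M x - x) <= N.+1%:R^-1 * `|d|%:R * nm x.
Proof.
move=> hx NM; pose b (k : 'I_N.+1) := (0 <= k%:Z - d) && (k%:Z - d <= N%:Z).
have inner (k : 'I_N.+1) : \sum_(l < N.+1) avg (k%:Z - l%:Z) M x = if b k then x else 0.
  have -> : \sum_(l < N.+1) avg (k%:Z - l%:Z) M x =
      \sum_(l < N.+1) if d == k%:Z - l%:Z then x else 0.
    apply: eq_bigr => l _; apply: avg_homog => //.
    have := dist_lt k l; lia.
  rewrite /b; case: ifPn => [/andP[b1 b2]|nb]; last first.
    rewrite big1// => l _; case: eqP => // dE; case/negP: nb.
    have := ltn_ord l; lia.
  have lN : (`|k%:Z - d| < N.+1)%N by lia.
  rewrite (bigD1 (Ordinal lN))//= ifT; last by lia.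
  rewrite big1 ?addr0// => l; case: eqP => [->//|/eqP lk _]; case: eqP => // dE; case/eqP: lk.
  by apply: val_inj => /=; lia.
have -> : fejer N M x - x = N.+1%:R^-1 *: \sum_(k < N.+1) ((if b k then x else 0) - x).
  rewrite /fejer (eq_bigr _ (fun k _ => inner k)) sumrB scalerBr; congr (_ - _).
  by rewrite sumr_const card_ord -(scaler_nat N.+1 x) scalerA mulVf ?scale1r// pnatr_eq0.
rewrite nmZ cabsV cabs_nat -mulrA ler_pM2l ?invr_gt0// (le_trans (nm_sum _ _ _))//.
rewrite (eq_bigr (fun k => (~~ b k)%:R * nm x)) => [|k _]; last first.
  by case: (b k); rewrite /= ?subrr ?nm0 ?mul0r// sub0r nmN mul1r.
rewrite -mulr_suml ler_wpM2r ?nm_ge0// -natr_sum ler_nat.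
rewrite /b; case: d {hx inner NM b} => m /=.
  rewrite (leq_trans _ (sum_lt_le N.+1 m))// leq_sum// => k _.
  have := ltn_ord k; lia.
rewrite (reindex_inj rev_ord_inj) (leq_trans _ (sum_lt_le N.+1 m.+1))// leq_sum// => k _.
have := ltn_ord k; rewrite /=; lia.
Qed.

Lemma fejer_hsum x : hsum gam x -> forall e, 0 < e ->
  exists N0, forall N, (N0 <= N)%N -> exists M0, forall M, (M0 <= M)%N ->
    nm (fejer N M x - x) <= e.
Proof.
elim=> [|d u v hu _ IH] e e0.
  exists 0%N => N _; exists N => M NM.
  by rewrite (le_trans (nmBD _ _))// nm0 addr0 (le_trans (nm_fejer _ _))// nm0 ltW.
have e2 : 0 < e / 2 by rewrite divr_gt0.
have [N0 HN0] := IH _ e2.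
have d1 : 0 < `|d|%:R * nm u + 1 :> R by rewrite ltr_wpDl// mulr_ge0// nm_ge0.
have [|N1 HN1] := @invn_small _ (e / 2 / (`|d|%:R * nm u + 1)).
  by rewrite !divr_gt0.
exists (maxn N0 N1) => N; rewrite geq_max => /andP[N0N N1N].
have [M0 HM0] := HN0 N N0N.
exists (maxn M0 (N + `|d|)) => M; rewrite geq_max => /andP[M0M NM].
have -> : fejer N M (u + v) - (u + v) = (fejer N M u - u) + (fejer N M v - v).
  by rewrite fejerD opprD addrACA.
rewrite (le_trans (nmD _ _))// (splitr e) lerD ?HM0//.
apply: le_trans (fejer_homog hu NM) _; have := HN1 N N1N; rewrite ler_pdivlMr//.
have : 0 < N.+1%:R^-1 :> R by rewrite invr_gt0.
rewrite -mulrA; move: (N.+1%:R^-1) => r; lra.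
Qed.

(** The Fejer means are contractive and converge to the identity on the
    homogeneous elements, hence everywhere; letting [M] tend to infinity turns
    them into combinations of Fourier coefficients. *)
Lemma fejer_dense x e : 0 < e -> exists N,
  nm (x - N.+1%:R^-1 *: \sum_(k < N.+1) \sum_(l < N.+1) fcoef (k%:Z - l%:Z) x) <= e.
Proof.
move=> e0; have e4 : 0 < e / 4 by rewrite divr_gt0.
have [y hy xy] := ca_dense ca x e4.
have [N /(_ N (leqnn N))[M0 HM0]] := fejer_hsum hy e4; exists N.
have /choice[m mP] : forall kl : 'I_N.+1 * 'I_N.+1, exists M1, forall M, (M1 <= M)%N ->
    nm (avg (kl.1%:Z - kl.2%:Z) M x - fcoef (kl.1%:Z - kl.2%:Z) x) <= e / 4 / N.+1%:R.
  by move=> kl; apply: fcoefP; rewrite divr_gt0.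
pose M := maxn (maxn M0 N) (\max_kl m kl).
have M0M : (M0 <= M)%N by rewrite /M; lia.
have NM : (N <= M)%N by rewrite /M; lia.
have mM kl : (m kl <= M)%N by rewrite (leq_trans (leq_bigmax kl))// leq_maxr.
rewrite (le_trans (nm_via y _ _))//.
rewrite (le_trans (lerD (lexx _) (nm_via (fejer N M y) _ _)))//.
rewrite (le_trans (lerD (lexx _) (lerD (lexx _) (nm_via (fejer N M x) _ _))))//.
have E1 : nm (y - fejer N M y) <= e / 4 by rewrite nmB HM0.
have E2 : nm (fejer N M y - fejer N M x) <= e / 4.
  by rewrite -fejerB (le_trans (nm_fejer _ NM))// nmB.
suff : nm (fejer N M x - N.+1%:R^-1 *:
    \sum_(k < N.+1) \sum_(l < N.+1) fcoef (k%:Z - l%:Z) x) <= e / 4 by lra.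
rewrite -scalerBr nmZ cabsV cabs_nat ler_pdivrMl// -sumrB (le_trans (nm_sum _ _ _))//.
rewrite -[X in X%:R * _]card_ord -sumr_const mulr_suml; apply: ler_sum => k _.
rewrite mul1r -sumrB (le_trans (nm_sum _ _ _))//.
have -> : e / 4 = \sum_(l < N.+1) e / 4 / N.+1%:R.
  by rewrite sumr_const card_ord -[RHS]mulr_natr divfK// pnatr_eq0.
by apply: ler_sum => l _; exact: (mP (k, l) M (mM _)).
Qed.

End circle_action.

(** * The gauge action *)

Section gauge.
Variables (R : realType) (G : finDigraph) (A : cstarType R).
Variables (p : vertex G -> A) (s : edge G -> A).
Hypothesis hA : is_CK p s.
Local Notation C := R[i].
Let ck := is_CK_family hA.
Let gen := is_CK_generates hA.
Implicit Types (v w : vertex G) (e f : edge G) (al be : seq (edge G)) (x y z : A).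

Lemma rotate_family (t : C) : cabs t = 1 -> CK_family p (fun e => t *: s e).
Proof.
move=> t1; have tt : t^* * t = 1 by rewrite mulJ t1 expr1n.
case: ck => c1 c2 c3 c4 c5 c6 c7; split => //.
- by move=> e; rewrite cmulZr c4.
- by move=> e; rewrite cmulZl c5.
- by move=> e f; rewrite cstarZ cmulZl cmulZr scalerA tt scale1r c6.
- move=> v ve; rewrite (c7 _ ve); apply: eq_bigr => e _.
  by rewrite cstarZ cmulZl cmulZr scalerA mulrC tt scale1r.
Qed.

(** Universality, applied to the algebra itself and to the family in which every
    edge is multiplied by [t]. *)
Lemma gauge_exists : exists gam : C -> A -> A, forall t, cabs t = 1 ->
  [/\ star_hom (gam t), forall v, gam t (p v) = p v & forall e, gam t (s e) = t *: s e].
Proof.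
suff /choice[gam gamP] : forall t : C, exists phi : A -> A, cabs t = 1 ->
  [/\ star_hom phi, forall v, phi (p v) = p v & forall e, phi (s e) = t *: s e].
  by exists gam.
move=> t; have [t1|t1] := pselect (cabs t = 1); last by exists id.
by have [phi] := is_CK_universal hA (rotate_family t1); exists phi.
Qed.

Definition gauge : C -> A -> A := projT1 (cid gauge_exists).

Lemma gaugeP t : cabs t = 1 ->
  [/\ star_hom (gauge t), forall v, gauge t (p v) = p v & forall e, gauge t (s e) = t *: s e].
Proof. by rewrite /gauge; case: cid => ? H /H. Qed.

Lemma gauge_le t x : cabs t = 1 -> nm (gauge t x) <= nm x.
Proof.
move=> t1; have [th tp ts] := gaugeP t1.
apply: (star_hom_contractive (ck_mul1x ck gen) (ck_mulx1 ck gen) th).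
rewrite /ck_one.
by rewrite (big_morph _ (star_homD th) (star_hom0 th)); apply: eq_bigr => v _; rewrite tp.
Qed.

Lemma homog_word t al v : cabs t = 1 -> gauge t (word p s al v) = t ^+ size al *: word p s al v.
Proof.
move=> t1; have [th tp ts] := gaugeP t1.
elim: al => [|e al IH] /=; first by rewrite tp scale1r.
by rewrite (star_hom_mul th) ts IH cmulZl cmulZr scalerA exprS.
Qed.

Lemma homog_mono al v be :
  homog gauge ((size al)%:Z - (size be)%:Z) (mono p s al v be).
Proof.
move=> t t1; have [th tp ts] := gaugeP t1.
rewrite (star_hom_mul th) (star_hom_star th) !homog_word// cstarZ cmulZl cmulZr scalerA.
rewrite rmorphXn /= cabs1_conj// expfzDr ?cabs1_neq0// exprVn exprnN.
by rewrite -exprnP.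
Qed.

Lemma mspan_hsum x : mspan p s x -> hsum gauge x.
Proof.
elim=> [|a al v be y _ IH]; first exact: hsum0.
apply: hsum_cons IH => t t1; have [th _ _] := gaugeP t1.
by rewrite (star_homZ th) homog_mono// !scalerA mulrC.
Qed.

(** Two contractive linear maps that agree on the monomials are equal; this gives
    the group law. *)
Lemma gauge_action : circle_action gauge.
Proof.
have lin t : cabs t = 1 -> forall y z, nm (gauge t y - gauge t z) <= nm (y - z).
  move=> t1 y z; have [th _ _] := gaugeP t1.
  by rewrite -(star_homB th) gauge_le.
have ext (f g : A -> A) : (forall y z, nm (f y - f z) <= nm (y - z)) ->
    (forall y z, nm (g y - g z) <= nm (y - z)) ->
    (forall a x y, f (a *: x + y) = a *: f x + f y) ->
    (forall a x y, g (a *: x + y) = a *: g x + g y) ->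
    (forall al v be, f (mono p s al v be) = g (mono p s al v be)) -> f =1 g.
  move=> fl gl fL gL fg x.
  apply: (@approx_eq _ _ _ (mspan p s) f g x 1) => //.
  - by move=> y z; rewrite mul1r.
  - by move=> y z; rewrite mul1r.
  - move=> y; elim=> [|a al v be z _ IH]; last by rewrite fL gL fg IH.
    have h0 h : (forall a x y, h (a *: x + y) = a *: h x + h y) -> h 0 = 0 :> A.
      by move=> /(_ (-1) 0 0); rewrite addr0 scaleN1r oppr0 scaleN1r addNr.
    by rewrite !h0.
  - exact: mspan_dense.
split.
- by move=> t /gaugeP[].
- by move=> t t1 x; exact: gauge_le.
- have c1 : cabs (1 : C) = 1 by exact: cabs1.
  apply: (ext _ id) => //; first exact: lin.
    by case: (gaugeP c1) => th _ _; exact: star_hom_linear.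
  by move=> al v be; rewrite homog_mono// exp1rz scale1r.
- move=> t u t1 u1; have tu1 : cabs (t * u) = 1 by rewrite cabsM t1 u1 mulr1.
  have [tl _ _] := gaugeP t1; have [ul _ _] := gaugeP u1; have [tul _ _] := gaugeP tu1.
  apply: (ext (fun x => gauge t (gauge u x)) (gauge (t * u))).
  + by move=> y z; rewrite (le_trans (lin t t1 _ _))// lin.
  + exact: lin.
  + by move=> a x y; rewrite (star_hom_linear ul) (star_hom_linear tl).
  + exact: star_hom_linear tul.
  + move=> al v be; rewrite !homog_mono//.
    by rewrite (star_homZ tl) homog_mono// scalerA mulrC -expfzMl.
- move=> x; apply: approx_trans (mspan_dense ck gen x) => y /mspan_hsum.
  exact: approx_refl.
Qed.

End gauge.

(** * Central elements of degree zero *)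

Section degree_zero.
Variables (R : realType) (G : finDigraph) (A : cstarType R).
Variables (p : vertex G -> A) (s : edge G -> A).
Hypothesis hA : is_CK p s.
Local Notation C := R[i].
Let ck := is_CK_family hA.
Let gen := is_CK_generates hA.
Local Notation gam := (gauge hA).
Let ca := gauge_action hA.
Implicit Types (v w : vertex G) (e f : edge G) (al be : seq (edge G)) (x y z : A).

Fixpoint walk n v w : Prop :=
  if n is n'.+1 then exists2 e : edge G, esource e = v & walk n' (erange e) w else v = w.

(** The vertices at which a central element can be compressed to a scalar: sinks,
    and ends of arbitrarily long paths. The values of a central element of
    degree zero at these vertices determine it ([core_scalar] and
    [core_faithful]), so that such elements form a finite-dimensional algebra. *)
Definition core w : Prop :=
  (forall e : edge G, esource e != w) \/ (forall n, exists v, walk n v w).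

(** For every path [mu] of length [n] the compression [s_mu^* x s_mu] is a scalar
    multiple of the range of [mu]; peeling off the first edge at each step
    avoids naming paths. *)
Fixpoint path_scalar n x : Prop :=
  if n is n'.+1 then forall e, path_scalar n' (cstar (s e) ** x ** s e)
  else forall v, exists c : C, p v ** x ** p v = c *: p v.

Lemma path_scalarL n a x y : path_scalar n x -> path_scalar n y -> path_scalar n (a *: x + y).
Proof.
elim: n x y => [|n IH] x y hx hy /=.
  move=> v; have [c xc] := hx v; have [d yd] := hy v; exists (a * c + d).
  by rewrite cmulDr cmulDl cmulZr cmulZl xc yd scalerDl scalerA.
by move=> e; rewrite cmulDr cmulDl cmulZr cmulZl; apply: IH.
Qed.

Lemma path_scalar0 n : path_scalar n 0.
Proof.
elim: n => [|n IH] /=; first by move=> v; exists 0; rewrite cmulx0 cmul0x scale0r.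
by move=> e; rewrite cmulx0 cmul0x.
Qed.

Lemma path_scalarS n x : path_scalar n x -> path_scalar n.+1 x.
Proof.
elim: n x => [|n IH] x /=; last by move=> H e; apply: IH.
move=> H e v; rewrite !cmulA ck_sp_star//; case: eqP => [->|_]; last first.
  by exists 0; rewrite !cmul0x scale0r.
have [c xc] := H (esource e); exists c.
rewrite -!cmulA (CK_range ck) -(CK_source ck e) cstarM (CK_selfadj ck).
rewrite -!cmulA (cmulA (p _)) (cmulA _ (p _)) xc cmulZl cmulZr (CK_source ck).
by rewrite (CK_cuntz ck) eqxx.
Qed.

Lemma path_scalar_le n m x : (n <= m)%N -> path_scalar n x -> path_scalar m x.
Proof.
move=> /subnKC <-; elim: (m - n)%N => [|k IH]; first by rewrite addn0.
by move=> /IH; rewrite addnS; apply: path_scalarS.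
Qed.

Lemma path_scalar_pp n v x : path_scalar n x -> path_scalar n (p v ** x ** p v).
Proof.
case: n => [|n] H /=.
  move=> w; rewrite -!cmulA (ck_pp ck) !cmulA (ck_pp ck) eq_sym.
  case: eqP => [<-|_]; first exact: H.
  by exists 0; rewrite !cmul0x scale0r.
move=> e; rewrite -!cmulA (ck_ps ck) !cmulA (ck_ps_star ck).
by case: eqP => // _; rewrite !cmul0x; apply: path_scalar0.
Qed.

(** Compression by a path of the common length of [al] and [be] gives a vertex
    when [al], [be] and the path coincide, and zero otherwise. *)
Lemma path_scalar_mono al v be : size al = size be ->
  path_scalar (size al) (mono p s al v be).
Proof.
elim: al be => [|f al IH] [|g be] //= sz.
  move=> w; rewrite /mono /= (CK_selfadj ck) (CK_idem ck) (ck_pp ck).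
  case: eqP => [->|_]; first by exists 1; rewrite (CK_idem ck) scale1r.
  by exists 0; rewrite cmul0x scale0r.
move=> e; rewrite /mono /= cstarM !cmulA (CK_cuntz ck) -!cmulA (CK_cuntz ck).
case: eqP => [->|_]; last by rewrite cmul0x; apply: path_scalar0.
case: eqP => _; last by rewrite !cmulx0; apply: path_scalar0.
rewrite !cmulA -(cmulA (p _)); apply: path_scalar_pp.
by apply: IH; case: sz.
Qed.

Lemma path_scalar_avg x : mspan p s x ->
  exists n M0, forall M, (M0 <= M)%N -> path_scalar n (avg gam 0 M x).
Proof.
elim=> [|a al v be y _ [n [M0 H]]].
  by exists 0%N, 0%N => M _; rewrite avg0//; apply: path_scalar0.
exists (maxn n (size al)), (maxn M0 (size al + size be)) => M.
rewrite geq_max => /andP[M0M sM]; rewrite avgL//.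
apply: path_scalarL; last by apply: path_scalar_le (H M M0M); rewrite leq_maxl.
rewrite (avg_homog (homog_mono hA _ _ _)); last by lia.
case: eqP => [sz|_]; last exact: path_scalar0.
apply: (@path_scalar_le (size al)); first exact: leq_maxr.
by apply: path_scalar_mono; lia.
Qed.

Lemma sink_scalar w x : (forall e : edge G, esource e != w) -> mspan p s x ->
  exists c : C, p w ** x ** p w = c *: p w.
Proof.
move=> sw; have pw al v : p w ** word p s al v = if (al == [::]) && (v == w) then p w else 0.
  case: al => [|e al]; first by rewrite /= (ck_pp ck) eq_sym.
  by rewrite (p_word ck) eq_sym (negPf (sw e)).
elim=> [|a al v be y _ [c yc]]; first by exists 0; rewrite cmulx0 cmul0x scale0r.
exists (a * ((al == [::]) && (v == w))%:R * ((be == [::]) && (v == w))%:R + c).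
rewrite cmulDr cmulDl yc scalerDl cmulZr cmulZl; congr (_ + _).
have -> : p w ** mono p s al v be ** p w =
    (p w ** word p s al v) ** cstar (p w ** word p s be v).
  by rewrite cstarM (CK_selfadj ck) !cmulA.
rewrite !pw -mulrA -scalerA; congr (_ *: _).
case: (_ && _); case: (_ && _); rewrite ?star0 ?cmulx0 ?cmul0x ?mulr0 ?mul0r ?scale0r//.
by rewrite (CK_selfadj ck) (CK_idem ck) mulr1 scale1r.
Qed.

Section central.
Variable z : A.
Hypothesis zC : forall y, z ** y = y ** z.

(** As [z] is central, [s_mu^* z s_mu = z p_w] for every path [mu] with end [w], so
    that the compressions of an approximation of [z] approximate [z p_w]. *)
Lemma compress_walk n v w x (d : R) : walk n v w -> path_scalar n x ->
  nm (p v ** (z - x) ** p v) <= d -> exists c : C, nm (z ** p w - c *: p w) <= d.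
Proof.
elim: n v x => [|n IH] v x /=.
  move=> -> /(_ w)[c xc] H; exists c; move: H.
  by rewrite cmulBr cmulBl xc -zC -cmulA (CK_idem ck).
move=> [e <- ew] xs H; apply: (IH _ _ ew (xs e)).
have -> : p (erange e) ** (z - cstar (s e) ** x ** s e) ** p (erange e) =
    cstar (s e) ** (p (esource e) ** (z - x) ** p (esource e)) ** s e.
  have sp : cstar (s e) ** p (esource e) = cstar (s e) by rewrite (ck_ps_star ck) eqxx.
  have ps : p (erange e) ** cstar (s e) = cstar (s e) by rewrite (ck_sp_star ck) eqxx.
  rewrite [RHS](_ : _ = cstar (s e) ** (z - x) ** s e); last first.
    by rewrite !cmulA sp -(cmulA _ (p _) (s e)) (CK_source ck).
  rewrite !cmulBr !cmulBl -(zC (p _)) -(zC (cstar _)); congr (_ - _).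
    by rewrite -!cmulA (CK_idem ck) (CK_cuntz ck) eqxx.
  by rewrite !cmulA ps -cmulA (CK_range ck).
have iso : nm (s e) <= 1.
  apply: (@nm_isom _ _ (s e) (p (erange e))); rewrite ?(CK_selfadj ck) ?(CK_idem ck)//.
  by rewrite (CK_cuntz ck) eqxx.
have d0 : 0 <= d := le_trans (nm_ge0 _) H.
rewrite (le_trans (nmM _ _))// -[leRHS]mulr1 ler_pM ?nm_ge0//.
by rewrite (le_trans (nmM _ _))// -[leRHS]mul1r ler_pM ?nm_ge0// nm_star.
Qed.

(** Approximate [z] by the degree zero part of an element of the span. At a sink
    the corner of [p w] is already scalar; at the end of arbitrarily long paths
    a long enough path compresses the approximation to a scalar. *)
Lemma core_scalar w : homog gam 0 z -> core w -> exists c : C, z ** p w = c *: p w.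
Proof.
move=> z0 cw; apply: approx_line => d d0.
have [x mx zx] := mspan_dense ck gen z d0.
have p1 : nm (p w) <= 1 by apply: nm_proj_le1; rewrite ?(CK_selfadj ck) ?(CK_idem ck).
have comp v y : nm (z - y) <= d -> nm (p v ** (z - y) ** p v) <= d.
  have {}p1 : nm (p v) <= 1 by apply: nm_proj_le1; rewrite ?(CK_selfadj ck) ?(CK_idem ck).
  move=> zy; rewrite (le_trans (nmM _ _))// -[leRHS]mulr1 ler_pM ?nm_ge0//.
  by rewrite (le_trans (nmM _ _))// -[leRHS]mul1r ler_pM ?nm_ge0.
case: cw => [sw|iw].
  have [c xc] := sink_scalar sw mx; exists (c *: p w); first by exists c.
  by have := comp w x zx; rewrite cmulBr cmulBl xc -zC -cmulA (CK_idem ck).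
have [n [M0 /(_ _ (leqnn M0)) H]] := path_scalar_avg mx.
have [v vw] := iw n.
have [|c Hc] := compress_walk (d := d) vw H; last by exists (c *: p w) => //; exists c.
apply: comp; have {1}<- : avg gam 0 M0 z = z by rewrite (avg_homog z0).
by rewrite -avgB// (le_trans (nm_avg ca _ _ _)).
Qed.

(** Centrality carries the value of [z] along the edges. *)
Lemma vertex_krieger v : (exists e, esource e = v) ->
  z ** p v = \sum_(e | esource e == v) s e ** (z ** p (erange e)) ** cstar (s e).
Proof.
move=> ve; rewrite (CK_krieger ck ve) cmul_sumr; apply: eq_bigr => e _.
by rewrite cmulA zC !cmulA -[s e ** _ ** p _]cmulA zC !cmulA (CK_range ck).
Qed.

(** By the Krieger relation, if [z] does not vanish at a vertex which is not a
    sink, then it does not vanish at the range of some edge leaving it. Walking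
    along such edges for long enough leads to a core vertex. *)
Lemma core_faithful : (forall w, core w -> z ** p w = 0) -> z = 0.
Proof.
move=> z0; rewrite -(ck_mulx1 ck gen z) /ck_one cmul_sumr big1// => v _.
apply: contrapT => zv.
have escape n : forall u, z ** p u <> 0 -> exists2 w, walk n u w & z ** p w <> 0.
  elim: n => [|n IH] u zu; first by exists u.
  have [|/forallNP H] := pselect (exists e, esource e = u /\ z ** p (erange e) <> 0).
    by move=> [e [eu /IH[w ew zw]]]; exists w => //; exists e.
  exfalso; apply: zu; have [ue|/forallNP ue] := pselect (exists e, esource e = u).
    rewrite (vertex_krieger ue) big1// => e /eqP eu.
    have -> : z ** p (erange e) = 0 by apply: contrapT => h; apply: (H e).
    by rewrite cmulx0 cmul0x.
  by apply: z0; left => e; apply/eqP/ue.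
(* [b w] bounds the length of the walks that end at a non-core vertex [w]. *)
have /choice[b bP] : forall w, exists n, ~ core w -> forall u, ~ walk n u w.
  move=> w; have [|/not_orP[_ /existsNP[n /forallNP H]]] := pselect (core w).
    by exists 0%N.
  by exists n.
have drop n m u w : walk (n + m) u w -> exists u', walk m u' w.
  elim: n u => [|n IH] u; first by exists u.
  by rewrite addSn => -[e _ /IH].
have [w vw zw] := escape (\max_w b w) v zv.
have ncw : ~ core w by move=> /z0.
have := vw; rewrite -(subnK (leq_bigmax w)) => /drop[u].
exact: bP.
Qed.

End central.

End degree_zero.

(** * Minimal projections of degree zero in the center *)

Section minimal_projections.
Variables (R : realType) (G : finDigraph) (A : cstarType R).
Variables (p : vertex G -> A) (s : edge G -> A).
Hypothesis hA : is_CK p s.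
Local Notation C := R[i].
Let ck := is_CK_family hA.
Let gen := is_CK_generates hA.
Local Notation gam := (gauge hA).
Let ca := gauge_action hA.
Local Notation one := (ck_one p).
Let mul1x := ck_mul1x ck gen.
Let mulx1 := ck_mulx1 ck gen.
Implicit Types (v w : vertex G) (x y z : A) (n : int).

Definition chomog n z : Prop := (forall y, z ** y = y ** z) /\ homog gam n z.

Lemma chomogL n a x y : chomog n x -> chomog n y -> chomog n (a *: x + y).
Proof.
move=> [xC xh] [yC yh]; split; last by apply: homogD => //; apply: homogZ.
by move=> z; rewrite cmulDl cmulDr cmulZl cmulZr xC yC.
Qed.

Lemma chomog0 n : chomog n 0.
Proof. by split; [move=> z; rewrite cmul0x cmulx0|apply: homog0]. Qed.

Lemma chomogZ n a x : chomog n x -> chomog n (a *: x).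
Proof. by move=> hx; rewrite -[_ *: _]addr0; apply/chomogL/chomog0. Qed.

Lemma chomogD n x y : chomog n x -> chomog n y -> chomog n (x + y).
Proof. by move=> hx; rewrite -[x]scale1r; apply: chomogL. Qed.

Lemma chomogM n m x y : chomog n x -> chomog m y -> chomog (n + m) (x ** y).
Proof.
move=> [xC xh] [yC yh]; split; last exact: homogM.
by move=> z; rewrite -cmulA yC cmulA xC cmulA.
Qed.

Lemma chomog_star n x : chomog n x -> chomog (- n) (cstar x).
Proof.
move=> [xC xh]; split; last exact: homog_star.
by move=> z; apply: star_inj; rewrite !cstarM cstarK xC.
Qed.

Lemma chomog1 : chomog 0 one.
Proof.
split=> [z|t t1]; first by rewrite mul1x mulx1.
have [th tp _] := gaugeP hA t1.
rewrite expr0z scale1r /ck_one (big_morph _ (star_homD th) (star_hom0 th)).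
by apply: eq_bigr => v _; rewrite tp.
Qed.

(** A central element of degree zero is faithfully represented by the function
    sending a vertex [w] with [live w] to the scalar by which it acts on [p w].
    The condition [p w != 0] makes this scalar unique. *)
Definition live w : Prop := core w /\ p w != 0.

Definition same w w' : Prop :=
  forall z, chomog 0 z -> forall c : C, z ** p w = c *: p w -> z ** p w' = c *: p w'.

Lemma chomog0_val z w : chomog 0 z -> live w -> exists c : C, z ** p w = c *: p w.
Proof. by move=> [zC zh] [cw _]; apply: (core_scalar (hA := hA)). Qed.

Lemma chomog0_eq z z' : chomog 0 z -> chomog 0 z' ->
  (forall w, live w -> z ** p w = z' ** p w) -> z = z'.
Proof.
move=> [zC zh] [zC' zh'] H; apply/eqP; rewrite -subr_eq0; apply/eqP.
apply: (core_faithful hA) => [y|w cw]; first by rewrite cmulBl cmulBr zC zC'.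
have [->|pw] := eqVneq (p w) 0; first by rewrite cmulx0.
by rewrite cmulBl H ?subrr.
Qed.

Lemma sameC w w' : live w -> live w' -> same w w' -> same w' w.
Proof.
move=> lw lw' ww z zh c zc; have [d zd] := chomog0_val zh lw.
have := ww z zh d zd; rewrite zc => /eqP; rewrite -subr_eq0 -scalerBl scaler_eq0.
by rewrite (negPf lw'.2) orbF subr_eq0 => /eqP ->.
Qed.

Lemma same_trans w w' w'' : same w w' -> same w' w'' -> same w w''.
Proof. by move=> h h' z zh c /(h z zh) /(h' z zh). Qed.

(** A product of interpolants, one for each vertex separated from [w]. *)
Lemma class_indicator w : live w -> exists2 e, chomog 0 e &
  forall w', live w' -> (same w w' -> e ** p w' = p w') /\ (~ same w w' -> e ** p w' = 0).
Proof.
move=> lw; suff [e eh [ew e0]] : exists2 e, chomog 0 e & e ** p w = p w /\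
    forall w', w' \in enum (vertex G) -> live w' -> ~ same w w' -> e ** p w' = 0.
  exists e => // w' lw'; split; last by apply: e0; rewrite ?mem_enum.
  by move=> /(_ e eh 1); rewrite !scale1r; apply.
elim: (enum _) => [|w' r [e eh [ew e0]]].
  by exists one; [exact: chomog1|rewrite mul1x].
have [ww|ww] := pselect (same w w' \/ ~ live w').
  exists e => //; split => // u; rewrite inE => /orP[/eqP ->|]; last exact: e0.
  by case: ww.
have /not_orP[/existsNP[z /not_implyP[zh /existsNP[c /not_implyP[zc zc']]]] /contrapT lw'] := ww.
have [d zd] := chomog0_val zh lw'.
have dc : c - d != 0 by apply/eqP => /subr0_eq cd; apply: zc'; rewrite cd.
pose f := (c - d)^-1 *: (z - d *: one).
have fh : chomog 0 f.
  apply: chomogZ; rewrite -scaleNr addrC; apply: chomogL => //; exact: chomog1.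
exists (f ** e); first by rewrite -[0]addr0; apply: chomogM.
have fp u b : z ** p u = b *: p u -> f ** p u = ((b - d) / (c - d)) *: p u.
  by move=> zb; rewrite cmulZl cmulBl zb cmulZl mul1x -scalerBl scalerA mulrC.
split; first by rewrite -cmulA ew (fp _ _ zc) divff// scale1r.
move=> u; rewrite inE => /orP[/eqP ->|ur] lu wu; last by rewrite -cmulA e0 ?cmulx0.
by rewrite (fh.1 e) -cmulA (fp _ _ zd) subrr mul0r scale0r cmulx0.
Qed.

(** The algebra of functions given by the central elements of degree zero consists
    of all functions that are constant on the classes of [same]; its minimal
    projections are the indicators of the classes, listed here without
    repetition. *)
Lemma minimal_projections : exists (m : nat) (e : 'I_m -> A),
  [/\ forall i, [/\ chomog 0 (e i), cstar (e i) = e i, e i ** e i = e i & e i != 0],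
      forall i j, i != j -> e i ** e j = 0,
      forall i z, chomog 0 z -> exists c : C, z ** e i = c *: e i &
      \sum_i e i = one].
Proof.
have /choice[E EP] : forall w, exists e, live w -> chomog 0 e /\
  forall w', live w' -> (same w w' -> e ** p w' = p w') /\ (~ same w w' -> e ** p w' = 0).
  move=> w; have [lw|lw] := pselect (live w); last by exists 0.
  by have [e eh eP] := class_indicator lw; exists e.
have Eh w : live w -> chomog 0 (E w) by move=> /EP[].
have E1 w w' : live w -> live w' -> same w w' -> E w ** p w' = p w'.
  by move=> /EP[_ h] /h[].
have E0 w w' : live w -> live w' -> ~ same w w' -> E w ** p w' = 0.
  by move=> /EP[_ h] /h[].
have refl w : same w w by [].
have hM x y : chomog 0 x -> chomog 0 y -> chomog 0 (x ** y).
  by move=> hx hy; rewrite -[0]addr0; apply: chomogM.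
have Eidem w : live w -> E w ** E w = E w.
  move=> lw; apply: chomog0_eq => [||u lu]; [exact/hM/Eh/lw/Eh|exact: Eh|].
  have [wu|wu] := pselect (same w u); rewrite -cmulA; first by rewrite !E1.
  by rewrite E0// cmulx0.
have Estar w : live w -> cstar (E w) = E w.
  move=> lw; have Esh : chomog 0 (cstar (E w)) by rewrite -[0]oppr0; apply/chomog_star/Eh.
  apply: chomog0_eq => [||u lu]; [exact: Esh|exact: Eh|].
  rewrite (Esh.1 (p u)) -{1}(CK_selfadj ck u) -cstarM.
  have [wu|wu] := pselect (same w u); first by rewrite !E1// (CK_selfadj ck).
  by rewrite !E0// star0.
have Enz w : live w -> E w != 0.
  move=> lw; apply/eqP => e0; have := E1 w w lw lw (refl w).
  by rewrite e0 cmul0x => /esym/eqP; rewrite (negPf lw.2).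
have Esame w w' : live w -> live w' -> same w w' -> E w = E w'.
  move=> lw lw' ww; apply: chomog0_eq => [||u lu]; [exact: Eh|exact: Eh|].
  have [wu|wu] := pselect (same w u).
    by rewrite !E1//; apply: same_trans wu; apply: sameC.
  by rewrite !E0// => w'u; apply: wu; apply: same_trans w'u.
have Eorth w w' : live w -> live w' -> E w <> E w' -> E w ** E w' = 0.
  move=> lw lw' ww; apply: chomog0_eq => [||u lu]; [exact/hM/Eh/lw'/Eh|exact: chomog0|].
  rewrite cmul0x -cmulA; have [w'u|w'u] := pselect (same w' u); last by rewrite E0// cmulx0.
  rewrite E1// E0// => wu; apply/ww/Esame => //; apply: same_trans wu _; exact: sameC.
have Eval w z : live w -> chomog 0 z -> exists c : C, z ** E w = c *: E w.
  move=> lw zh; have [c zc] := chomog0_val zh lw; exists c.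
  apply: chomog0_eq => [||u lu]; [exact/hM/Eh|exact/chomogZ/Eh|].
  rewrite -cmulA cmulZl; have [wu|wu] := pselect (same w u); last by rewrite E0// cmulx0 scaler0.
  by rewrite E1//; apply: wu.
pose l := undup [seq E w | w <- enum (vertex G) & `[< live w >]].
have lP x : x \in l -> exists2 w, live w & x = E w.
  rewrite mem_undup => /mapP[w]; rewrite mem_filter => /andP[/asboolP lw _ ->].
  by exists w.
have lE w : live w -> E w \in l.
  by move=> lw; rewrite mem_undup map_f// mem_filter mem_enum andbT; apply/asboolP.
have nl (i : 'I_(size l)) : exists2 w, live w & l`_i = E w by apply/lP/mem_nth.
exists (size l), (fun i => l`_i); split.
- move=> i; have [w lw ->] := nl i.
  by split; [exact: Eh|exact: Estar|exact: Eidem|exact: Enz].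
- move=> i j ij; have [w lw iw] := nl i; have [w' lw' jw] := nl j.
  rewrite iw jw; apply: Eorth => //; rewrite -iw -jw => /eqP.
  by rewrite nth_uniq ?undup_uniq// => /eqP/val_inj ij'; rewrite ij' eqxx in ij.
- by move=> i z zh; have [w lw ->] := nl i; apply: Eval.
apply: chomog0_eq => [||u lu].
- elim/big_ind: _ => [|x y hx hy|i _]; [exact: chomog0|exact: chomogD|].
  by have [w lw ->] := nl i; exact: Eh.
- exact: chomog1.
rewrite mul1x -(big_mkord xpredT (fun i => l`_i)) -(big_nth 0 xpredT id).
rewrite (bigD1_seq (E u)) ?undup_uniq ?lE//= cmulDl E1//.
rewrite cmul_suml big_seq_cond big1 ?addr0// => x /andP[/lP[w lw ->] /eqP wu].
by rewrite -(E1 u u lu lu (refl u)) cmulA Eorth// cmul0x.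
Qed.

End minimal_projections.

(** * Laurent polynomials in a unitary *)

Section laurent.
Variables (R : realType) (A : cstarType R).
Local Notation C := R[i].
Implicit Types (q r : {poly C}) (x y z e u : A).

Definition upow e u k : A := iter k (cmul u) e.

Definition peval e u q : A := \sum_(i < size q) q`_i *: upow e u i.

Record corner_unitary e u : Prop := CornerUnitary {
  cu_star : cstar e = e;
  cu_idem : e ** e = e;
  cu_unit : e ** u = u;
  cu_isom : cstar u ** u = e;
  cu_coisom : u ** cstar u = e
}.

(** The last condition says that the Fourier coefficients of a polynomial in [u]
    are bounded by its norm; it amounts to the spectrum of [u] being the whole
    circle, and determines the norm of every polynomial in [u]
    ([nm_peval_le]). *)
Record circular e u : Prop := Circular {
  circ_unitary : corner_unitary e u;
  circ_coef : forall q i, cabs q`_i <= nm (peval e u q)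
}.

Variables (e u : A).
Hypothesis cu : corner_unitary e u.
Notation U := (upow e u).
Notation P := (peval e u).

Let es := cu_star cu.
Let ee := cu_idem cu.
Let eu := cu_unit cu.
Let su := cu_isom cu.
Let us := cu_coisom cu.

Lemma cu_unitr : u ** e = u.
Proof. by rewrite -su cmulA us eu. Qed.

Lemma cmul_e_upow k : e ** U k = U k.
Proof. by case: k => [|k] //=; rewrite cmulA eu. Qed.

Lemma upowD j k : U (j + k) = U j ** U k.
Proof. by elim: j => [|j IH] /=; rewrite ?cmul_e_upow// IH cmulA. Qed.

Lemma cmul_upow_e k : U k ** e = U k.
Proof. by rewrite -[e]/(U 0) -upowD addn0. Qed.

Lemma upowC j k : U j ** U k = U k ** U j.
Proof. by rewrite -!upowD addnC. Qed.

Lemma upow_isom k : cstar (U k) ** U k = e.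
Proof.
elim: k => [|k IH] /=; first by rewrite es.
by rewrite cstarM -cmulA (cmulA _ u) su cmul_e_upow.
Qed.

Lemma upow_coisom k : U k ** cstar (U k) = e.
Proof.
elim: k => [|k IH] /=; first by rewrite es.
rewrite cstarM -cmulA (cmulA _ _ (cstar u)) IH.
by rewrite -{1}es -cstarM cu_unitr us.
Qed.

Lemma star_upowC j k : cstar (U j) ** U k = U k ** cstar (U j).
Proof.
have -> : U k ** cstar (U j) = cstar (U j) ** (U j ** U k) ** cstar (U j).
  by rewrite cmulA upow_isom cmul_e_upow.
by rewrite upowC -!cmulA upow_coisom cmul_upow_e.
Qed.

Lemma star_upow_e k : cstar (U k) ** e = cstar (U k).
Proof. by rewrite -{2}(cmul_e_upow k) cstarM es. Qed.

Lemma cmul_e_star_upow k : e ** cstar (U k) = cstar (U k).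
Proof. by rewrite -{2}(cmul_upow_e k) cstarM es. Qed.

Lemma nm_upow_le1 k : nm (U k) <= 1.
Proof. exact: nm_isom es ee (upow_isom k). Qed.

Lemma peval_wide q n : (size q <= n)%N -> P q = \sum_(i < n) q`_i *: U i.
Proof.
move=> qn; rewrite /peval (big_ord_widen _ (fun i => q`_i *: U i) qn).
rewrite big_mkcond /=; apply: eq_bigr => i _; case: ltnP => // qi.
by rewrite nth_default// scale0r.
Qed.

Lemma pevalL a q r : P (a *: q + r) = a *: P q + P r.
Proof.
pose n := maxn (size q) (size r).
rewrite !(@peval_wide _ n) ?leq_maxl ?leq_maxr//; last first.
  by rewrite (leq_trans (size_polyD _ _))// geq_max !leq_max size_scale_leq leqnn orbT.
rewrite scaler_sumr -big_split; apply: eq_bigr => i _ /=.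
by rewrite coefD coefZ scalerDl scalerA.
Qed.

Lemma peval0 : P 0 = 0.
Proof. by rewrite /peval size_poly0 big_ord0. Qed.

Lemma pevalD q r : P (q + r) = P q + P r.
Proof. by have := pevalL 1 q r; rewrite !scale1r. Qed.

Lemma pevalZ a q : P (a *: q) = a *: P q.
Proof. by have := pevalL a q 0; rewrite peval0 !addr0. Qed.

Lemma pevalC (c : C) : P c%:P = c *: e.
Proof. by rewrite (@peval_wide _ 1) ?size_polyC_leq1// big_ord1 coefC. Qed.

Lemma pevalMX q : P (q * 'X) = u ** P q.
Proof.
have sz : (size (q * 'X)%R <= (size q).+1)%N.
  by rewrite (leq_trans (size_polyMleq _ _))// size_polyX addn2.
rewrite (peval_wide sz) big_ord_recl coefMX eqxx scale0r add0r cmul_sumr.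
by apply: eq_bigr => i _; rewrite coefMX /= cmulZr.
Qed.

Lemma pevalXn k : P 'X^k = U k.
Proof.
elim: k => [|k IH]; first by rewrite expr0 pevalC scale1r.
by rewrite exprSr pevalMX IH.
Qed.

Lemma cmul_e_peval q : e ** P q = P q.
Proof. by rewrite cmul_sumr; apply: eq_bigr => i _; rewrite cmulZr cmul_e_upow. Qed.

Lemma upow_pevalC k q : U k ** P q = P q ** U k.
Proof.
rewrite cmul_sumr cmul_suml; apply: eq_bigr => i _.
by rewrite cmulZr cmulZl upowC.
Qed.

Lemma cmul_peval_e q : P q ** e = P q.
Proof. by rewrite -(upow_pevalC 0) cmul_e_peval. Qed.

Lemma cmul_e_star_peval q : e ** cstar (P q) = cstar (P q).
Proof. by rewrite -{2}(cmul_peval_e q) cstarM es. Qed.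

Lemma star_upow_pevalC k q : cstar (U k) ** P q = P q ** cstar (U k).
Proof.
rewrite cmul_sumr cmul_suml; apply: eq_bigr => i _.
by rewrite cmulZr cmulZl star_upowC.
Qed.

Lemma pevalM q r : P (q * r) = P q ** P r.
Proof.
elim/poly_ind: q => [|q c IH]; first by rewrite mul0r peval0 cmul0x.
rewrite mulrDl pevalD mul_polyC pevalZ mulrAC pevalMX IH pevalD pevalMX pevalC.
by rewrite cmulDl cmulZl cmul_e_peval cmulA.
Qed.

Lemma nm_upowM k x : e ** x = x -> nm (U k ** x) = nm x.
Proof.
move=> ex; apply/eqP; rewrite -(@eqrXn2 _ 2) ?nm_ge0// -!nm_starM.
by rewrite cstarM -cmulA (cmulA (cstar (U k))) upow_isom ex.
Qed.

Lemma nm_star_upowM k x : e ** x = x -> nm (cstar (U k) ** x) = nm x.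
Proof.
move=> ex; rewrite -(@nm_upowM k) ?cmulA ?upow_coisom ?ex//.
by rewrite cmul_e_star_upow.
Qed.

(** The polynomial which, on unitaries, is the adjoint of [q] multiplied by the
    power needed to clear negative exponents. *)
Definition conj_rev q : {poly C} := \poly_(i < size q) (q`_((size q).-1 - i))^*.

Lemma peval_conj_rev q : P (conj_rev q) = U (size q).-1 ** cstar (P q).
Proof.
rewrite (@peval_wide _ (size q)) ?size_poly// star_sum cmul_sumr.
rewrite (reindex_inj rev_ord_inj); apply: eq_bigr => -[i iq] _ /=.
have rev_arith n j : (j < n)%N -> (n - j.+1 < n)%N /\ (n.-1 - (n - j.+1))%N = j /\
    n.-1 = (n - j.+1 + j)%N by lia.
have [lt_i [rev_i def_i]] := rev_arith _ _ iq.
rewrite /conj_rev coef_poly lt_i rev_i.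
rewrite cstarZ cmulZr; congr (_ *: _).
by rewrite def_i upowD -cmulA upow_coisom cmul_upow_e.
Qed.

Lemma nm_peval_sqr q : nm (P q) ^+ 2 = nm (P (conj_rev q * q)).
Proof.
rewrite pevalM peval_conj_rev -cmulA nm_upowM ?nm_starM//.
by rewrite cmulA cmul_e_star_peval.
Qed.

Definition laurent d q : A := cstar (U d) ** P q.

Lemma e_laurent d q : e ** laurent d q = laurent d q.
Proof. by rewrite /laurent cmulA cmul_e_star_upow. Qed.

Lemma laurentM d q d' q' : laurent d q ** laurent d' q' = laurent (d + d') (q * q').
Proof.
rewrite /laurent -cmulA (cmulA (P q)) -star_upow_pevalC -!cmulA -pevalM cmulA -cstarM.
by rewrite -upowD addnC.
Qed.

Lemma laurent_shift k d q : laurent (d + k) ('X^k * q) = laurent d q.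
Proof.
by rewrite /laurent addnC upowD cstarM pevalM pevalXn -cmulA (cmulA _ (U k)) upow_isom cmul_e_peval.
Qed.

Lemma laurentL a d q d' q' : a *: laurent d q + laurent d' q' =
  laurent (d + d') (a *: ('X^d' * q) + 'X^d * q').
Proof.
rewrite -(laurent_shift d' d q) -(laurent_shift d d' q') (addnC d' d).
by rewrite /laurent pevalL cmulDr cmulZr.
Qed.

Lemma laurent_star d q : cstar (laurent d q) = laurent (size q).-1 ('X^d * conj_rev q).
Proof.
rewrite /laurent cstarM cstarK pevalM pevalXn peval_conj_rev.
rewrite (cmulA (U d)) upowC cmulA (cmulA _ (U _)) upow_isom cmul_e_upow.
by apply: star_inj; rewrite !cstarM cstarK star_upow_pevalC.
Qed.

End laurent.

Section compare.
Variables (R : realType) (A B : cstarType R) (e u : A) (f v : B).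
Hypotheses (cu : corner_unitary e u) (cv : circular f v).
Let cv' := circ_unitary cv.

(** By the C*-identity the squared norm of a polynomial is the norm of another
    polynomial of twice the length, for which the trivial estimate loses the
    same factor. *)
Lemma nm_peval_le q : nm (peval e u q) <= nm (peval f v q).
Proof.
apply: (@le_of_powers _ _ _ (size q)); rewrite ?nm_ge0// => k.
suff : forall n (q : {poly R[i]}), (size q <= n)%N -> nm (peval e u q) ^+ (2 ^ k)%N <=
    (2 ^ k * n)%:R * nm (peval f v q) ^+ (2 ^ k)%N by apply.
elim: k {q} => [|k IH] n q qn.
  rewrite expn0 mul1n !expr1 (peval_wide _ _ qn) (le_trans (nm_sum _ _ _))//.
  rewrite -[X in X%:R * _]card_ord -sumr_const mulr_suml; apply: ler_sum => i _.
  rewrite nmZ mul1r (le_trans _ (circ_coef cv q i))// ler_piMr ?cabs_ge0//.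
  exact: nm_upow_le1 cu _.
rewrite expnS !exprM !nm_peval_sqr// (mulnC 2) -mulnA; apply: IH.
rewrite (leq_trans (size_polyMleq _ _))// mul2n -addnn.
by rewrite (leq_trans (leq_pred _))// leq_add// (leq_trans (size_poly _ _)).
Qed.

End compare.

Section circular_iso.
Variables (R : realType) (A B : cstarType R) (e u : A) (f v : B).
Hypotheses (cu : circular e u) (cv : circular f v).
Let cu' := circ_unitary cu.
Let cv' := circ_unitary cv.

Lemma nm_laurent_eq d q : nm (laurent e u d q) = nm (laurent f v d q).
Proof.
rewrite (nm_star_upowM cu') ?cmul_e_peval// (nm_star_upowM cv') ?cmul_e_peval//.
by apply/eqP; rewrite eq_le !nm_peval_le.
Qed.

Definition laurent_pair (xy : (A * B)%type) : Prop :=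
  exists d q, xy = (laurent e u d q, laurent f v d q).

Lemma laurent_pair_subalgebra : star_subalgebra (laurent_pair : set (A * B)%type).
Proof.
split.
- by exists 0%N, 0; rewrite /laurent !peval0 !cmulx0.
- move=> a _ _ [d [q ->]] [d' [q' ->]].
  exists (d + d')%N, (a *: ('X^d' * q) + 'X^d * q'); rewrite -!laurentL//.
- move=> _ _ [d [q ->]] [d' [q' ->]]; exists (d + d')%N, (q * q').
  by rewrite prod_cmulE /= !laurentM.
- move=> _ [d [q ->]]; exists (size q).-1, ('X^d * conj_rev q).
  by rewrite prod_cstarE /= !laurent_star.
Qed.

Lemma nm_pair (x : A) (y : B) : nm ((x, y) : (A * B)%type) = Num.max (nm x) (nm y).
Proof.
rewrite /nm prod_cnormE /= /Order.max.
by rewrite [X in X < _](nmE x) [X in _ < X](nmE y) ltcR; case: ifP.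
Qed.

(** The closure, inside the direct sum of the two algebras, of the graph of the
    correspondence between Laurent polynomials in [u] and in [v]. A closure of a
    *-subalgebra is a *-subalgebra, which gives all algebraic properties of the
    correspondence at once. *)
Definition laurent_corr (x : A) (y : B) : Prop := approx laurent_pair (x, y).

Lemma laurent_corr_subalgebra : star_subalgebra (approx laurent_pair : set (A * B)%type).
Proof. exact/approx_star_subalgebra/laurent_pair_subalgebra. Qed.

Lemma laurent_corrP x y c : 0 < c -> laurent_corr x y ->
  exists d q, nm (x - laurent e u d q) <= c /\ nm (y - laurent f v d q) <= c.
Proof.
move=> c0 /(_ c c0)[_ [d [q ->]]]; rewrite nm_pair ge_max => /andP[? ?].
by exists d, q.
Qed.

Lemma laurent_corr_nm x y : laurent_corr x y -> nm x = nm y.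
Proof.
move=> xy; apply/eqP; rewrite -subr_eq0 -normr_le0.
apply/ler_addgt0Pr => c c0; rewrite add0r.
have [|d [q [xd yd]]] := laurent_corrP (c := c / 2) _ xy; first by rewrite divr_gt0.
have H (V : normedModType R[i]) (a b : V) : nm a <= nm b + nm (a - b).
  by rewrite -{1}(subrK b a) addrC nmD.
have := H _ x (laurent e u d q); have := H _ (laurent e u d q) x.
have := H _ y (laurent f v d q); have := H _ (laurent f v d q) y.
rewrite !(nmB (laurent _ _ _ _)) nm_laurent_eq ler_norml; lra.
Qed.

Lemma laurent_corr_fun x y y' : laurent_corr x y -> laurent_corr x y' -> y = y'.
Proof.
move=> xy xy'; have [_ cD _ _] := laurent_corr_subalgebra.
have := cD (-1) _ _ xy xy'; rewrite scaleN1r => /laurent_corr_nm /=.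
rewrite [X in nm X](addNr x) nm0 => /esym/eqP.
by rewrite nm_eq0 addrC subr_eq0 => /eqP.
Qed.

Lemma laurent_corr_inj x x' y : laurent_corr x y -> laurent_corr x' y -> x = x'.
Proof.
move=> xy xy'; have [_ cD _ _] := laurent_corr_subalgebra.
have := cD (-1) _ _ xy xy'; rewrite scaleN1r => /laurent_corr_nm /=.
rewrite [X in _ = nm X](addNr y) nm0 => /eqP.
by rewrite nm_eq0 addrC subr_eq0 => /eqP.
Qed.

Definition laurent_like (e u : A) x : Prop := exists d q, x = laurent e u d q.

End circular_iso.

Section circular_iso2.
Variables (R : realType) (A B : cstarType R) (e u : A) (f v : B).
Hypotheses (cu : circular e u) (cv : circular f v).
Let cu' := circ_unitary cu.
Let cv' := circ_unitary cv.

Lemma laurent_corr_sym x y : laurent_corr e u f v x y -> laurent_corr f v e u y x.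
Proof.
move=> H c c0; have [_ [d [q ->]]] := H c c0; rewrite nm_pair => xy.
exists (laurent f v d q, laurent e u d q); first by exists d, q.
by rewrite nm_pair maxC.
Qed.

(** A sequence of Laurent polynomials in [u] converging to [x] is Cauchy, hence so
    is the corresponding sequence in [v]. *)
Lemma laurent_corr_total x : approx (laurent_like e u) x -> exists y, laurent_corr e u f v x y.
Proof.
move=> xu; have /choice[dq dqP] : forall n : nat, exists dq : nat * {poly R[i]},
    nm (x - laurent e u dq.1 dq.2) <= n.+1%:R^-1.
  move=> n; have [|_ [d [q ->]] ?] := xu n.+1%:R^-1; first by rewrite invr_gt0.
  by exists (d, q).
have small c : 0 < c -> exists N, forall n, (N <= n)%N ->
    nm (x - laurent e u (dq n).1 (dq n).2) <= c.
  move=> /invn_small[N HN]; exists N => n Nn; exact: le_trans (dqP n) (HN n Nn).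
have [y yl] : exists y, tends (fun n => laurent f v (dq n).1 (dq n).2) y.
  apply: complete_tends => c c0; have [|N HN] := small (c / 2); first by rewrite divr_gt0.
  exists N => m n Nm Nn.
  have := laurentL cv' (-1) (dq n).1 (dq n).2 (dq m).1 (dq m).2.
  rewrite scaleN1r addrC => ->; rewrite -(nm_laurent_eq cu cv) -laurentL// scaleN1r addrC.
  by rewrite (le_trans (nm_via x _ _))// (splitr c) lerD ?HN// nmB HN.
exists y => c c0; have [N HN] := small c c0; have [M HM] := yl c c0.
pose n := maxn N M; exists (laurent e u (dq n).1 (dq n).2, laurent f v (dq n).1 (dq n).2).
  by exists (dq n).1, (dq n).2.
by rewrite nm_pair ge_max HN ?leq_maxl// nmB HM// leq_maxr.
Qed.

Lemma laurent_corr_range x y : laurent_corr e u f v x y -> approx (laurent_like f v) y.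
Proof.
move=> xy c c0; have [d [q [_ yd]]] := laurent_corrP c0 xy.
by exists (laurent f v d q) => //; exists d, q.
Qed.

End circular_iso2.

(** The correspondence of Laurent polynomials is isometric, as polynomials in two
    circular elements have the same norm; it extends to the closures. *)
Lemma circular_iso (R : realType) (A B : cstarType R) (e u : A) (f v : B) :
  circular e u -> circular f v -> (forall x, approx (laurent_like e u) x) ->
  exists psi : A -> B, [/\ star_hom psi, injective psi,
    forall x, approx (laurent_like f v) (psi x) &
    forall y, approx (laurent_like f v) y -> exists x, psi x = y].
Proof.
move=> cu cv full.
have /choice[psi psiP] : forall x, exists y, laurent_corr e u f v x y.
  by move=> x; apply: laurent_corr_total.
have [_ cD cM cS] := laurent_corr_subalgebra cu cv.
exists psi; split.
- split=> [a x y|x y|x]; apply: (laurent_corr_fun cu cv (psiP _)).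
  + exact: cD (psiP x) (psiP y).
  + exact: cM (psiP x) (psiP y).
  + exact: cS (psiP x).
- by move=> x x' xx; apply: (laurent_corr_inj cu cv (psiP x)); rewrite xx.
- by move=> x; apply: laurent_corr_range (psiP x).
- move=> y yv; have [x yx] := laurent_corr_total cv cu yv; exists x.
  by apply: (laurent_corr_fun cu cv (psiP x)); apply: laurent_corr_sym.
Qed.

(** * Continuous functions on the circle *)

Section circle_functions.
Variable R : realType.
Local Notation C := R[i].
Local Notation T := (set_type (@circle R)).
Implicit Types (z t : T) (g : circle_cfun R).

Definition cval (z : T) : C := set_val z.

Lemma cabs_cval z : cabs (cval z) = 1.
Proof.
have := set_valP z; rewrite /circle /= => z1; apply: complexI.
by rewrite -cabsE; exact: z1.
Qed.

Lemma cpoint_subproof (a : C) : cabs a = 1 -> @circle R (a : cplx R).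
Proof. by move=> a1; rewrite /circle /= -[LHS]/(`|a : C|) cabsE a1. Qed.

Definition cpoint (a : C) (a1 : cabs a = 1) : T :=
  exist _ (a : cplx R) (mem_set (cpoint_subproof a1)).

Lemma cval_point a (a1 : cabs a = 1) : cval (cpoint a1) = a.
Proof. by rewrite /cval set_valE; exact: erefl. Qed.

Lemma cval_continuous : continuous (cval : T -> cplx R).
Proof. exact: (@initial_continuous T (cplx R) set_val). Qed.

Lemma cfun_near g t (e : R) : 0 < e -> exists2 d : R, 0 < d &
  forall z, cabs (cval z - cval t) < d -> cabs (g z - g t) <= e.
Proof.
move=> e0; have e0' : 0 < e%:C%C by rewrite ltcR.
have /cvgrPdist_le/(_ _ e0') := circle_cfun_continuous (f := g) (x := t).
move=> [_ [[W oW <-] Wt] Wg].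
have : nbhs (cval t : cplx R) W by exact: open_nbhs_nbhs.
move=> /nbhs_ballP[d d0 dW].
have dE := ge0C_ReE (ltW d0).
exists (complex.Re d); first by rewrite -ltcR -dE.
move=> z zt; have := Wg z; rewrite /= distrC -lecR -cabsE; apply.
apply: dW; rewrite -ball_normE /= dE -[ltLHS]/(`|cval t - cval z : C|) cabsE ltcR.
by rewrite -cabsN opprB.
Qed.

Lemma circle_compact : compact (@circle R).
Proof.
pose sq : set (R * R) := `[-1, 1] `*` `[-1, 1].
pose h (x : R * R) : cplx R := Complex x.1 x.2.
have hc : continuous h.
  move=> x; apply/cvgrPdist_le => e e0.
  have eE := ge0C_ReE (ltW e0).
  have e2 : 0 < complex.Re e / 2 by rewrite divr_gt0// -ltcR -eE.
  have /cvgrPdist_le/(_ _ e2) x1 : fst @ x --> x.1 by exact: cvg_fst.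
  have /cvgrPdist_le/(_ _ e2) x2 : snd @ x --> x.2 by exact: cvg_snd.
  apply: filterS2 x1 x2 => y x1 x2.
  change (is_true (`|Complex (x.1 - y.1) (x.2 - y.2) : C| <= e)).
  rewrite (complexE (Complex _ _)).
  rewrite (le_trans (ler_normD _ _))// eE; move: (complex.Re e) x1 x2 => r x1 x2.
  have -> : r%:C%C = (r / 2)%:C%C + (r / 2)%:C%C by rewrite -rmorphD -splitr.
  apply: lerD => /=; first by rewrite cabsE cabsR lecR.
  by rewrite normrM cabsE cabsE cabsR /cabs normc_def /= expr0n expr1n add0r sqrtr1 mul1r lecR.
apply: (@subclosed_compact _ _ (h @` sq)).
- rewrite (_ : @circle R = (fun z : cplx R => complex.Re `|z|) @^-1` [set 1]); last first.
    apply/seteqP; split => z /=.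
    move=> z1; have /(congr1 (@complex.Re R)) : `|z : C| = 1 by exact: z1.
    exact.
    by move=> z1; change (`|z : C| = 1); rewrite cabsE; congr (_%:C%C); exact: z1.
  apply: closed_comp => [z _|]; first exact: Renorm_continuous.
  exact: closed_eq.
- apply: continuous_compact; first exact: continuous_subspaceT.
  by apply: compact_setX; exact: segment_compact.
- move=> z z1; have {}z1 : complex.Re (z : C) ^+ 2 + complex.Im (z : C) ^+ 2 = 1.
    by apply: complexI; rewrite add_Re2_Im2 -[`|_|]/(`|z|) z1 expr1n.
  exists (complex.Re (z : C), complex.Im (z : C)); last by case: (z : C).
  have := sqr_ge0 (complex.Re (z : C)); have := sqr_ge0 (complex.Im (z : C)) => p1 p2.
  by split; rewrite /= in_itv /= -ler_norml -(@ler_pXn2r _ 2) ?nnegrE// expr1n real_normK ?num_real//; lra.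
Qed.

Lemma cfun_uniform g (e : R) : 0 < e -> exists2 d : R, 0 < d &
  forall z t, cabs (cval z - cval t) < d -> cabs (g z - g t) <= e.
Proof.
move=> e0; have e2 : 0 < e / 2 by rewrite divr_gt0.
have /compact_near_coveringP/(_ nat \oo (fun n x => forall z t, cval z = x ->
    cabs (cval z - cval t) < n.+1%:R^-1 -> cabs (g z - g t) <= e) _) := circle_compact.
case=> [x cx|N _ /(_ N (leqnn N)) HN]; last first.
  by exists N.+1%:R^-1; [rewrite invr_gt0|move=> z t; apply: HN => //; exact: set_valP].
pose t0 : T := exist _ x (mem_set cx).
have [d d0 dg] := cfun_near g t0 e2.
have d2 : 0 < d / 2 by rewrite divr_gt0.
have [N HN] := invn_small d2.
exists (ball x (d / 2)%:C%C, [set n | (N <= n)%N]).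
  by split; [apply: nbhsx_ballx; rewrite ltcR|exists N].
move=> [y n] [/= xy Nn] z t zy zt; move: xy; rewrite -zy -ball_normE /=.
rewrite -[ltLHS]/(`|x - cval z : C|) cabsE ltcR -cabsN opprB => zx.
have {}zt := lt_le_trans zt (HN n Nn).
have tz : cabs (cval t - cval t0) < d.
  rewrite -[_ - _](subrKA (cval z)) (le_lt_trans (cabsD _ _))// (splitr d) ltrD//.
  by rewrite -cabsN opprB.
have zt0 : cabs (cval z - cval t0) < d by rewrite (lt_le_trans zx)//; lra.
rewrite -[_ - _](subrKA (g t0)) (le_trans (cabsD _ _))// (splitr e) lerD ?dg//.
by rewrite -cabsN opprB dg.
Qed.

Lemma cfun_bounded g : exists2 M : R, 0 <= M & forall z, cabs (g z) <= M.
Proof.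
have /compact_near_coveringP/(_ nat \oo (fun n x => forall z, cval z = x ->
    cabs (g z) <= n%:R) _) := circle_compact.
case=> [x cx|N _ /(_ N (leqnn N)) HN]; last first.
  by exists N%:R => // z; apply: HN => //; exact: set_valP.
pose t0 : T := exist _ x (mem_set cx).
have [d d0 dg] := cfun_near g t0 ltr01.
pose N := (Num.trunc (cabs (g t0) + 1)).+1.
exists (ball x d%:C%C, [set n | (N <= n)%N]).
  by split; [apply: nbhsx_ballx; rewrite ltcR|exists N].
move=> [y n] [/= xy Nn] z zy; move: xy; rewrite -zy -ball_normE /=.
rewrite -[ltLHS]/(`|x - cval z : C|) cabsE ltcR -cabsN opprB => /dg zx.
have : cabs (g z) <= cabs (g t0) + 1.
  by rewrite -{1}(subrK (g t0) (g z)) addrC (le_trans (cabsD _ _))// lerD2l.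
by move=> /le_trans; apply; rewrite ltW// (lt_le_trans (truncnS_gt _))// ler_nat.
Qed.

Lemma cfun_le g z : cabs (g z) <= nm g.
Proof.
have [M M0 gM] := cfun_bounded g.
rewrite -lecR -cabsE -nmE circle_cfun_normE.
have sE : supnorm g = (nm g)%:C%C by rewrite -nmE circle_cfun_normE.
have /supnormP/(_ (nm_ge0 g))[+ _] : exists M : R, forall z, `|g z| <= M%:C%C.
  by exists M => t; rewrite -[leLHS]/(`|g t : C|) cabsE lecR.
by rewrite -sE lexx => /(_ isT z).
Qed.

Lemma cfun_nm_le g (c : R) : 0 <= c -> (forall z, cabs (g z) <= c) -> nm g <= c.
Proof.
move=> c0 gc; rewrite -lecR -nmE circle_cfun_normE; apply/supnormP => //.
  by exists c => t; rewrite -[leLHS]/(`|g t : C|) cabsE lecR.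
by move=> t; rewrite -[leLHS]/(`|g t : C|) cabsE lecR.
Qed.

Lemma circle_one_cts : (fun=> 1 : cplx R) \in @cts_circle R.
Proof. by apply/cts_circleP => z; exact: (@cst_continuous T (cplx R)). Qed.

Lemma circle_id_cts : (cval : T -> cplx R) \in @cts_circle R.
Proof. exact/cts_circleP/cval_continuous. Qed.

Definition circle_one : circle_cfun R := CircleCfun circle_one_cts.
Definition circle_id : circle_cfun R := CircleCfun circle_id_cts.

Lemma cfun_ext g (g' : circle_cfun R) : (forall z, g z = g' z) -> g = g'.
Proof. by move=> gg; apply/val_inj/funext. Qed.

Lemma cfun_scale (a : C) g z : (a *: g) z = a * g z.
Proof. by []. Qed.

Lemma cfun_mul (f g : circle_cfun R) z : (f ** g) z = (f z : C) * (g z : C).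
Proof. by []. Qed.

Lemma cfun_star g z : cstar g z = (g z : C)^*.
Proof. by []. Qed.

Lemma cfun_sum I (r : seq I) (P : pred I) (F : I -> circle_cfun R) z :
  (\sum_(i <- r | P i) F i) z = \sum_(i <- r | P i) F i z.
Proof. by elim/big_rec2: _ => [//|i f g _ <-]. Qed.

Lemma upow_val k z : upow circle_one circle_id k z = cval z ^+ k.
Proof.
elim: k => [//|k IH]; rewrite -[LHS]/((circle_id ** upow circle_one circle_id k) z).
by rewrite cfun_mul IH exprS.
Qed.

Lemma peval_val q z : peval circle_one circle_id q z = q.[cval z].
Proof.
rewrite /peval cfun_sum horner_coef; apply: eq_bigr => i _.
by rewrite cfun_scale upow_val.
Qed.

(** Averaging over a group of roots of unity larger than the degree. *)
Lemma circle_coef (q : {poly C}) i : cabs q`_i <= nm (peval circle_one circle_id q).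
Proof.
have [iq|qi] := ltnP i (size q); last by rewrite nth_default// cabs0 nm_ge0.
have arith m a b : (a < m)%N -> (b < m)%N -> (`|(- a%:Z + b%:Z)%R| <= m)%N by lia.
pose M := size q.
have -> : q`_i = M.+1%:R^-1 * \sum_(j < M.+1) (omega R M ^+ j) ^ (- i%:Z) * q.[omega R M ^+ j].
  under eq_bigr => j _.
    rewrite horner_coef mulr_sumr.
    under eq_bigr => k _.
      rewrite mulrCA (exprnP (omega R M ^+ j)) -expfzDr; last by rewrite cabs1_neq0// cabs_omega.
    over.
  over.
  rewrite exchange_big /= (bigD1 (Ordinal iq))//= -mulr_sumr sum_omega; last by rewrite addNr.
  rewrite addNr eqxx big1 ?addr0; first by rewrite mulrC mulfK// pnatr_eq0.
  move=> k ki; rewrite -mulr_sumr sum_omega; last exact: arith.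
  case: eqP => [ik|_]; last by rewrite mulr0.
  by case/eqP: ki; apply: val_inj => /=; lia.
rewrite cabsM cabsV cabs_nat ler_pdivrMl// (le_trans (cabs_sum _ _ _))//.
rewrite -[X in X%:R * _]card_ord -sumr_const mulr_suml; apply: ler_sum => j _.
rewrite cabsM cabs1_exprz ?cabs_omega// !mul1r.
by rewrite -[X in q.[X]](cval_point (cabs_omega R M j)) -peval_val cfun_le.
Qed.

Lemma circle_circular : circular circle_one circle_id.
Proof.
split=> [|q i]; last exact: circle_coef.
split.
- by apply: cfun_ext => z; rewrite cfun_star /= conjC1.
- by apply: cfun_ext => z; rewrite cfun_mul /= mulr1.
- by apply: cfun_ext => z; rewrite cfun_mul /= mul1r.
- apply: cfun_ext => z; rewrite cfun_mul cfun_star /=.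
  by rewrite mulJ cabs_cval expr1n.
- apply: cfun_ext => z; rewrite cfun_mul cfun_star /=.
  by rewrite mulrC mulJ cabs_cval expr1n.
Qed.

(** Interpolation at the roots of unity by translates of the Fejer kernel: the
    weights [w j] are nonnegative, have sum one, and are small away from [t]. *)
Lemma circle_dense g : approx (laurent_like circle_one circle_id) g.
Proof.
move=> e e0; have e2 : 0 < e / 2 by rewrite divr_gt0.
have [d d0 dg] := cfun_uniform g e2; have [B B0 Bg] := cfun_bounded g.
(* An interpolation point at distance at least [d] from [t] has weight at most
   [4 / (d M.+1)^2] and contributes at most [2 B] times its weight. *)
pose K := B * 8 / d ^+ 2 + 1.
have K1 : 0 <= B * 8 / d ^+ 2 by rewrite divr_ge0 ?sqr_ge0// mulr_ge0.
have K0 : 0 < K by rewrite ltr_wpDl.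
have [|M /(_ M (leqnn M)) MK] := @invn_small _ (e / 2 / K); first by rewrite !divr_gt0.
pose om (j : 'I_M.+1) : C := omega R M ^+ j.
have om1 j : cabs (om j) = 1 by exact: cabs_omega.
pose pt j : T := cpoint (om1 j).
pose N : C := M.+1%:R; have N0 : N != 0 by rewrite pnatr_eq0.
pose c (k l : 'I_M.+1) : C := N ^- 2 * \sum_j g (pt j) * ((om j)^* ^+ k * om j ^+ l).
pose q : {poly C} := \sum_k \sum_l c k l *: 'X^(k + (M - l)).
exists (laurent circle_one circle_id M q); first by exists M, q.
apply: cfun_nm_le => [|z]; first exact: ltW.
pose t := cval z; have t1 : cabs t = 1 := cabs_cval z.
pose D j : C := \sum_(k < M.+1) ((om j)^* * t) ^+ k.
pose w j : C := N ^- 2 * `|D j| ^+ 2.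
have wE j : w j = \sum_(k < M.+1) \sum_(l < M.+1)
    N ^- 2 * (((om j)^* ^+ k * om j ^+ l) * (t ^+ k * t^* ^+ l)).
  rewrite /w normCK rmorph_sum big_distrl mulr_sumr /=; apply: eq_bigr => k _.
  rewrite !mulr_sumr; apply: eq_bigr => l _; congr (_ * _).
  have -> : (((om j)^* * t) ^+ l)^* = (om j * t^*) ^+ l.
    by rewrite -[om j in RHS]conjCK -rmorphM -rmorphXn.
  by rewrite !exprMn mulrACA.
have qt : laurent circle_one circle_id M q z = \sum_j g (pt j) * w j.
  rewrite cfun_mul cfun_star upow_val peval_val -/t horner_sum mulr_sumr.
  under [RHS]eq_bigr do rewrite wE mulr_sumr.
  rewrite [RHS]exchange_big /=; apply: eq_bigr => k _.
  rewrite horner_sum mulr_sumr; under [RHS]eq_bigr do rewrite mulr_sumr.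
  rewrite [RHS]exchange_big /=; apply: eq_bigr => l _.
  rewrite hornerZ hornerXn.
  have -> : (t ^+ M)^* * (c k l * t ^+ (k + (M - l))) = c k l * (t ^+ k * t^* ^+ l).
    rewrite mulrCA; congr (_ * _); rewrite rmorphXn /= exprD mulrCA; congr (_ * _).
    have lM : (l <= M)%N by rewrite -ltnS.
    by rewrite -{1}(subnKC lM) exprD -mulrA -exprMn mulJ t1 expr1n expr1n mulr1.
  rewrite /c -mulrA mulr_suml mulr_sumr; apply: eq_bigr => j _.
  by rewrite -(mulrA (g _)) mulrCA.
have w_sum : \sum_j w j = 1.
  under eq_bigr do rewrite wE.
  rewrite exchange_big /=.
  have inner (k l : 'I_M.+1) : \sum_j (om j)^* ^+ k * om j ^+ l = if l == k then N else 0.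
    under eq_bigr => j _.
      rewrite cabs1_conj// exprVn exprnN (exprnP (om j) l) -expfzDr; last by rewrite cabs1_neq0.
    over.
    rewrite sum_omega; last by have := ltn_ord k; have := ltn_ord l; lia.
    by congr (if _ then _ else _); apply/eqP/eqP => [|->]; [move=> h; apply: val_inj => /=; lia|rewrite addNr].
  transitivity (\sum_(k < M.+1) N^-1); last by rewrite sumr_const card_ord -(mulr_natl _ M.+1) divff.
  apply: eq_bigr => k _; rewrite exchange_big (bigD1 k)//= [X in _ + X]big1 ?addr0; last first.
    move=> l lk; rewrite -mulr_sumr -mulr_suml inner (negPf lk) mul0r mulr0 //.
  rewrite -mulr_sumr -mulr_suml inner eqxx -exprMn [t * _]mulrC mulJ t1 expr1n expr1n mulr1.
  by rewrite expr2 invfM mulfVK.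
have w0 j : 0 <= w j by rewrite mulr_ge0 ?invr_ge0 ?exprn_ge0.
have w_sumR : \sum_j cabs (w j) = 1.
  apply: complexI; rewrite rmorph_sum rmorph1 -w_sum; apply: eq_bigr => j _.
  by rewrite -[LHS]/((cabs (w j))%:C%C) -cabsE ger0_norm.
have -> : (g - laurent circle_one circle_id M q) z = \sum_j w j * (g z - g (pt j)).
  rewrite -[LHS]/(g z - laurent circle_one circle_id M q z) qt -[X in X - _](mul1r (g z : C)) -w_sum.
  by rewrite mulr_suml -sumrB; apply: eq_bigr => j _; rewrite mulrBr (mulrC (g _)).
have term j : cabs (w j * (g z - g (pt j))) <= cabs (w j) * (e / 2) + B * 8 / d ^+ 2 / M.+1%:R ^+ 2.
  rewrite cabsM; have [near|far] := ltP (cabs (t - om j)) d.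
    rewrite (le_trans (ler_wpM2l (cabs_ge0 _) (dg z (pt j) near)))// lerDl.
    by rewrite divr_ge0 ?exprn_ge0.
  apply: ler_wpDl; first by rewrite mulr_ge0 ?cabs_ge0// ltW.
  have DB : cabs (D j) * d <= 2.
    have := subrX1 ((om j)^* * t) M.+1; rewrite -/(D j) => /(congr1 (@cabs R)); rewrite cabsM => Dj.
    have : cabs (D j) * d <= cabs ((om j)^* * t - 1) * cabs (D j).
      rewrite mulrC ler_wpM2r ?cabs_ge0// (le_trans far)//.
      have -> : (om j)^* * t - 1 = (om j)^* * (t - om j) by rewrite mulrBr mulJ om1 expr1n.
      by rewrite cabsM cabs_conj om1 mul1r.
    rewrite -Dj => /le_trans; apply; rewrite (le_trans (cabsD _ _))// cabsN cabs1.
    by rewrite cabsX cabsM cabs_conj om1 t1 mulr1 expr1n.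
  have wj : cabs (w j) * d ^+ 2 * M.+1%:R ^+ 2 <= 4.
    rewrite cabsM cabsV cabsX cabs_nat cabsX cabsE cabsR ger0_norm ?cabs_ge0//.
    have cancel (m a : R) : m != 0 -> m ^- 2 * a * d ^+ 2 * m ^+ 2 = a * d ^+ 2.
      by move=> m0; field.
    rewrite cancel ?pnatr_eq0//.
    rewrite -exprMn; have : 0 <= cabs (D j) * d by rewrite mulr_ge0 ?cabs_ge0// ltW.
    by move: (_ * d) DB => r; nra.
  have gg : cabs (g z - g (pt j)) <= 2 * B.
    by rewrite (le_trans (cabsD _ _))// cabsN mulr2n mulrDl mul1r lerD.
  rewrite ler_pdivlMr ?exprn_gt0// ler_pdivlMr ?exprn_gt0//.
  have -> : cabs (w j) * cabs (g z - g (pt j)) * M.+1%:R ^+ 2 * d ^+ 2 =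
    cabs (w j) * d ^+ 2 * M.+1%:R ^+ 2 * cabs (g z - g (pt j)) by ring.
  have -> : B * 8 = 4 * (2 * B) by ring.
  by rewrite ler_pM ?cabs_ge0// mulr_ge0 ?sqr_ge0// mulr_ge0 ?sqr_ge0 ?cabs_ge0.
rewrite (le_trans (cabs_sum _ _ _))// (le_trans (ler_sum _ (fun j _ => term j)))//.
rewrite big_split /= -mulr_suml w_sumR mul1r sumr_const card_ord [leRHS]splitr lerD2l.
rewrite -[_ *+ _]mulr_natr; have m0 : M.+1%:R != 0 :> R by rewrite pnatr_eq0.
have -> : B * 8 / d ^+ 2 / M.+1%:R ^+ 2 * M.+1%:R = B * 8 / d ^+ 2 * M.+1%:R^-1.
  by rewrite -mulrA; congr (_ * _); rewrite expr2 invfM mulfVK.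
move: MK; rewrite ler_pdivlMr// /K; apply: le_trans.
by rewrite mulrC ler_wpM2l ?invr_ge0// lerDl.
Qed.

End circle_functions.

(** * The center under a minimal projection *)

Section homogeneous_corner.
Variables (R : realType) (G : finDigraph) (A : cstarType R).
Variables (p : vertex G -> A) (s : edge G -> A).
Hypothesis hA : is_CK p s.
Local Notation C := R[i].
Let ck := is_CK_family hA.
Let gen := is_CK_generates hA.
Local Notation gam := (gauge hA).
Let ca := gauge_action hA.
Let mul1x := ck_mul1x ck gen.
Let mulx1 := ck_mulx1 ck gen.
Local Notation chomog := (chomog hA).
Implicit Types (x y z : A) (n : int).

Definition central x : Prop := forall y, x ** y = y ** x.

Lemma central_approx (D : A -> Prop) x : (forall y, D y -> central y) -> approx D x -> central x.
Proof.
move=> DC Dx y; apply: (@approx_eq _ _ _ D (fun x => x ** y) (fun x => y ** x) _ (nm y)) => //.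
- exact: nm_ge0.
- by move=> u v; rewrite -cmulBl (le_trans (nmM _ _))// mulrC.
- by move=> u v; rewrite -cmulBr (le_trans (nmM _ _)).
- by move=> u /DC ->.
Qed.

Lemma central0 : central 0.
Proof. by move=> y; rewrite cmul0x cmulx0. Qed.

Lemma centralL a x y : central x -> central y -> central (a *: x + y).
Proof. by move=> xC yC z; rewrite cmulDl cmulDr cmulZl cmulZr xC yC. Qed.

Lemma centralM x y : central x -> central y -> central (x ** y).
Proof. by move=> xC yC z; rewrite -cmulA yC cmulA xC cmulA. Qed.

Lemma central_star x : central x -> central (cstar x).
Proof. by move=> xC z; apply: star_inj; rewrite !cstarM cstarK xC. Qed.

Lemma central_sum I (r : seq I) (F : I -> A) : (forall i, central (F i)) ->
  central (\sum_(i <- r) F i).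
Proof.
move=> FC; elim/big_ind: _ => //; first exact: central0.
by move=> x y xC yC; rewrite -[x]scale1r; apply: centralL.
Qed.

Lemma centralZ a x : central x -> central (a *: x).
Proof. by move=> xC; rewrite -[_ *: _]addr0; apply/centralL/central0. Qed.

Lemma central_laurent e u x : central e -> central u -> laurent_like e u x -> central x.
Proof.
move=> eC uC [d [q ->]]; have UC k : central (upow e u k).
  by elim: k => [//|k IH]; apply: centralM.
apply: centralM; first exact/central_star/UC.
by apply: central_sum => i; apply: centralZ.
Qed.

Lemma central_gauge t z : cabs t = 1 -> central z -> central (gam t z).
Proof.
move=> t1 zC y; have t1' : cabs t^-1 = 1 by rewrite cabsV t1 invr1.
have yE : y = gam t (gam t^-1 y).
  by rewrite (ca_comp ca)// mulfV ?(ca_one ca)// cabs1_neq0.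
by rewrite yE -!(star_hom_mul (ca_hom ca t1)) zC.
Qed.

Lemma chomog_fcoef n z : central z -> chomog n (fcoef ca n z).
Proof.
move=> zC; split; last exact: homog_fcoef.
apply: (@central_approx (fun y => central y)) => // e e0.
have [M HM] := fcoefP ca n z e0; exists (avg gam n M z); last by rewrite nmB HM.
by apply/centralZ/central_sum => j; apply/centralZ/central_gauge => //; exact: cabs_omega.
Qed.

(** The Fourier coefficients of a central element are central, so that its Fejer
    means are combinations of homogeneous central elements. *)
Lemma central_span (D : A -> Prop) z (e : A) : D 0 ->
  (forall a x y, D x -> D y -> D (a *: x + y)) ->
  (forall n x, chomog n x -> D (x ** e)) -> nm e <= 1 ->
  central z -> approx D (z ** e).
Proof.
move=> D0 DL De e1 zC d d0; have [N HN] := fejer_dense ca z d0.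
pose S := N.+1%:R^-1 *: \sum_(k < N.+1) \sum_(l < N.+1) fcoef ca (k%:Z - l%:Z) z.
exists (S ** e); last first.
  by rewrite -cmulBl (le_trans (nmM _ _))// -[d]mulr1 ler_pM ?nm_ge0.
have DD x y : D x -> D y -> D (x + y) by move=> Dx; rewrite -[x]scale1r; apply: DL.
rewrite cmulZl cmul_suml -[_ *: _]addr0; apply: DL => //.
elim/big_ind: _ => // k _; rewrite cmul_suml.
by elim/big_ind: _ => // l _; apply/De/chomog_fcoef.
Qed.

Section corner.
Variable e : A.
Hypotheses (eh : chomog 0 e) (es : cstar e = e) (ee : e ** e = e) (e0 : e != 0).
Hypothesis emin : forall z, chomog 0 z -> exists c : C, z ** e = c *: e.

Let e1 : nm e = 1 := nm_proj es ee e0.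
Let eC : central e := eh.1.

(** For [y = x e] the element [y^* y] has degree zero, hence is a scalar multiple
    of [e]; the scalar is real because [y^* y] is self-adjoint, and positive by
    [no_negative_unitary] as [y] is normal. *)
Lemma homog_unitary n x : chomog n x -> x ** e != 0 ->
  exists u (a : C), [/\ chomog n u, u = a *: (x ** e) & corner_unitary e u].
Proof.
move=> xh xe0; pose y := x ** e.
have yh : chomog n y by rewrite -[n]addr0; apply: chomogM.
have ye : y ** e = y by rewrite /y -cmulA ee.
have ey : e ** y = y by rewrite eC.
have sh : chomog 0 (cstar y ** y) by rewrite -(addNr n); apply: chomogM => //; apply: chomog_star.
have [c] := emin sh; rewrite -cmulA ye => yy.
have yy' : y ** cstar y = c *: e by rewrite yh.1.
have cJ : c^* = c.
  apply/eqP; rewrite -subr_eq0; have := congr1 (@cstar R A) yy.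
  rewrite cstarM cstarK yy cstarZ es => /eqP.
  by rewrite eq_sym -subr_eq0 -scalerBl scaler_eq0 (negPf e0) orbF.
pose r := nm y; have r0 : 0 < r by rewrite nm_gt0.
have cr : cabs c = r ^+ 2 by rewrite -nm_starM yy nmZ e1 mulr1.
have rE : cabs r%:C%C = r by rewrite cabsR gtr0_norm.
have rJ : (r%:C%C^-1)^* = r%:C%C^-1 :> C by rewrite fmorphV; congr (_^-1); exact: conjR.
have rr : r%:C%C^-1 * r%:C%C^-1 * (r ^+ 2)%:C%C = 1 :> C.
  by rewrite -invfM -expr2 -rmorphXn /= mulVf// -cabs_eq0 cabsR gt_eqF// normr_gt0 expf_neq0// gt_eqF.
pose u := r%:C%C^-1 *: y.
have uM : cstar u ** u = (r%:C%C^-1 * r%:C%C^-1 * c) *: e.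
  by rewrite cstarZ cmulZl cmulZr yy !scalerA rJ.
have uM' : u ** cstar u = (r%:C%C^-1 * r%:C%C^-1 * c) *: e.
  by rewrite cstarZ cmulZl cmulZr yy' !scalerA rJ.
have cE : c = (r ^+ 2)%:C%C.
  have : `|c| = (r ^+ 2)%:C%C by rewrite cabsE cr.
  have /CrealP := cJ; rewrite realE => /orP[c0|c0]; first by rewrite ger0_norm.
  rewrite ler0_norm// => cN; exfalso; case/eqP: e0.
  have ccN : r%:C%C^-1 * r%:C%C^-1 * c = -1 by rewrite -[c]opprK cN mulrN rr.
  apply: (no_negative_unitary mul1x mulx1 (y := u)) => //.
    by rewrite uM ccN scaleN1r.
  by rewrite uM' ccN scaleN1r.
exists u, (r%:C%C^-1); split => //; first exact: chomogZ.
by split; rewrite ?es ?ee ?uM ?uM' ?cE ?rr ?scale1r// cmulZr ey.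
Qed.

Lemma nm_upow u k : corner_unitary e u -> nm (upow e u k) = 1.
Proof.
move=> cu; apply/eqP; rewrite -(@pexpr_eq1 _ _ 2) ?nm_ge0//.
by rewrite -nm_starM (upow_isom cu) e1.
Qed.

(** As [u] has degree [d > 0], the averages over roots of unity extract the
    coefficients of a polynomial in [u], and they are contractive. *)
Lemma homog_circular (d : nat) u : (0 < d)%N -> chomog d u -> corner_unitary e u ->
  circular e u.
Proof.
move=> d0 uh cu; split => // q i.
have Uh k : homog gam (d * k)%:Z (upow e u k).
  elim: k => [|k IH]; first by rewrite muln0; exact: eh.2.
  by rewrite mulnS PoszD; apply: homogM => //; exact: uh.2.
have [iq|qi] := ltnP i (size q); last by rewrite nth_default// cabs0 nm_ge0.
have avgE : avg gam (d * i)%:Z (d * size q) (peval e u q) = q`_i *: upow e u i.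
  rewrite /peval (big_morph _ (avgD ca _ _) (avg0 ca _ _)) (bigD1 (Ordinal iq))//=.
  rewrite (avgZ ca) (avg_homog (Uh i)) ?subrr// eqxx big1 ?addr0// => k ki.
  rewrite (avgZ ca) (avg_homog (Uh k)); last first.
    have := leq_mul (leqnn d) (ltnW (ltn_ord k)); have := leq_mul (leqnn d) (ltnW iq).
    by move: (d * k)%N (d * i)%N (d * size q)%N => a b c; lia.
  rewrite eqz_nat eqn_pmul2l// ifF ?scaler0//; apply/negP => /eqP ik.
  by case/eqP: ki; exact: val_inj.
by rewrite -[leLHS]mulr1 -(nm_upow i cu) -nmZ -avgE (nm_avg ca).
Qed.

(** If the corner has a nonzero central element of positive degree, let [d] be the
    least such degree and [u] a unitary of degree [d]. Dividing by [u] lowers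
    degrees by [d], so every homogeneous central element is, on the corner, a
    multiple of a power of [u] or of its adjoint. Otherwise only degree zero
    remains, where the corner is scalar. *)
Lemma corner_dichotomy :
  (forall z, central z -> exists c : C, z ** e = c *: e) \/
  exists u, [/\ circular e u, central u &
    forall z, central z -> approx (laurent_like e u) (z ** e)].
Proof.
have [H|/existsNP[d0 /not_implyP[d0_gt /existsNP[x0 /not_implyP[xh0 /eqP x0e]]]]] :=
  pselect (forall d : nat, (0 < d)%N -> forall x, chomog d x -> x ** e = 0).
  left=> z zC; apply: approx_line; apply: central_span => //.
  - by exists 0; rewrite scale0r.
  - by move=> a _ _ [c ->] [c' ->]; exists (a * c + c'); rewrite scalerDl scalerA.
  - move=> n x xh; case: n xh => [[|n]|n] xh; first exact: emin.
      by exists 0; rewrite scale0r (H n.+1).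
    exists 0; rewrite scale0r -[x]cstarK -es -cstarM eC (H n.+1) ?star0//.
    by have := chomog_star xh; rewrite NegzE opprK.
  - by rewrite e1.
right; pose P d := (0 < d)%N && `[< exists2 x, chomog (Posz d) x & x ** e != 0 >].
have exP : exists d, P d by exists d0; apply/andP; split => //; apply/asboolP; exists x0.
have [d /andP[d_gt /asboolP[x xh xe]] dmin] := ex_minnP exP.
have small k y : (0 < k < d)%N -> chomog (Posz k) y -> y ** e = 0.
  move=> /andP[k0 kd] yh; apply/eqP; apply: contraTT kd => ye; rewrite -leqNgt.
  by apply: dmin; rewrite /P k0; apply/asboolP; exists y.
have [u [a [uh ua cu]]] := homog_unitary xh xe.
have cc := homog_circular d_gt uh cu.
have pos (n : nat) : forall y, chomog (Posz n) y -> exists (c : C) k, y ** e = c *: upow e u k.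
  have [m nm_] := ubnP n; elim: m n nm_ => // m IH n nm_ y yh.
  have [nd|dn] := ltnP n d.
    case: n nm_ nd yh => [|n] nm_ nd yh; first by have [c yc] := emin yh; exists c, 0%N.
    by exists 0, 0%N; rewrite scale0r (small n.+1).
  pose z := cstar u ** y; have zh : chomog (Posz (n - d)) z.
    by rewrite -subzn// addrC; apply: chomogM => //; apply: chomog_star.
  have [|c [k zc]] := IH (n - d)%N _ z zh; first by lia.
  exists c, k.+1; have -> : y ** e = u ** (z ** e).
    by rewrite /z !cmulA (cu_coisom cu) eC -cmulA ee.
  by rewrite zc cmulZr.
exists u; split => //; first exact: uh.1.
move=> z zC.
apply: central_span => //; last by rewrite e1.
- by exists 0%N, 0; rewrite /laurent peval0 cmulx0.
- move=> b _ _ [k [q ->]] [k' [q' ->]].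
  by exists (k + k')%N, (b *: ('X^k' * q) + 'X^k * q'); rewrite -laurentL.
- move=> n y yh; have mono_ (c : C) k : laurent_like e u (c *: upow e u k).
    by exists 0%N, (c *: 'X^k); rewrite /laurent /= es pevalZ pevalXn cmulZr (cmul_e_upow cu).
  case: n yh => n yh; first by have [c [k ->]] := pos _ _ yh.
  have [|c [k yc]] := pos n.+1 (cstar y).
    by have := chomog_star yh; rewrite NegzE opprK.
  have -> : y ** e = c^* *: cstar (upow e u k).
    by rewrite -cstarZ -yc cstarM cstarK es eC.
  exists k, (c^*%:P); rewrite /laurent pevalC cmulZr (star_upow_e cu) //.
Qed.

End corner.

End homogeneous_corner.

(** * Decomposition of the center *)

Section inverse.
Variables (R : realType) (A B : cstarType R).

Lemma cstar_isomorphic_inv (psi : B -> A) : star_hom psi -> injective psi ->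
  (forall a, exists b, psi b = a) -> cstar_isomorphic A B.
Proof.
move=> psiH psi_inj /choice[phi phiK]; exists phi; split; last first.
  by exists psi => // b; apply: psi_inj; rewrite phiK.
split=> [a x y|x y|x]; apply: psi_inj.
- by rewrite (star_hom_linear psiH) !phiK.
- by rewrite (star_hom_mul psiH) !phiK.
- by rewrite (star_hom_star psiH) !phiK.
Qed.

End inverse.

Section center_sum.
Variables (R : realType) (A : cstarType R) (one : A).
Hypothesis mulx1 : forall x : A, x ** one = x.
Local Notation C := R[i].

(** The isomorphism is constructed from the direct sum to the center: a scalar
    is sent to a multiple of its projection, and a function on the circle to its
    image under the isomorphism of [circular_iso], which takes the identity
    function of the circle to the circular unitary. The summands multiply
    independently because the projections are orthogonal, and cutting down by
    [e i] recovers the components. *)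
Lemma center_direct_sum (m : nat) (e : 'I_m -> A) :
  (forall i, [/\ central (e i), cstar (e i) = e i, e i ** e i = e i & e i != 0]) ->
  (forall i j, i != j -> e i ** e j = 0) -> \sum_i e i = one ->
  (forall i, (forall z, central z -> exists c : C, z ** e i = c *: e i) \/
    exists u, [/\ circular (e i) u, central u &
      forall z, central z -> approx (laurent_like (e i) u) (z ** e i)]) ->
  exists k l : nat, cstar_isomorphic (cstar_center A)
    ({ffun 'I_k -> cplx R} * {ffun 'I_l -> circle_cfun R})%type.
Proof.
move=> eP eorth esum dich.
pose b : {pred 'I_m} := fun i => `[< forall z, central z -> exists c : C, z ** e i = c *: e i >].
pose b' : {pred 'I_m} := [predC b].
have b'P i : (i \in b') = (i \notin b) by [].
exists #|b|, #|b'|.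
have /choice[psi psiP] : forall i, exists psi : circle_cfun R -> A, i \in b' ->
  [/\ star_hom psi, injective psi, forall g, central (psi g) /\ psi g ** e i = psi g &
    forall z, central z -> exists g, psi g = z ** e i].
  move=> i; have [ib|ib] := boolP (i \in b'); last by exists (fun=> 0).
  have [eC es ee e0] := eP i.
  case: (dich i) => [H|[u [cu uC udense]]]; first by case/negP: ib; apply/asboolP.
  have [psi [h1 h2 h3 h4]] := circular_iso (circle_circular R) cu (@circle_dense R).
  exists psi => _; split => //; last by move=> z /udense /h4.
  move=> g; have gC : central (psi g).
    apply: central_approx (h3 g) => y; exact: central_laurent.
  split => //; rewrite gC; apply: (@approx_eq _ _ _ _ (fun y => e i ** y) id _ 1 _ _ _ _ (h3 g)).
  - exact: ler01.
  - by move=> y z; rewrite -cmulBr (le_trans (nmM _ _))// (nm_proj es ee e0).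
  - by move=> y z; rewrite mul1r.
  - by move=> _ [d [q ->]]; rewrite (e_laurent (circ_unitary cu)).
(* The summands, scalars first, and their positions among the [e i]. *)
pose I := ('I_#|b| + 'I_#|b'|)%type.
pose io (t : I) : 'I_m := match t with inl i => enum_val i | inr j => enum_val j end.
have io_inj t t' : io t = io t' -> t = t'.
  case: t t' => [i|j] [i'|j'] //= H; rewrite ?(enum_val_inj H)//.
    by have := enum_valP j'; rewrite -H b'P (enum_valP i).
  by have := enum_valP j; rewrite H b'P (enum_valP i').
have eiorth t t' : t != t' -> e (io t) ** e (io t') = 0.
  by move=> tt'; apply: eorth; apply: contra_neq tt' => /io_inj.
have sumI (F : 'I_m -> A) : \sum_i F i = \sum_(t : I) F (io t).
  rewrite (bigID [in b]) big_sumType /=; congr (_ + _); first exact: big_enum_val.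
  by transitivity (\sum_(i in b') F i); [exact: eq_bigl|exact: big_enum_val].
set P := ({ffun _ -> _} * {ffun _ -> _})%type.
pose W (t : I) (x : P) : A := match t with
  | inl i => (x.1 i : C) *: e (enum_val i) | inr j => psi (enum_val j) (x.2 j) end.
have psiH (j : 'I_#|b'|) := psiP (enum_val j) (enum_valP j).
have WL t a x y : W t (a *: x + y) = a *: W t x + W t y.
  case: t => [i|j] /=.
    by rewrite !ffunE scalerDl -scalerA.
  by have [h _ _ _] := psiH j; rewrite !ffunE (star_hom_linear h).
have WM t x y : W t (x ** y) = W t x ** W t y.
  case: t => [i|j] /=.
    rewrite ffun_cmulE cplx_cmulE cmulZl cmulZr scalerA.
    by have [_ _ -> _] := eP (enum_val i).
  by have [h _ _ _] := psiH j; rewrite ffun_cmulE (star_hom_mul h).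
have WS t x : W t (cstar x) = cstar (W t x).
  case: t => [i|j] /=.
    rewrite ffun_cstarE cplx_cstarE cstarZ.
    by have [_ -> _ _] := eP (enum_val i).
  by have [h _ _ _] := psiH j; rewrite ffun_cstarE (star_hom_star h).
have WC t x : central (W t x).
  case: t => [i|j] /=; first by apply: centralZ; have [] := eP (enum_val i).
  by have [_ _ h _] := psiH j; have [] := h (x.2 j).
have We t x : W t x ** e (io t) = W t x.
  case: t => [i|j] /=; first by rewrite cmulZl; have [_ _ -> _] := eP (enum_val i).
  by have [_ _ h _] := psiH j; have [] := h (x.2 j).
have eC i : central (e i) by have [] := eP i.
have Worth t t' x : t != t' -> W t x ** e (io t') = 0.
  by move=> tt'; rewrite -We -cmulA eiorth// cmulx0.
pose S x := \sum_(t : I) W t x.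
have SC x : S x \in cstar_central A by apply/centralP/central_sum.
have Se x t : S x ** e (io t) = W t x.
  rewrite /S cmul_suml (bigD1 t)//= We big1 ?addr0// => t' t't.
  by rewrite Worth.
have Sinj x y : (forall t, W t x = W t y) -> x = y.
  case: x y => [x1 x2] [y1 y2] H; congr (_, _); apply/ffunP => i.
    have [_ _ _ e0] := eP (enum_val i).
    have /eqP := H (inl i); rewrite /= -subr_eq0 -scalerBl scaler_eq0 (negPf e0) orbF.
    by rewrite subr_eq0 => /eqP.
  by have [_ inj _ _] := psiH i; apply: inj; exact: (H (inr i)).
apply: (@cstar_isomorphic_inv _ _ _ (fun x => CStarCenter (SC x))).
- split=> [a x y|x y|x]; apply: val_inj => /=.
  + by rewrite /S scaler_sumr -big_split; apply: eq_bigr => t _.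
  + rewrite /S [RHS]cmul_suml; apply: eq_bigr => t _.
    rewrite WM cmul_sumr (bigD1 t)//= big1 ?addr0// => t' t't.
    by rewrite -(We t x) -cmulA (eC (io t)) Worth// cmulx0.
  + by rewrite /S [RHS]star_sum; apply: eq_bigr => t _.
- move=> x y /(congr1 val) /= SS; apply: Sinj => t; rewrite -!Se; congr (_ ** _).
  exact: SS.
move=> z; have zC : central (center_val z) by case: z => z zP; apply/centralP.
have /choice[x1 x1P] : forall i : 'I_#|b|, exists c : C, center_val z ** e (enum_val i) = c *: e (enum_val i).
  by move=> i; have /asboolP := enum_valP i; apply.
have /choice[x2 x2P] : forall j : 'I_#|b'|, exists g, psi (enum_val j) g = center_val z ** e (enum_val j).
  by move=> j; have [_ _ _] := psiH j; apply.
exists ([ffun i => x1 i : cplx R], [ffun j => x2 j]); apply: val_inj => /=.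
rewrite -[RHS]mulx1 -esum cmul_sumr sumI; apply: eq_bigr => -[i|j] _ /=; rewrite ffunE.
  by rewrite x1P.
by rewrite x2P.
Qed.

End center_sum.

Theorem corollary2 (R : realType) (G : finDigraph)
    (A : cstarType R) (p : vertex G -> A) (s : edge G -> A)
    (hA : is_CK p s) :
  exists k l : nat,
    cstar_isomorphic (cstar_center A)
      ({ffun 'I_k -> cplx R} * {ffun 'I_l -> circle_cfun R})%type.
Proof.
have [m [e [eP eorth emin esum]]] := minimal_projections hA.
apply: (center_direct_sum (ck_mulx1 (is_CK_family hA) (is_CK_generates hA)) (e := e)) => //.
- by move=> i; have [[eC _] es ee e0] := eP i.
- move=> i; have [eh es ee e0] := eP i.
  by apply: (corner_dichotomy (hA := hA)) => // z; apply: emin.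
Qed.
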